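(* Let $\beta=1$ and $\rho>0$, and let $$r_c(\rho)=\frac{1+2\sqrt\rho}{\rho}\log\left(1+\frac{\rho}{1+2\sqrt\rho}\right)+2\log(1+\sqrt\rho)-1 .$$ For every $r>r_c(\rho)$ there is a unique $k>0$ with $$r-\log\rho=(k+1)\log(k+1)-k\log k-1 .$$ With this $k$ set $$a=\left(\sqrt{k+1}-1\right)^2-\rho^{-1},\qquad b=\left(\sqrt{k+1}+1\right)^2-\rho^{-1}.$$ Then the function $$p(x)=\frac{\rho}{2\pi}\,\frac{\sqrt{(b-x)(x-a)}}{1+\rho x}\quad(a\le x\le b),\qquad p(x)=0\ \text{ otherwise},$$ is the unique minimizer of $\mathcal{E}$ over $\mathcal{X}_r$, and $$\mathcal{E}_1(r)-\mathcal{E}_0=\frac{k-1}{2}(r-\log\rho)+k-\frac12-\rho^{-1}-\frac{k\log k}{2}.$$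
   Context: An integrable function $p:\mathbb{R}_+\to\mathbb{R}$ is called tame if $\int_0^\infty x|p(x)|\,dx<\infty$ and there is some $\varepsilon>0$ with $\int_0^\infty|p(x)|^{1+\varepsilon}dx<\infty$. Let $\Omega$ be the set of tame functions (identified when equal almost everywhere). For $\beta\ge 1$ and $p\in\Omega$ the energy functional is $$\mathcal{E}[p]=\int_0^\infty x\,p(x)\,dx-(\beta-1)\int_0^\infty p(x)\log x\,dx-\int_0^\infty\!\!\int_0^\infty p(x)p(y)\log|x-y|\,dx\,dy ;$$ here $\beta=1$, so the middle term is absent. $\mathcal{X}=\{p\in\Omega: p\ge0,\ \int_0^\infty p(x)\,dx=1\}$ and, for given $\rho>0$ and $r>0$, $\mathcal{X}_r=\{p\in\mathcal{X}:\int_0^\infty p(x)\log(1+\rho x)\,dx=r\}$. Set $\mathcal{E}_0=\inf_{q\in\mathcal{X}}\mathcal{E}[q]$ and $\mathcal{E}_1(r)=\inf_{q\in\mathcal{X}_r}\mathcal{E}[q]$. Here $\log$ is the natural logarithm. *)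

(* Defs.v *)
From HB Require Import structures.
From mathcomp Require Import all_boot all_order all_algebra.
From mathcomp Require Import all_classical all_reals all_analysis.

Set Implicit Arguments.
Unset Strict Implicit.
Unset Printing Implicit Defensive.

Import Order.TTheory GRing.Theory Num.Theory.
Import numFieldNormedType.Exports.

Local Open Scope classical_set_scope.
Local Open Scope ring_scope.

(* A function on the half line [0, +oo[ is represented by a total function
   R -> R; only its values on [0, +oo[ ever matter. *)
Definition halfline (R : realType) : set R := `[0, +oo[.
Arguments halfline R : clear implicits.

Definition tame (R : realType) (p : R -> R) : Prop :=
  [/\ lebesgue_measure.-integrable (halfline R) (EFin \o p),
      (\int[lebesgue_measure]_(x in halfline R) (x * `|p x|)%:E < +oo)%E
    & exists2 eps : R, 0 < eps &
      (\int[lebesgue_measure]_(x in halfline R)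
          (`|p x| `^ (1 + eps))%:E < +oo)%E].

(* The values ln 0 = 0 at x = 0 and on the diagonal x = y are conventional;
   both sets are negligible. For tame p all three integrals are finite. *)
Definition energy (R : realType) (beta : R) (p : R -> R) : \bar R :=
  (\int[lebesgue_measure]_(x in halfline R) (x * p x)%:E
   - (beta - 1)%:E
     * \int[lebesgue_measure]_(x in halfline R) (p x * ln x)%:E
   - \int[lebesgue_measure \x lebesgue_measure]_(z in
         halfline R `*` halfline R)
       (p z.1 * p z.2 * ln `|z.1 - z.2|)%:E)%E.

(* Since functions are identified when equal almost everywhere, p >= 0 is
   required almost everywhere. *)
Definition density (R : realType) : set (R -> R) :=
  [set p | [/\ tame p,
    {ae lebesgue_measure, forall x : R, halfline R x -> 0 <= p x}
    & (\int[lebesgue_measure]_(x in halfline R) (p x)%:E = 1)%E]].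

Definition density_at (R : realType) (rho r : R) : set (R -> R) :=
  [set p | density p /\
    (\int[lebesgue_measure]_(x in halfline R)
        (p x * ln (1 + rho * x))%:E = r%:E)%E].

Definition energy0 (R : realType) (beta : R) : \bar R :=
  ereal_inf [set energy beta q | q in @density R].

Definition energy1 (R : realType) (beta rho r : R) : \bar R :=
  ereal_inf [set energy beta q | q in density_at rho r].

Definition minimizer (R : realType) (F : (R -> R) -> \bar R)
    (S : set (R -> R)) (p : R -> R) : Prop :=
  S p /\ forall q, S q -> (F p <= F q)%E.

Definition unique_minimizer (R : realType) (F : (R -> R) -> \bar R)
    (S : set (R -> R)) (p : R -> R) : Prop :=
  minimizer F S p /\ forall q, minimizer F S q ->
    q = p %[ae lebesgue_measure in halfline R].

Definition r_crit (R : realType) (rho : R) : R :=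
  (1 + 2 * Num.sqrt rho) / rho * ln (1 + rho / (1 + 2 * Num.sqrt rho))
  + 2 * ln (1 + Num.sqrt rho) - 1.

Definition edge_a (R : realType) (rho k : R) : R :=
  (Num.sqrt (k + 1) - 1) ^+ 2 - rho^-1.

Definition edge_b (R : realType) (rho k : R) : R :=
  (Num.sqrt (k + 1) + 1) ^+ 2 - rho^-1.

Definition opt_density (R : realType) (rho k : R) (x : R) : R :=
  if edge_a rho k <= x <= edge_b rho k
  then rho / (2 * pi)
       * (Num.sqrt ((edge_b rho k - x) * (x - edge_a rho k)) / (1 + rho * x))
  else 0.

(* Main.v *)
Require Import Defs.
From HB Require Import structures.
From mathcomp Require Import all_boot all_order all_algebra.
From mathcomp Require Import all_classical all_reals all_analysis.
From mathcomp Require Import measurable_realfun.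
From mathcomp Require Import ring lra.

(** Put [d = 1/rho] and [y = x + d].  The candidate density is the Marchenko-Pastur density
    [sqrt (4 y - (y - k)^2) / (2 pi y)], which is the average over [0 < t < 1] of the arcsine
    laws with centre [2 t + k] and half-width [2 sqrt (t (t + k))].  The logarithmic potential of
    an arcsine law is elementary: with [L X] the integral of [ln |X + 2 cos|] over [[0, pi]],
    doubling the angle gives [2 L X = L (X^2 - 2)], so [L] vanishes on [[-2, 2]] because it is
    bounded there, and [L (z + 1/z) = pi ln z] for [z > 1].  Integrating over [t] shows that the
    potential [W] satisfies the Euler-Lagrange condition
    [x - 2 W x >= c + k ln (x + d)], with equality on the support.

    For a competitor [q] this gives [E q - E p >= - J (q - p)], where [J f] is the double integral
    of [f x f y ln |x - y|].  Frullani's formula writes [- ln |x|] as the integral over [s > 0] of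
    [(max 0 (1 - s |x|) - max 0 (1 - s)) / s], and the first kernel is the autocorrelation of an
    interval of length [1/s].  Hence, when [f] has mean zero, [- J f] is an integral of squares of
    the masses of [f] on intervals; it is nonnegative, and by Lebesgue differentiation it vanishes
    only when [f = 0] almost everywhere.  The unconstrained minimum is the case [k = d = 0]. *)

Set Implicit Arguments.
Unset Strict Implicit.
Unset Printing Implicit Defensive.

Import Order.TTheory GRing.Theory Num.Theory.
Import numFieldNormedType.Exports.

Local Open Scope classical_set_scope.
Local Open Scope ring_scope.

(** The constraint enters through [ln (1 + rho * x) = ln rho + ln (x + d)], so with multiplier [k]
    the effective field is [y - k ln y] up to a constant. This is the Laguerre field, whose
    equilibrium law is the Marchenko-Pastur law; hence the candidate. Up to [ln rho] the constraint
    value is the potential of the candidate at [y = 0], namely [(k+1) ln (k+1) - k ln k - 1]. The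
    threshold [r_crit] is its value at [k = d + 2 sqrt d], where the lower edge [(sqrt (k+1) - 1)^2]
    equals [d], that is [a = 0]; above it the support lies inside the half line. The mixture is
    useful because its parameter enters the discriminant [4 t y - (y - k)^2] linearly, so every
    average over [t] has an elementary antiderivative and no principal values occur. The main
    obstacle is integrability under logarithmic singularities. Potentials of the candidate are
    computed by Tonelli on [M - ln |x - z|], with [M] a bound on the support. The Frullani kernel
    has constant sign in [s], so absolute integrability passes through it. A competitor whose
    interaction is not integrable has energy [+oo], because on the half line the positive part of
    the interaction is controlled by first moments. *)

Lemma measure_eq_of_rays (R : realType)
    (m1 m2 : {measure set (measurableTypeR R) -> \bar R}) :
  (forall d, m1 `]-oo, d[%classic = m2 `]-oo, d[%classic) ->
  (m1 setT < +oo)%E -> forall A, measurable A -> m1 A = m2 A.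
Proof.
move=> m12 m1oo A mA.
have := (@measure_unique _ R (measurableTypeR R) (@RGenInftyO.G R)
  (fun n => `]-oo, n%:R[%classic)) => H; apply: H => //.
- exact: RGenInftyO.measurableE.
- move=> _ _ [x ->] [y ->]; exists (Num.min x y).
  apply/seteqP; split => z /=; rewrite !in_itv/= lt_min; first by case=> -> ->.
  by move/andP.
- by move=> n; eexists.
- rewrite -subTset => x _; exists (Num.truncn `|x|).+1 => //=.
  rewrite in_itv/=; apply: le_lt_trans (ler_norm x) _.
  by rewrite truncnS_gt.
- by move=> _ [d ->]; exact: m12.
- move=> n; apply: le_lt_trans m1oo; apply: le_measure => //; rewrite ?inE//.
Qed.

Lemma integral_constant d (T : measurableType d) (R : realType)
    (mu : {measure set T -> \bar R}) (D : set T) (r : \bar R) :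
  measurable D -> (\int[mu]_(x in D) r = r * mu D)%E.
Proof. by move=> mD; exact: integral_cst. Qed.

Lemma integrable_constant d (T : measurableType d) (R : realType)
    (mu : {measure set T -> \bar R}) (D : set T) (r : R) :
  measurable D -> (mu D < +oo)%E -> mu.-integrable D (fun=> r%:E).
Proof.
by move=> mD Doo; apply: measurable_bounded_integrable => //; exact: bounded_cst.
Qed.

(** * Change of variables *)

Section Transfer.
Context (R : realType).
Notation mu := (@lebesgue_measure R).
Local Open Scope ereal_scope.

Section Transfer_fun.
Variables (D E : set (measurableTypeR R))
  (phi psi : measurableTypeR R -> measurableTypeR R).
Hypotheses (mD : measurable D) (mE : measurable E) (Eoo : mu E < +oo).
Hypotheses (mphi : measurable_fun setT phi) (mpsi : measurable_fun setT psi).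
Hypothesis psi0 : forall x, D x -> (0 <= psi x)%R.
Hypothesis ray : forall d,
  \int[mu]_(x in D `&` phi @^-1` `]-oo, d[) (psi x)%:E = mu (E `&` `]-oo, d[).
Hypothesis tot : \int[mu]_(x in D) (psi x)%:E = mu E.

Let image_density (A : set (measurableTypeR R)) : \bar R :=
  \int[mu]_(x in D `&` phi @^-1` A) (psi x)%:E.

Let mpre A : measurable A -> measurable (D `&` phi @^-1` A).
Proof. by move=> mA; apply: measurableI => //; rewrite -[X in measurable X]setTI; exact: mphi. Qed.

Let image_density0 : image_density set0 = 0.
Proof. by rewrite /image_density preimage_set0 setI0 integral_set0. Qed.

Let image_density_ge0 A : 0 <= image_density A.
Proof. by apply: integral_ge0 => x [Dx _]; rewrite lee_fin psi0. Qed.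

Let image_density_sigma_additive : semi_sigma_additive image_density.
Proof.
move=> /= F mF tF mUF; rewrite /image_density; apply: cvg_toP.
  apply: ereal_nondecreasing_is_cvgn => m n mn.
  by apply: lee_sum_nneg_natr => // k _ _; exact: image_density_ge0.
rewrite preimage_bigcup setI_bigcupr ge0_integral_bigcup//=.
- by move=> k; exact: mpre.
- exact/measurable_EFinP/measurable_funTS.
- by move=> x [k _ [Dx _]]; rewrite lee_fin psi0.
- apply/trivIsetP => i j _ _ ij; move/trivIsetP: tF => /(_ i j I I ij) Fij.
  by rewrite setIACA setIid -preimage_setI Fij preimage_set0 setI0.
Qed.

HB.instance Definition _ := isMeasure.Build _ _ _ image_density
  image_density0 image_density_ge0 image_density_sigma_additive.

Let image_densityE A : measurable A -> image_density A = mu (A `&` E).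
Proof.
move=> mA.
have := @measure_eq_of_rays R image_density (mrestr mu mE).
rewrite /mrestr /= => -> //.
- by move=> d; rewrite /image_density ray setIC.
- by rewrite /image_density preimage_setT setIT tot.
Qed.

Import HBNNSimple.

Let transfer_indic A : measurable A ->
  \int[mu]_(x in D) ((\1_A (phi x))%:E * (psi x)%:E) =
  \int[mu]_(y in E) (\1_A y)%:E.
Proof.
move=> mA; transitivity (image_density A); last first.
  by rewrite image_densityE// integral_indic.
rewrite /image_density.
rewrite integral_mkcondr; apply: eq_integral => x xD; rewrite patchE.
rewrite indicE (_ : (x \in phi @^-1` A) = (phi x \in A)); last first.
  by apply/idP/idP; rewrite !inE.
by case: ifPn => xA; rewrite ?mul1e ?mul0e.
Qed.

Let transfer_nnsfun (f : {nnsfun (measurableTypeR R) >-> R}) :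
  \int[mu]_(x in D) ((f (phi x))%:E * (psi x)%:E) = \int[mu]_(y in E) (f y)%:E.
Proof.
under [RHS]eq_integral do rewrite fimfunE -fsumEFin//.
rewrite [RHS]ge0_integral_fsum//; last 2 first.
  - move=> r; apply/measurable_EFinP; apply: measurable_funTS.
    exact/measurableT_comp.
  - by move=> n x _; rewrite EFinM nnfun_muleindic_ge0.
under [LHS]eq_integral.
  move=> x xD; rewrite fimfunE -fsumEFin// muleC ge0_mule_fsumr; last first.
    by move=> r; rewrite EFinM nnfun_muleindic_ge0.
  over.
have mi r : measurable_fun setT (fun x => (r * \1_(f @^-1` [set r]) x)%R).
  exact/measurableT_comp.
have mi' r : measurable_fun setT (fun x => (\1_(f @^-1` [set r]) (phi x))%R : R).
  by apply: measurableT_comp => //; exact: mphi.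
rewrite ge0_integral_fsum//; last 2 first.
  - move=> r; apply/measurable_EFinP; apply: measurable_funM.
      exact: measurable_funTS.
    apply: measurable_funM => //; exact: measurable_funTS (mi' r).
  - move=> n x Dx; rewrite EFinM mule_ge0//; last by rewrite nnfun_muleindic_ge0.
    by rewrite lee_fin psi0.
apply: eq_fsbigr => r _.
have [->|r0] := eqVneq r 0%R.
  by under eq_integral do rewrite mul0r mule0;
     under [in RHS]eq_integral do rewrite mul0r; rewrite !integral0.
have [rf|rf] := pselect (range f r); last first.
  rewrite preimage10//.
  by under eq_integral do rewrite indic0 mulr0 mule0;
     under [in RHS]eq_integral do rewrite indic0 mulr0; rewrite !integral0.
have r_ge0 : (0 <= r)%R by case: rf => x _ <-; exact: fun_ge0.
under eq_integral do rewrite EFinM muleCA (muleC (psi _)%:E).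
rewrite ge0_integralZl//; last 2 first.
- apply: emeasurable_funM; apply/measurable_EFinP; exact: measurable_funTS.
- by move=> x Dx; rewrite mule_ge0 ?lee_fin ?psi0.
rewrite transfer_indic//.
under [RHS]eq_integral do rewrite EFinM.
by rewrite ge0_integralZl//; apply/measurable_EFinP; exact: measurable_indic.
Qed.

(** The image under [phi] of the measure with density [psi] on [D] is finite and agrees on rays with
    Lebesgue measure on [E], hence on all measurable sets. Simple functions and monotone limits do
    the rest. No continuity of [f] enters, so singular integrands can be substituted. *)
Lemma ge0_integral_transfer (f : measurableTypeR R -> \bar R) :
  measurable_fun setT f -> (forall x, 0 <= f x) ->
  \int[mu]_(x in D) (f (phi x) * (psi x)%:E) = \int[mu]_(y in E) f y.
Proof.
move=> mf f0; pose f_ := nnsfun_approx measurableT mf.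
transitivity (lim (\int[mu]_(y in E) (f_ n y)%:E @[n --> \oo])); last first.
  rewrite -monotone_convergence//=.
  - apply: eq_integral => ? /[!inE] xD; apply/cvg_lim => //=.
    exact: cvg_nnsfun_approx.
  - by move=> n; apply/measurable_EFinP; apply: measurable_funTS; exact: measurable_funP.
  - by move=> n ? _; rewrite lee_fin.
  - by move=> ? _ ? ? mn; rewrite lee_fin; exact/lefP/nd_nnsfun_approx.
rewrite (_ : (fun n => \int[mu]_(y in E) (f_ n y)%:E) =
    fun n => \int[mu]_(x in D) ((f_ n (phi x))%:E * (psi x)%:E)); last first.
  by apply/funext => n; rewrite transfer_nnsfun.
rewrite -monotone_convergence//=.
- apply: eq_integral => x /[!inE] xD; apply/esym/cvg_lim => //=.
  apply: cvgeZr => //; exact: cvg_nnsfun_approx.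
- move=> n; apply: emeasurable_funM; last exact/measurable_EFinP/measurable_funTS.
  by apply/measurable_EFinP/measurable_funTS; apply: measurableT_comp.
- by move=> n x Dx; rewrite mule_ge0 ?lee_fin ?psi0.
- move=> x Dx m n mn; apply: lee_wpmul2r; first by rewrite lee_fin psi0.
  by rewrite lee_fin; exact/lefP/nd_nnsfun_approx.
Qed.

(** Multiplication by the nonnegative weight commutes with taking positive and negative parts, so
    the identity holds part by part, without integrability. *)
Lemma integral_transfer (f : measurableTypeR R -> \bar R) :
  measurable_fun setT f ->
  \int[mu]_(x in D) (f (phi x) * (psi x)%:E) = \int[mu]_(y in E) f y.
Proof.
move=> mf; rewrite [LHS]integralE [RHS]integralE; congr (_ - _).
- rewrite -ge0_integral_transfer//; last exact: measurable_funepos.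
  apply: eq_integral => x; rewrite inE => Dx; rewrite !funeposE.
  by rewrite !(muleC _ (psi x)%:E) maxe_pMr ?mule0 ?lee_fin ?psi0.
- rewrite -ge0_integral_transfer//; last exact: measurable_funeneg.
  apply: eq_integral => x; rewrite inE => Dx; rewrite !funenegE.
  by rewrite !(muleC _ (psi x)%:E) -muleN maxe_pMr ?mule0 ?lee_fin ?psi0.
Qed.

End Transfer_fun.
End Transfer.

(** * Substitution along increasing maps, reflections and translations *)

Section FTC.
Context (R : realType).
Notation mu := (@lebesgue_measure R).

Lemma FTC_is_derive (f F : R -> R) (a b : R) : a <= b ->
  {within `[a, b], continuous f} -> {within `[a, b], continuous F} ->
  (forall x : R, x \in `]a, b[ -> is_derive x 1 F (f x)) ->
  (\int[mu]_(x in `[a, b]) (f x)%:E = (F b - F a)%:E)%E.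
Proof.
rewrite le_eqVlt => /predU1P[->|ab] cf cF dF.
  by rewrite set_itv1 integral_set1 subrr.
have [cF1 Fa Fb] := (continuous_within_itvP F ab).1 cF.
rewrite (@continuous_FTC2 _ _ F _ _ ab cf) ?EFinB//.
- by split => // x xab; have [] := dF x xab.
- by move=> x xab; rewrite derive1E; have [_ ->] := dF x xab.
Qed.

Lemma continuous_is_derive (f : R -> R) (x df : R) : is_derive x 1 f df ->
  {for x, continuous f}.
Proof.
case=> d1 _; apply: differentiable_continuous; exact/derivable1_diffP.
Qed.

Lemma continuous_within (f : R -> R) (A : set R) : (forall x, A x -> {for x, continuous f}) ->
  {within A, continuous f}.
Proof.
move=> cf; apply: continuous_in_subspaceT => x; rewrite inE; exact: cf.
Qed.

Section increasing.
Variables (phi psi : R -> R) (a b : R).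
Hypothesis ab : a < b.
Hypothesis dphi : forall x : R, is_derive x 1 phi (psi x).
Hypothesis cpsi : continuous psi.
Hypothesis psi_gt0 : forall x, a < x < b -> 0 < psi x.

Let cphi : continuous phi.
Proof. by move=> x; exact: continuous_is_derive. Qed.

Let phi_incr x y : a <= x -> x < y -> y <= b -> phi x < phi y.
Proof.
apply: gtr0_derive1_incr => //.
- move=> z; rewrite in_itv/= => /psi_gt0.
  by rewrite derive1E; have [_ ->] := dphi z.
- apply: continuous_subspaceT => ?; by [].
Qed.

Let int_psi c : a <= c -> (\int[mu]_(x in `]a, c[) (psi x)%:E = (phi c - phi a)%:E)%E.
Proof.
move=> ac; rewrite -(@integral_itv_bndoo _ _ _ _ true false); last first.
  by apply/measurable_EFinP/measurable_funTS; exact: continuous_measurable_fun.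
by rewrite (@FTC_is_derive psi phi)//; apply: continuous_subspaceT => ?; by [].
Qed.

Let ray d : (\int[mu]_(x in `]a, b[ `&` phi @^-1` `]-oo, d[) (psi x)%:E =
  mu (`]phi a, phi b[ `&` `]-oo, d[))%E.
Proof.
have phiab := phi_incr (lexx a) ab (lexx b).
have [da|da] := leP d (phi a).
  rewrite (_ : _ `&` _ = set0) ?integral_set0; last first.
    apply/seteqP; split => // x [/=]; rewrite !in_itv/= => /andP[ax xb] xd.
    by have := lt_trans (lt_le_trans xd da) (phi_incr (lexx a) ax (ltW xb)); rewrite ltxx.
  rewrite (_ : _ `&` _ = set0) ?measure0//.
  apply/seteqP; split => // x [/=]; rewrite !in_itv/= => /andP[ax xb] xd.
  by have := lt_trans (lt_le_trans xd da) ax; rewrite ltxx.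
have [bd|bd] := leP (phi b) d.
  rewrite setIidl; last first.
    move=> x /=; rewrite !in_itv/= => /andP[ax xb].
    by apply: lt_le_trans bd; exact: phi_incr (ltW ax) xb _.
  rewrite setIidl; last first.
    by move=> x /=; rewrite !in_itv/= => /andP[ax xb]; apply: lt_le_trans bd.
  by rewrite int_psi ?ltW// lebesgue_measure_itv/= lte_fin phiab EFinB.
have [||c] := @IVT R phi a b d (ltW ab).
- apply: continuous_subspaceT => ?; by [].
- by rewrite ge_min le_max (ltW da) (ltW bd) orbT.
rewrite in_itv/= => /andP[ac cb] cd.
rewrite (_ : _ `&` _ = `]a, c[%classic); last first.
  apply/seteqP; split => x /=; rewrite !in_itv/=.
    move=> [/andP[ax xb] xd]; rewrite ax/= ltNge; apply/negP; rewrite le_eqVlt.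
    move=> /predU1P[cx|cx]; first by move: xd; rewrite -cx cd ltxx.
    by have := lt_trans (phi_incr ac cx (ltW xb)) xd; rewrite cd ltxx.
  move=> /andP[ax xc]; rewrite ax (lt_le_trans xc cb); split => //.
  by rewrite -cd; exact: phi_incr (ltW ax) xc cb.
rewrite (_ : _ `&` _ = `]phi a, d[%classic); last first.
  apply/seteqP; split => x /=; rewrite !in_itv/=; first by case=> /andP[-> _] ->.
  by move=> /andP[-> xd]; rewrite xd (lt_trans xd bd).
by rewrite int_psi// lebesgue_measure_itv/= lte_fin da EFinB cd.
Qed.

Let tot : (\int[mu]_(x in `]a, b[) (psi x)%:E = mu `]phi a, phi b[)%E.
Proof.
have phiab := phi_incr (lexx a) ab (lexx b).
by rewrite int_psi ?ltW// lebesgue_measure_itv/= lte_fin phiab EFinB.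
Qed.

Let mphi : measurable_fun setT phi. Proof. exact: continuous_measurable_fun. Qed.
Let mpsi : measurable_fun setT psi. Proof. exact: continuous_measurable_fun. Qed.
Let psi0 x : `]a, b[%classic x -> (0 <= psi x)%R.
Proof. by rewrite /= in_itv/= => /psi_gt0/ltW. Qed.
Let Eoo : (mu `]phi a, phi b[ < +oo)%E.
Proof. by rewrite lebesgue_measure_itv/=; case: ifPn => // _; rewrite -EFinB ltry. Qed.

Local Open Scope ereal_scope.
(** The preimage of a ray is cut at the point given by the intermediate value theorem, and its
    weight comes from the fundamental theorem. Positivity of [psi] is asked only inside the interval
    since the substitutions by powers and by cosines have derivatives vanishing at end points. *)
Lemma ge0_integral_subst_increasing (f : measurableTypeR R -> \bar R) :
  measurable_fun setT f -> (forall x, 0 <= f x) ->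
  \int[mu]_(x in `]a, b[) (f (phi x) * (psi x)%:E) =
  \int[mu]_(y in `]phi a, phi b[) f y.
Proof. exact: ge0_integral_transfer. Qed.

Lemma integral_subst_increasing (f : measurableTypeR R -> \bar R) :
  measurable_fun setT f ->
  \int[mu]_(x in `]a, b[) (f (phi x) * (psi x)%:E) =
  \int[mu]_(y in `]phi a, phi b[) f y.
Proof. exact: integral_transfer. Qed.

End increasing.

Section reflection.
Variables (s a b : R).
Hypothesis ab : a < b.
Local Open Scope ereal_scope.
Let phi (x : R) : R := (s - x)%R.
Let psi (x : R) : R := 1%R.
Let mphi : measurable_fun setT phi. Proof. exact: measurable_funB. Qed.
Let mpsi : measurable_fun setT psi. Proof. exact: measurable_cst. Qed.
Let psi0 x : `]a, b[%classic x -> (0 <= psi x)%R.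
Proof. by move=> _; exact: ler01. Qed.
Let Eoo : (mu `](s - b)%R, (s - a)%R[ < +oo)%E.
Proof. by rewrite lebesgue_measure_itv/=; case: ifPn => // _; rewrite -EFinB ltry. Qed.
Let tot : (\int[mu]_(x in `]a, b[) (psi x)%:E = mu `](s - b)%R, (s - a)%R[)%E.
Proof.
rewrite /psi integral_cst// mul1e [LHS](lebesgue_measure_itv `]a, b[).
rewrite [RHS](lebesgue_measure_itv `](s - b)%R, (s - a)%R[)/= !lte_fin ab ltrD2l ltrN2 ab.
rewrite -!EFinB; congr EFin; lra.
Qed.
Let ray d : (\int[mu]_(x in `]a, b[ `&` phi @^-1` `]-oo, d[) (psi x)%:E =
  mu (`](s - b)%R, (s - a)%R[ `&` `]-oo, d[))%E.
Proof.
rewrite (_ : _ `&` phi @^-1` _ = `](Num.max a (s - d)%R), b[%classic); last first.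
  rewrite /phi; apply/seteqP; split => x /=; rewrite !in_itv/= gt_max.
    by move=> [/andP[-> ->]]; rewrite ltrBlDr ltrBlDl => ->.
  by move=> /andP[/andP[-> +] ->]; rewrite ltrBlDr ltrBlDl => ->.
rewrite (_ : _ `&` _ = `](s - b)%R, (Num.min (s - a)%R d)[%classic); last first.
  apply/seteqP; split => x /=; rewrite !in_itv/= lt_min; first by move=> [/andP[-> ->]] ->.
  by move=> /andP[-> /andP[-> ->]].
rewrite /psi integral_cst// mul1e.
rewrite [LHS](lebesgue_measure_itv `](Num.max a (s - d)%R), b[).
rewrite [RHS](lebesgue_measure_itv `](s - b)%R, (Num.min (s - a)%R d)[)/=.
rewrite !lte_fin gt_max lt_min ab.
rewrite ltrD2l ltrN2 ab/= ltrBlDr ltrBlDl addrC.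
case: ifPn => // _; rewrite -!EFinB; congr EFin.
case: (leP a (s-d)%R) => ?; case: (leP (s-a)%R d) => ?; lra.
Qed.

Lemma integral_reflect (f : measurableTypeR R -> \bar R) :
  measurable_fun setT f ->
  \int[mu]_(x in `]a, b[) f (s - x)%R =
  \int[mu]_(y in `](s - b)%R, (s - a)%R[) f y.
Proof.
move=> mf.
rewrite -[RHS](@integral_transfer _ `]a, b[%classic `](s - b)%R, (s - a)%R[%classic phi psi)//.
by apply: eq_integral => x _; rewrite mule1.
Qed.

End reflection.
End FTC.

Lemma ae_except1 (R : realType) (r : R) (P : R -> Prop) :
  (forall x, x != r -> P x) -> {ae @lebesgue_measure R, forall x, P x}.
Proof.
move=> h; exists [set r]; split => //; first exact: lebesgue_measure_set1.
by move=> x /= nPx; apply: contrapT => /eqP xr; apply: nPx; exact: h.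
Qed.

Lemma integral_translate (R : realType) (p a b : R) (f : measurableTypeR R -> \bar R) :
  a < b -> measurable_fun setT f ->
  (\int[@lebesgue_measure R]_(x in `]a, b[) f (p + x)%R =
   \int[@lebesgue_measure R]_(y in `](p + a)%R, (p + b)%R[) f y)%E.
Proof.
move=> ab mf.
have d (x : R) : is_derive x 1 (fun v : R => p + v) 1.
  by apply: is_derive_eq; rewrite mulr1 add0r. 
have c1 : continuous (fun _ : R => 1 : R) by move=> x; exact: cvg_cst.
have p1 (x : R) : a < x < b -> 0 < (1 : R) by [].
rewrite -(integral_subst_increasing ab d c1 p1 mf).
by apply: eq_integral => x _; rewrite mule1.
Qed.

(** * Integrals of inverse square roots, the majorants of logarithmic singularities *)

Section sqrtV.
Context (R : realType).
Notation mu := (@lebesgue_measure R).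

Lemma measurable_sqrtr D : measurable_fun D (@Num.sqrt R).
Proof. by apply: measurable_funTS; apply: continuous_measurable_fun; exact: sqrt_continuous. Qed.

Lemma measurable_invr D : measurable_fun D (@GRing.inv R).
Proof.
apply: measurable_funTS; rewrite -(setUv [set 0 : R]); apply/measurable_funU => //.
  exact: measurableC.
split; first exact: measurable_fun_set1.
apply: open_continuous_measurable_fun; first exact/closed_openC/closed_eq.
by move=> x; rewrite inE/= => /eqP x0; exact: inv_continuous.
Qed.

Lemma integral_sqrtV (c : R) : 0 < c ->
  (\int[mu]_(x in `]0%R, c[) ((Num.sqrt x)^-1)%:E = (2 * Num.sqrt c)%:E)%E.
Proof.
move=> c0.
have sc0 : 0 < Num.sqrt c by rewrite sqrtr_gt0.
have d (x : R) : is_derive x 1 (fun v : R => v ^+ 2) (2 * x).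
  by apply: is_derive_eq; rewrite /GRing.scale/=; ring.
have c2 : continuous (fun v : R => 2 * v).
  by move=> x; apply: cvgM; [exact: cvg_cst|exact: cvg_id].
have p x : 0 < x < Num.sqrt c -> 0 < 2 * x by move=> /andP[x0 _]; rewrite mulr_gt0.
have := ge0_integral_subst_increasing sc0 d c2 p.
rewrite expr0n/= sqr_sqrtr ?ltW// => <-//.
- rewrite (eq_integral (fun=> 2%:E)).
    rewrite integral_cst// [X in (_ * X)%E](lebesgue_measure_itv `]0, Num.sqrt c[)/=.
    by rewrite lte_fin sc0 sube0 -EFinM.
  move=> x; rewrite inE/= in_itv/= => /andP[x0 _].
  by rewrite -EFinM sqrtr_sqr gtr0_norm// mulrCA mulVf ?mulr1// gt_eqF.
- apply/measurable_EFinP; apply: measurableT_comp; last exact: measurable_sqrtr.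
  exact: measurable_invr.
Qed.

Lemma integral_sqrtV_dist (p c : R) : 0 < c ->
  (\int[mu]_(x in `](p - c)%R, (p + c)%R[) ((Num.sqrt `|x - p|)^-1)%:E = (4 * Num.sqrt c)%:E)%E.
Proof.
move=> c0; set f := fun x : R => ((Num.sqrt `|x - p|)^-1)%:E.
have mf : measurable_fun setT f.
  apply/measurable_EFinP; apply: measurableT_comp; first exact: measurable_invr.
  apply: measurableT_comp; first exact: measurable_sqrtr.
  by apply: measurableT_comp => //; exact: measurable_funB.
rewrite (@itv_bndbnd_setU _ _ _ (BRight p)); last 2 first.
- by rewrite bnd_simp gerBl ltW.
- by rewrite bnd_simp ltrDl.
rewrite integral_setU//; last 2 first.
- exact: measurable_funTS.
- apply/disj_setPS => x [] /=; rewrite !in_itv/= => /andP[_ xp] /andP[px _].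
  by have := lt_le_trans px xp; rewrite ltxx.
rewrite (@integral_itv_bndoo _ (p - c)%R p f false false); last exact: measurable_funTS.
have := @integral_reflect R p 0 c c0 f mf; rewrite subr0 => <-.
have := @integral_translate R p 0 c f c0 mf; rewrite addr0 => <-.
have sc : 4 * Num.sqrt c = 2 * Num.sqrt c + 2 * Num.sqrt c by ring.
rewrite sc EFinD -!(integral_sqrtV c0); congr (_ + _)%E;
  apply: eq_integral => x; rewrite inE/= in_itv/= => /andP[x0 _]; rewrite /f.
- by rewrite addrAC subrr add0r normrN gtr0_norm.
- by rewrite addrAC subrr add0r gtr0_norm.
Qed.
End sqrtV.

(** * The potential of the arcsine law *)

Section trig.
Context (R : realType).
Implicit Types x d : R.

(** With [w = d / 2], the mean value theorem gives [sin w >= w cos w], so [sin d >= d * cos w ^+ 2];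
    and [cos d >= 0] forces [cos w ^+ 2 >= 1/2]. *)
Lemma sin_ge_half d : 0 <= d <= pi / 2 -> d / 2 <= sin d.
Proof.
move=> /andP[d0 dpi].
have pi0 := @pi_gt0 R.
have [->|dn0] := eqVneq d 0; first by rewrite mul0r sin0.
have {}d0 : 0 < d by rewrite lt_neqAle eq_sym dn0.
pose w := d / 2.
have w0 : 0 < w by rewrite divr_gt0.
have dw : d = w *+ 2 by rewrite /w; lra.
have cosd : 0 <= cos d by apply: cos_ge0_pihalf; rewrite dpi andbT; lra.
have [c] : exists2 c, c \in `]0, w[ & sin w - sin 0 = cos c * (w - 0).
  apply: MVT => //.
  by apply: continuous_subspaceT => ?; exact: continuous_sin.
rewrite in_itv/= sin0 !subr0 => /andP[c0 cw] sinw.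
have cosw : cos w <= cos c.
  rewrite ltW// ltr_cos// in_itv/=; apply/andP; split; move: cw; rewrite /w => ?; lra.
have coswp : 0 <= cos w.
  by apply: cos_ge0_pihalf; apply/andP; split; rewrite /w; lra.
have cosd2 : cos d = cos w ^+ 2 *+ 2 - 1 by rewrite dw cos_mulr2n.
rewrite dw sin_mulr2n sinw.
have : cos w * (cos w * w) <= cos w * (cos c * w).
  by rewrite ler_wpM2l// ler_wpM2r// ltW.
have -> : cos w * (cos w * w) = cos w ^+ 2 * w by ring.
nra.
Qed.

Lemma one_sub_cos_ge d : `|d| <= pi -> d ^+ 2 / 8 <= 1 - cos d.
Proof.
rewrite -(cos_norm d) -(real_normK (num_real d)).
move: (normr_ge0 d); move: `|d| => e e0 dpi.
have : e / 2 / 2 <= sin (e / 2) by apply: sin_ge_half; apply/andP; split; lra.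
have -> : cos e = cos (e / 2 *+ 2) by congr cos; lra.
rewrite cos_mulr2n cos2sin2; nra.
Qed.

(** The square of [cos x - cos y] is [(1 - cos (x - y)) * (1 - cos (x + y))], and on [[0, pi]] the
    second factor is at least the first because [sin x * sin y >= 0]. *)
Lemma cos_sub_ge (x y : R) : 0 <= x <= pi -> 0 <= y <= pi ->
  (x - y) ^+ 2 / 8 <= `|cos x - cos y|.
Proof.
move=> /andP[x0 xpi] /andP[y0 ypi].
have sx : 0 <= sin x by rewrite sin_ge0_pi// x0.
have sy : 0 <= sin y by rewrite sin_ge0_pi// y0.
have h : (x - y) ^+ 2 / 8 <= 1 - cos (x - y).
  by apply: one_sub_cos_ge; rewrite ler_norml; apply/andP; split; lra.
have h0 : 0 <= 1 - cos (x - y) by rewrite subr_ge0 cos_le1.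
apply: le_trans h _; rewrite -ler_sqr ?nnegrE ?normr_ge0//.
rewrite real_normK ?num_real// cosB.
have sx2 := sin2cos2 x; have sy2 := sin2cos2 y.
have : (cos x - cos y) ^+ 2 = (1 - (cos x * cos y + sin x * sin y)) *
    (1 - (cos x * cos y - sin x * sin y)).
  have -> : (1 - (cos x * cos y + sin x * sin y)) * (1 - (cos x * cos y - sin x * sin y))
    = (1 - cos x * cos y) ^+ 2 - sin x ^+ 2 * sin y ^+ 2 by ring.
  by rewrite sx2 sy2; ring.
move=> ->; rewrite expr2 ler_wpM2l//; first by rewrite -cosB subr_ge0 cos_le1.
have : 0 <= sin x * sin y by exact: mulr_ge0.
lra.
Qed.

Lemma ln_ge_sqrtV (s : R) : 0 < s -> - ln s <= 2 * (Num.sqrt s)^-1.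
Proof.
move=> s0; have r0 : 0 < Num.sqrt s by rewrite sqrtr_gt0.
have -> : ln s = 2 * ln (Num.sqrt s).
  by rewrite -[in LHS](sqr_sqrtr (ltW s0)) lnXn// mulr_natl.
have : ln (Num.sqrt s)^-1 < (Num.sqrt s)^-1 by apply: ln_sublinear; rewrite invr_gt0.
by rewrite lnV ?posrE//; lra.
Qed.

(** The quadratic lower bound on the difference of cosines reduces the singularity to
    [2 ln |x - p|], hence to an inverse square root, with constants independent of [p]. Where the
    argument vanishes, [ln 0 = 0] makes the bound trivial. *)
Lemma norm_ln_cos_le (p x : R) : 0 <= p <= pi -> 0 <= x <= pi ->
  `|ln `|- (2 * cos p) + 2 * cos x| | <= ln 4 + 4 * (Num.sqrt `|x - p|)^-1.
Proof.
move=> pp xp.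
have ln4 : 0 <= ln (4 : R) by rewrite ln_ge0//; lra.
have si : 0 <= (Num.sqrt `|x - p|)^-1 by rewrite invr_ge0 sqrtr_ge0.
set z := - _ + _.
have [->|z0] := eqVneq z 0.
  by rewrite normr0 ln0// normr0; lra.
have zp : 0 < `|z| by rewrite normr_gt0.
have z4 : `|z| <= 4.
  rewrite ler_norml /z; have := cos_geN1 p; have := cos_le1 p.
  have := cos_geN1 x; have := cos_le1 x; move=> *; apply/andP; split; lra.
have zd : `|x - p| ^+ 2 / 4 <= `|z|.
  have := cos_sub_ge xp pp; rewrite real_normK ?num_real//.
  have -> : z = 2 * (cos x - cos p) by rewrite /z; ring.
  rewrite normrM ger0_norm//; lra.
have xp0 : 0 < `|x - p|.
  rewrite normr_gt0; apply: contra_neq z0 => xp0.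
  by rewrite /z (_ : x = p) ?addNr//; lra.
have lnu : ln `|z| <= ln 4 by rewrite ler_ln ?posrE//; lra.
have lnl : 2 * ln `|x - p| - ln 4 <= ln `|z|.
  have -> : 2 * ln `|x - p| = ln (`|x - p| ^+ 2) by rewrite lnXn// mulr_natl.
  rewrite -ln_div ?posrE ?exprn_gt0 ?ltr0n//.
  by rewrite ler_ln ?posrE// divr_gt0// exprn_gt0.
have := ln_ge_sqrtV xp0.
by rewrite ler_norml => ?; apply/andP; split; lra.
Qed.
End trig.

Section arcsine_pot.
Context (R : realType).
Notation mu := (@lebesgue_measure R).
Implicit Types X Y z : R.

Lemma measurable_ln_norm d (T : measurableType d) (D : set T) (f : T -> R) :
  measurable_fun D f -> measurable_fun D (fun x => ln `|f x|).
Proof.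
move=> mf; apply: measurableT_comp; first exact: measurable_ln.
by apply: measurableT_comp => //; exact: normr_measurable.
Qed.

Lemma measurable_cos D : measurable_fun D (@cos R).
Proof.
by apply: measurable_funTS; apply: continuous_measurable_fun; exact: continuous_cos.
Qed.

Lemma measurable_ln_cos D X c : measurable_fun D (fun x : R => ln `|X + c * cos x|).
Proof.
apply: measurable_ln_norm; apply: measurable_funD => //.
by apply: measurable_funM => //; exact: measurable_cos.
Qed.

Let D : set R := `]0, pi[.

Let mD : measurable D. Proof. exact: measurable_itv. Qed.

Let muD : mu D = (@pi R)%:E.
Proof. by rewrite [LHS](lebesgue_measure_itv `]0, pi[)/= lte_fin pi_gt0 sube0. Qed.

Let muDoo : (mu D < +oo)%E. Proof. by rewrite muD ltry. Qed.

Let bound (p x : R) : R := ln 4 + 4 * (Num.sqrt `|x - p|)^-1.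

Let bound_ge0 p x : 0 <= bound p x.
Proof.
by rewrite addr_ge0 ?ln_ge0 ?ler1n// mulr_ge0// invr_ge0 sqrtr_ge0.
Qed.

Let mbound p A : measurable_fun A (bound p).
Proof.
apply: measurable_funD => //; apply: measurable_funM => //.
apply: measurableT_comp; first exact: measurable_invr.
apply: measurableT_comp; first exact: measurable_sqrtr.
by apply: measurableT_comp => //; exact: measurable_funB.
Qed.

Let int_bound p : 0 <= p <= pi ->
  (\int[mu]_(x in D) (bound p x)%:E <= (pi * ln 4 + 16 * Num.sqrt pi)%:E)%E.
Proof.
move=> /andP[p0 ppi]; have pi0 := @pi_gt0 R.
have ms A : measurable_fun A (fun x : R => ((Num.sqrt `|x - p|)^-1)%:E).
  apply/measurable_EFinP.
  apply: measurableT_comp; first exact: measurable_invr.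
  apply: measurableT_comp; first exact: measurable_sqrtr.
  by apply: measurableT_comp => //; exact: measurable_funB.
have s0 (x : R) : (0 <= ((Num.sqrt `|x - p|)^-1)%:E)%E.
  by rewrite lee_fin invr_ge0 sqrtr_ge0.
rewrite /bound; under eq_integral do rewrite EFinD EFinM.
rewrite ge0_integralD//; last 2 first.
- by move=> x _; rewrite lee_fin ln_ge0// ler1n.
- by apply: emeasurable_funM => //; exact: ms.
rewrite integral_constant//.
rewrite [X in (_ * X)%E]muD ge0_integralZl//; last exact: ms.
rewrite [X in (_ <= X)%E]EFinD leeD//; first by rewrite -EFinM mulrC.
apply: (@le_trans _ _ (4%:E * (4 * Num.sqrt pi)%:E)%E); last by rewrite -EFinM lee_fin; lra.
rewrite lee_wpmul2l// -(integral_sqrtV_dist p pi0).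
apply: ge0_subset_integral => //; first exact: ms.
by move=> x; rewrite /D /= !in_itv/= => /andP[? ?]; apply/andP; split; lra.
Qed.

Let acos_spec X : `|X| <= 2 -> exists2 p, 0 <= p <= pi & X = - (2 * cos p).
Proof.
move=> X2; have h : -1 <= - (X / 2) <= 1 by move: X2; rewrite ler_norml; lra.
exists (acos (- (X / 2))); first by rewrite acos_ge0// acos_lepi.
by rewrite acosK ?in_itv//; lra.
Qed.

Let integrable_bound p : 0 <= p <= pi -> mu.-integrable D (EFin \o bound p).
Proof.
move=> pp; apply/integrableP; split; first by apply/measurable_EFinP; exact: mbound.
under eq_integral do rewrite /= ger0_norm//.
by apply: le_lt_trans (int_bound pp) _; rewrite ltry.
Qed.

Let le_bound p x : 0 <= p <= pi -> D x ->
  `|ln `|- (2 * cos p) + 2 * cos x| | <= bound p x.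
Proof.
move=> pp; rewrite /D/= in_itv/= => /andP[x0 xpi].
by apply: norm_ln_cos_le => //; rewrite !ltW.
Qed.

Lemma integrable_ln_cos X :
  mu.-integrable D (fun x => (ln `|X + 2 * cos x|)%:E).
Proof.
have [X2|X2] := leP `|X| 2.
  have [p pp ->] := acos_spec X2.
  apply: le_integrable (integrable_bound pp) => //.
    by apply/measurable_EFinP; exact: measurable_ln_cos.
  move=> x Dx /=; rewrite lee_fin (ger0_norm (bound_ge0 p x)).
  exact: le_bound.
apply: measurable_bounded_integrable => //.
  exact: measurable_ln_cos.
exists (`|ln (`|X| - 2)| + `|ln (`|X| + 2)|); split; first exact: num_real.
move=> M XM x _ /=; apply: ltW; apply: le_lt_trans XM.
have c1 : `|2 * cos x| <= 2.
  by rewrite normrM ger0_norm// ler_piMr// cos_max.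
have l : `|X| - 2 <= `|X + 2 * cos x|.
  by apply: le_trans (lerB_normD _ _); lra.
have u : `|X + 2 * cos x| <= `|X| + 2.
  by apply: le_trans (ler_normD _ _) _; lra.
have lnl : ln (`|X| - 2) <= ln `|X + 2 * cos x| by rewrite ler_ln ?posrE//; lra.
have lnu : ln `|X + 2 * cos x| <= ln (`|X| + 2) by rewrite ler_ln ?posrE//; lra.
have := ler_norm (ln (`|X| + 2)); have := lerNnormlW (lexx `|ln (`|X| - 2)|).
have := normr_ge0 (ln (`|X| + 2)); have := normr_ge0 (ln (`|X| - 2)).
rewrite ler_norml => *; apply/andP; split; lra.
Qed.

Definition arcsine_pot X : R := (\int[mu]_(x in D) ln `|X + 2 * cos x|).

Lemma arcsine_potE X :
  (\int[mu]_(x in D) (ln `|X + 2 * cos x|)%:E = (arcsine_pot X)%:E)%E.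
Proof.
rewrite /arcsine_pot /Rintegral fineK//.
by apply: integrable_fin_num => //; exact: integrable_ln_cos.
Qed.

(** Writing [X = - (2 * cos p)] places the singularity at [p], and the integral of the majorant is
    bounded uniformly in [p]. The doubling argument rests on this uniformity. *)
Lemma arcsine_pot_bounded : exists C, forall X, `|X| <= 2 -> `|arcsine_pot X| <= C.
Proof.
exists (pi * ln 4 + 16 * Num.sqrt pi) => X X2.
have [p pp XE] := acos_spec X2.
rewrite -lee_fin; apply: le_trans (int_bound pp).
rewrite -[(`|_|)%:E]/(`|(arcsine_pot X)%:E|)%E -arcsine_potE.
apply: le_trans (le_abse_integral _ _ _) _ => //.
  by apply/measurable_EFinP; exact: measurable_ln_cos.
apply: ge0_le_integral => //.
- by apply/measurable_EFinP; apply: measurableT_comp => //; exact: measurable_ln_cos.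
- by apply/measurable_EFinP; exact: mbound.
- by move=> x Dx; rewrite lee_fin XE; exact: le_bound.
Qed.

Lemma arcsine_potN X : arcsine_pot (- X) = arcsine_pot X.
Proof.
apply: EFin_inj; rewrite -!arcsine_potE.
have := @integral_reflect R pi 0 pi (pi_gt0 R) (fun x => (ln `|X + 2 * cos x|)%:E).
rewrite subrr subr0 => <-; last by apply/measurable_EFinP; exact: measurable_ln_cos.
apply: eq_integral => x _; rewrite cosB cospi sinpi -(normrN (- X + _)).
by congr (ln `|_|)%:E; ring.
Qed.

(** The product [(X + 2 cos x) * (- X + 2 cos x)] equals [2 cos (2 x) - (X ^+ 2 - 2)]. After [x] is
    doubled, the half []pi, 2 pi[] folds onto []0, pi[] by [x -> 2 pi - x], and evenness of the
    potential removes the signs. *)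
Lemma arcsine_pot_double X : 2 * arcsine_pot X = arcsine_pot (X ^+ 2 - 2).
Proof.
have pi0 := @pi_gt0 R.
pose Y := - (X ^+ 2 - 2).
pose g (x : R) := (ln `|Y + 2 * cos x|)%:E.
have mg : measurable_fun setT g by apply/measurable_EFinP; exact: measurable_ln_cos.
have mg2 : measurable_fun setT (fun x : R => g (2 * x)).
  by apply: (measurableT_comp mg); exact: measurable_funM.
have g2E (x : R) : g (2 * x) = (ln `|(X + 2 * cos x) * (- X + 2 * cos x)|)%:E.
  rewrite /g [in 2 * x]mulr_natl cos_mulr2n /Y.
  by congr (ln `|_|)%:E; rewrite -mulr_natl; ring.
have gE (x : R) : X + 2 * cos x != 0 -> - X + 2 * cos x != 0 ->
    ((ln `|X + 2 * cos x|)%:E + (ln `|- X + 2 * cos x|)%:E = g (2 * x)%R)%E.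
  by move=> x1 x2; rewrite g2E -EFinD normrM lnM ?posrE ?normr_gt0.
have sum : (arcsine_pot X + arcsine_pot (- X))%:E =
    (\int[mu]_(x in D) g (2 * x)%R)%E.
  rewrite EFinD -!arcsine_potE -integralD//; [|exact: integrable_ln_cos..].
  apply: ae_eq_integral => //.
  - by apply/measurable_EFinP; apply: measurable_funD; exact: measurable_ln_cos.
  - apply: measurable_funTS; exact: mg2.
  (* The product rule for [ln] breaks down where a factor is zero, since [ln 0 = 0]; injectivity of
     [cos] leaves at most one such point per factor. *)
  have aeX (Z : R) : {ae mu, forall x, D x -> Z + 2 * cos x != 0}.
    apply: (@ae_except1 _ (acos (- (Z / 2)))) => x xZ; rewrite /D/= in_itv/= => /andP[x0 xpi].
    apply: contra_neq xZ => Zx; rewrite (_ : - (Z / 2) = cos x); last lra.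
    by rewrite cosK// in_itv/= !ltW.
  apply: filterS2 (aeX X) (aeX (- X)); first exact: (ae_filter_ringOfSetsType mu).
  by move=> x h1 h2 Dx; apply: gE; [exact: h1|exact: h2].
have d2 (x : R) : is_derive x 1 (fun v : R => 2 * v) 2.
  by apply: is_derive_eq; rewrite /GRing.scale/= mulr1.
have c2 : continuous (fun _ : R => 2 : R) by move=> x; exact: cvg_cst.
have p2 (x : R) : 0 < x < pi -> 0 < (2 : R) by [].
have := integral_subst_increasing pi0 d2 c2 p2 mg.
rewrite mulr0 (@itv_bndbnd_setU _ _ (BRight 0) (BRight pi) (BLeft (2 * pi))); last 2 first.
- by rewrite bnd_simp ltW.
- by rewrite bnd_simp; lra.
rewrite integral_setU//; last 2 first.
- exact: measurable_funTS.
- apply/disj_setPS => x [] /=; rewrite !in_itv/= => /andP[_ xp] /andP[px _].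
  by have := lt_le_trans px xp; rewrite ltxx.
rewrite (@integral_itv_bndoo _ 0 pi g false false); last exact: measurable_funTS.
have := @integral_reflect R (2 * pi) 0 pi pi0 g mg.
have -> : 2 * pi - pi = pi :> R by lra.
rewrite subr0 => <-.
have c2pi : cos (2 * pi) = 1 :> R by rewrite mulr_natl cos2pi.
have s2pi : sin (2 * pi) = 0 :> R by rewrite mulr_natl sin2pi.
have -> : (\int[mu]_(x in D) g (2 * pi - x)%R = \int[mu]_(x in D) g x)%E.
  by apply: eq_integral => x _; rewrite /g cosB c2pi s2pi; congr (ln `|_|)%:E; ring.
have ig2 : mu.-integrable D (fun x : R => g (2 * x)%R).
  have iG : mu.-integrable D (fun x => `|(ln `|X + 2 * cos x|)%:E| +
      `|(ln `|- X + 2 * cos x|)%:E|)%E.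
    by apply: integrableD => //; apply: integrable_abse; exact: integrable_ln_cos.
  apply: le_integrable iG => //.
  - by apply: measurable_funTS; exact: mg2.
  - move=> x Dx; have [x1|x1] := eqVneq (X + 2 * cos x) 0.
      by rewrite g2E x1 mul0r normr0 ln0// abse0.
    have [x2|x2] := eqVneq (- X + 2 * cos x) 0.
      by rewrite g2E x2 mulr0 normr0 ln0// abse0.
    rewrite -gE//; apply: le_trans (lee_abs_add _ _) _.
    by rewrite [X in (_ <= X)%E]gee0_abs// adde_ge0.
rewrite integralZr// -sum arcsine_potN.
rewrite arcsine_potE -EFinD -EFinM arcsine_potN => -[].
lra.
Qed.
End arcsine_pot.

(** * Values of the arcsine potential inside and outside the interval *)

Section arcsine_values.
Context (R : realType).
Notation mu := (@lebesgue_measure R).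
Implicit Types X z h d : R.

Let D : set R := `]0, pi[.
Let mD : measurable D. Proof. exact: measurable_itv. Qed.
Let muD : mu D = (@pi R)%:E.
Proof. by rewrite [LHS](lebesgue_measure_itv `]0, pi[)/= lte_fin pi_gt0 sube0. Qed.
Let muDoo : (mu D < +oo)%E. Proof. by rewrite muD ltry. Qed.

Lemma eq0_of_doubling (a C : R) : (forall n, 2 ^+ n * `|a| <= C) -> a = 0.
Proof.
move=> h; apply/eqP; rewrite -normr_eq0; apply/negPn/negP => a0.
have {}a0 : 0 < `|a| by rewrite lt_neqAle eq_sym a0 normr_ge0.
have := h (Num.truncn (C / `|a|)).+1; apply/negP; rewrite -ltNge.
rewrite -ltr_pdivrMr//; apply: lt_le_trans (truncnS_gt _) _.
by rewrite -natrX ler_nat ltnW// ltn_expl.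
Qed.

Lemma arcsine_pot_inside X : `|X| <= 2 -> arcsine_pot X = 0.
Proof.
have [C hC] := arcsine_pot_bounded R.
move=> X2; apply: (@eq0_of_doubling _ C) => n.
elim: n X X2 => [|n ih] X X2; first by rewrite expr0 mul1r hC.
rewrite exprSr -mulrA -[2 in X in _ * (X * _)]ger0_norm// -normrM arcsine_pot_double; apply: ih.
have : X ^+ 2 <= 4 by rewrite -(real_normK (num_real X)); have := normr_ge0 X; nra.
have := sqr_ge0 X; rewrite ler_norml => *; apply/andP; split; lra.
Qed.

Lemma Rintegral_between (f : R -> R) (l u : R) :
  mu.-integrable D (EFin \o f) -> (forall x, D x -> l <= f x <= u) ->
  pi * l <= \int[mu]_(x in D) f x <= pi * u.
Proof.
move=> If h.
have k c : \int[mu]_(x in D) c = pi * c.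
  by rewrite /Rintegral integral_constant// [X in (_ * X)%E]muD -EFinM/= mulrC.

rewrite -!k !le_Rintegral//; try exact: integrable_constant.
- by move=> x /h/andP[].
- by move=> x /h/andP[].
Qed.

(** The error [e] satisfies [e (y ^+ 2) = 2 * e y] and is bounded on [[2, +oo[], hence vanishes
    there. By Bernoulli's inequality, repeated squaring brings any [z > 1] beyond [2], and the
    functional equation brings the vanishing back to [z]. *)
Lemma arcsine_pot_outside z : 1 < z -> arcsine_pot (z + z^-1) = pi * ln z.
Proof.
move=> z1; pose e z := arcsine_pot (z + z^-1) - pi * ln z.
suff : e z = 0 by move/eqP; rewrite subr_eq0 => /eqP.
have pi0 := @pi_gt0 R.
have e2 y : 0 < y -> e (y ^+ 2) = 2 * e y.
  move=> y0; rewrite /e lnXn// mulrBr arcsine_pot_double.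
  have -> : (y + y^-1) ^+ 2 - 2 = y ^+ 2 + (y ^+ 2)^-1.
    by field; rewrite gt_eqF.
  ring.
have eb y : 2 <= y -> `|e y| <= 2 * pi * ln 2.
  move=> y2; have y0 : 0 < y by lra.
  have yV : 0 < y^-1 by rewrite invr_gt0.
  have yV2 : y^-1 <= 2^-1 by rewrite lef_pV2 ?posrE//; lra.
  have yyV : y * y^-1 = 1 by rewrite mulfV ?gt_eqF.
  (* For [y >= 2] the argument of the logarithm lies between [y / 4] and [4 * y]. *)
  have := @Rintegral_between (fun x => ln `|y + y^-1 + 2 * cos x|) (ln y - 2 * ln 2) (ln y + 2 * ln 2).
  rewrite -/(arcsine_pot (y + y^-1)) => /(_ (integrable_ln_cos _)) H.
  have : pi * (ln y - 2 * ln 2) <= arcsine_pot (y + y^-1) <= pi * (ln y + 2 * ln 2).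
    apply: H => x _; have c1 := cos_le1 x; have c2 := cos_geN1 x.
    have l4 : 2 * ln 2 = ln (4 : R).
      by rewrite (_ : 4 = 2 ^+ 2) ?lnXn// ?mulr_natl//; ring.
    have p : 0 < y + y^-1 + 2 * cos x by lra.
    rewrite gtr0_norm// l4 -ln_div ?posrE// -lnM ?posrE//.
    by rewrite !ler_ln ?posrE ?divr_gt0 ?mulr_gt0//; apply/andP; split; nra.
  by rewrite /e ler_norml => /andP[? ?]; apply/andP; split; lra.
have en n : e (z ^+ (2 ^ n)) = 2 ^+ n * e z.
  elim: n => [|n ih]; first by rewrite mul1r.
  by rewrite expnSr exprM e2 ?exprn_gt0 ?ih ?exprS ?mulrA// (lt_trans ltr01).
have z2 : exists n, 2 <= z ^+ (2 ^ n).
  exists (Num.truncn (1 / (z - 1))).+1.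
  have z0 : 0 < z - 1 by lra.
  have k : 1 < (z - 1) * (2 ^ (Num.truncn (1 / (z - 1))).+1)%:R.
    rewrite mulrC -ltr_pdivrMr//; apply: lt_le_trans (truncnS_gt _) _.
    by rewrite ler_nat ltnW// ltn_expl.
  have b m : 1 + (z - 1) * m%:R <= z ^+ m.
    elim: m => [|m ih]; first by rewrite mulr0 addr0 expr0.
    rewrite exprS -natr1; have m0 : 0 <= m%:R :> R by [].
    apply: (@le_trans _ _ (z * (1 + (z - 1) * m%:R))); last by rewrite ler_wpM2l//; lra.
    have := mulr_ge0 (mulr_ge0 (ltW z0) (ltW z0)) m0; nra.
  by apply: le_trans (b _); lra.
have [n0 hn0] := z2.
have e00 : 2 ^+ n0 * e z = 0.
  apply: (@eq0_of_doubling _ (2 * pi * ln 2)) => n.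
  rewrite -[2 ^+ n]ger0_norm ?exprn_ge0// -normrM mulrA -exprD -en; apply: eb.
  apply: le_trans hn0 _; rewrite ler_weXn2l//; first exact: ltW.
  by rewrite leq_exp2l// leq_addl.
by move/eqP: e00; rewrite mulf_eq0 gt_eqF ?exprn_gt0//= => /eqP.
Qed.

(* The potential, at distance [d] from the centre, of the arcsine law of half-width [2 h]. *)
Definition itv_pot d h : R :=
  if `|d| <= 2 * h then ln h else ln ((`|d| + Num.sqrt (d ^+ 2 - 4 * h ^+ 2)) / 2).

(** Outside [[-2, 2]], the root above [1] of [z + z^-1 = |X|] is [(|X| + sqrt (X^2 - 4)) / 2]. *)
Let arcsine_pot_itv_pot X : arcsine_pot X = pi * itv_pot X 1.
Proof.
rewrite /itv_pot; case: ifPn => X2.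
  by rewrite ln1 mulr0 arcsine_pot_inside//; lra.
rewrite -ltNge mulr1 in X2.
have -> : arcsine_pot X = arcsine_pot `|X|.
  by case: (ger0P X) => _; rewrite ?arcsine_potN.
have -> : X ^+ 2 = `|X| ^+ 2 by rewrite real_normK ?num_real.
move: `|X| X2 => x x2.
set s := Num.sqrt _; have s2 : s ^+ 2 = x ^+ 2 - 4.
  by rewrite sqr_sqrtr ?expr1n ?mulr1//; nra.
have s0 : 0 <= s := sqrtr_ge0 _.
have z1 : 1 < (x + s) / 2 by lra.
rewrite -(arcsine_pot_outside z1); congr arcsine_pot.
have : (x + s) * (x - s) = 4 by rewrite mulrC -subr_sqr s2; ring.
have xs : x + s != 0 by rewrite gt_eqF//; lra.
move=> h; have -> : ((x + s) / 2)^-1 = (x - s) / 2.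
  apply: (mulfI xs); rewrite mulrA h; field; exact: xs.
by field.
Qed.

Lemma itv_pot_scale d h : 0 < h -> itv_pot d h = ln h + itv_pot (d / h) 1.
Proof.
move=> h0; rewrite /itv_pot normrM normfV (gtr0_norm h0) ler_pdivrMr// mulr1 ln1.
case: ifPn => dh; first by rewrite addr0.
rewrite -ltNge in dh; rewrite -lnM ?posrE//; last first.
  by rewrite divr_gt0// ltr_pwDl ?sqrtr_ge0// divr_gt0//; lra.
have -> : Num.sqrt ((d / h) ^+ 2 - 4 * 1 ^+ 2) = Num.sqrt (d ^+ 2 - 4 * h ^+ 2) / h.
  transitivity (Num.sqrt ((d ^+ 2 - 4 * h ^+ 2) / h ^+ 2)).
    by congr Num.sqrt; field; rewrite gt_eqF.
  rewrite sqrtrM; first by rewrite sqrtrV ?sqr_ge0// sqrtr_sqr gtr0_norm.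
  have h2 := ltW dh; have : (2 * h) ^+ 2 <= `|d| ^+ 2.
    by rewrite ler_sqr ?nnegrE ?mulr_ge0// ltW.
  by rewrite real_normK ?num_real// exprMn => ?; lra.
by congr ln; field; rewrite gt_eqF.
Qed.

Lemma integrable_itv_pot d h : 0 < h ->
  mu.-integrable D (fun x => (ln `|d + 2 * h * cos x|)%:E).
Proof.
move=> h0.
have iG : mu.-integrable D (fun x => `|(ln h)%:E| + `|(ln `|d / h + 2 * cos x|)%:E|)%E.
  apply: integrableD => //; apply: integrable_abse; last exact: integrable_ln_cos.
  exact: integrable_constant.
apply: le_integrable iG => //.
  by apply/measurable_EFinP; exact: measurable_ln_cos.
move=> x Dx; rewrite [X in (_ <= X)%E]gee0_abs ?adde_ge0//.
have -> : d + 2 * h * cos x = h * (d / h + 2 * cos x) by field; rewrite gt_eqF.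
have [->|x1] := eqVneq (d / h + 2 * cos x) 0.
  by rewrite mulr0 normr0 ln0// abse0 adde_ge0.
rewrite normrM gtr0_norm// lnM ?posrE ?normr_gt0// EFinD.
exact: lee_abs_add.
Qed.

Lemma integral_itv_pot d h : 0 < h ->
  (\int[mu]_(x in D) (ln `|d + 2 * h * cos x|)%:E = (pi * itv_pot d h)%:E)%E.
Proof.
move=> h0; transitivity (\int[mu]_(x in D) ((ln h)%:E + (ln `|d / h + 2 * cos x|)%:E)%E)%E.
  apply: ae_eq_integral => //.
  - by apply/measurable_EFinP; exact: measurable_ln_cos.
  - by apply/measurable_EFinP; apply: measurable_funD => //; exact: measurable_ln_cos.
  apply: (@ae_except1 _ (acos (- (d / h / 2)))) => x xZ; rewrite /D/= in_itv/= => /andP[x0 xpi].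
  have -> : d + 2 * h * cos x = h * (d / h + 2 * cos x) by field; rewrite gt_eqF.
  have dx : d / h + 2 * cos x != 0.
    apply: contra_neq xZ => Zx; rewrite (_ : - (d / h / 2) = cos x); last lra.
    by rewrite cosK// in_itv/= !ltW.
  by rewrite normrM gtr0_norm// lnM ?posrE ?normr_gt0// EFinD.
rewrite integralD//; [|exact: integrable_constant|exact: integrable_ln_cos].
rewrite integral_constant// [X in (_ * X + _)%E]muD -EFinM.
have -> := @arcsine_potE R (d / h).
rewrite -EFinD arcsine_pot_itv_pot (itv_pot_scale d h0); congr EFin; ring.
Qed.

End arcsine_values.

(** * The Marchenko-Pastur density *)

Section mixture.
Context (R : realType).
Notation mu := (@lebesgue_measure R).

Definition mp_density (k y : R) : R := Num.sqrt (4 * y - (y - k) ^+ 2) / (2 * pi * y).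

(* Outside the support both square roots are [0], and so are the densities since [0^-1 = 0]. *)
Definition arcsine_density (k t y : R) : R :=
  (pi * Num.sqrt (4 * t * y - (y - k) ^+ 2))^-1.

Lemma arcsine_density_ge0 k t y : 0 <= arcsine_density k t y.
Proof. by rewrite invr_ge0 mulr_ge0 ?pi_ge0 ?sqrtr_ge0. Qed.

Lemma mp_density_ge0 k y : 0 <= mp_density k y.
Proof.
have [y0|y0] := leP 0 y; first by rewrite divr_ge0 ?sqrtr_ge0 ?mulr_ge0 ?pi_ge0.
by rewrite /mp_density ler0_sqrtr ?mul0r//; have := sqr_ge0 (y - k); lra.
Qed.

Lemma measurable_arcsine_density d (T : measurableType d) (D : set T) (k : R) (t y : T -> R) :
  measurable_fun D t -> measurable_fun D y ->
  measurable_fun D (fun z => arcsine_density k (t z) (y z)).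
Proof.
move=> mt my; apply: measurableT_comp; first exact: measurable_invr.
apply: measurable_funM => //; apply: measurableT_comp; first exact: measurable_sqrtr.
apply: measurable_funB; first by apply: measurable_funM => //; exact: measurable_funM.
by apply: measurable_funX; exact: measurable_funB.
Qed.

Lemma measurable_mp_density d (T : measurableType d) (D : set T) (k : R) (y : T -> R) :
  measurable_fun D y -> measurable_fun D (fun z => mp_density k (y z)).
Proof.
move=> my; apply: measurable_funM.
  apply: measurableT_comp; first exact: measurable_sqrtr.
  apply: measurable_funB; first exact: measurable_funM.
  by apply: measurable_funX; exact: measurable_funB.
by apply: measurableT_comp; [exact: measurable_invr|exact: measurable_funM].
Qed.

Lemma arcsine_density_eq0 k t y : 4 * t * y <= (y - k) ^+ 2 -> arcsine_density k t y = 0.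
Proof. by move=> h; rewrite /arcsine_density ler0_sqrtr ?subr_le0// mulr0 invr0. Qed.

Lemma mp_density_eq0 k y : 4 * y <= (y - k) ^+ 2 -> mp_density k y = 0.
Proof. by move=> h; rewrite /mp_density ler0_sqrtr ?subr_le0// mul0r. Qed.

(** The discriminant equals [4 y (t - tau)], so the component charges [y] only for [t > tau]. The
    substitution [t = tau + v^2 / (4 y)] makes the integrand constant. *)
Lemma integral_arcsine_density k y :
  (\int[mu]_(t in `]0%R, 1%R[) (arcsine_density k t y)%:E = (mp_density k y)%:E)%E.
Proof.
have pi0 := @pi_gt0 R.
have [y1|y1] := leP (4 * y) ((y - k) ^+ 2).
  rewrite mp_density_eq0// integral0_eq// => t /=; rewrite in_itv/= => /andP[t0 t1].
  rewrite arcsine_density_eq0//; have [y0|y0] := leP 0 y; first by nra.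
  by have := sqr_ge0 (y - k); nra.
have y0 : 0 < y by have := sqr_ge0 (y - k); lra.
pose tau := (y - k) ^+ 2 / (4 * y).
have tau0 : 0 <= tau by rewrite divr_ge0 ?sqr_ge0//; lra.
have tauE : 4 * y * tau = (y - k) ^+ 2 by rewrite /tau; field; rewrite gt_eqF.
have tau1 : tau < 1 by rewrite ltr_pdivrMr; lra.
pose V := Num.sqrt (4 * y - (y - k) ^+ 2).
have V0 : 0 < V by rewrite sqrtr_gt0; lra.
have V2 : V ^+ 2 = 4 * y - (y - k) ^+ 2 by rewrite sqr_sqrtr//; lra.
have mw : measurable_fun setT (fun t => (arcsine_density k t y)%:E).
  by apply/measurable_EFinP; exact: measurable_arcsine_density.
have d1 (v : R) : is_derive v 1 (fun v : R => tau + v ^+ 2 / (4 * y)) (v / (2 * y)).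
  apply: is_derive_eq; rewrite /GRing.scale/=; field; rewrite gt_eqF//.
have c1 : continuous (fun v : R => v / (2 * y)).
  by move=> x; apply: cvgM; [exact: cvg_id|exact: cvg_cst].
have p1 (v : R) : 0 < v < V -> 0 < v / (2 * y).
  by move=> /andP[v0 _]; rewrite divr_gt0//; lra.
have := ge0_integral_subst_increasing V0 d1 c1 p1 mw.
have -> : tau + 0 ^+ 2 / (4 * y) = tau by rewrite expr0n/= mul0r addr0.
have -> : tau + V ^+ 2 / (4 * y) = 1 by rewrite V2 /tau; field; rewrite gt_eqF.
move=> /(_ (fun t => ltac:(rewrite lee_fin; exact: arcsine_density_ge0))) H.
transitivity (\int[mu]_(t in `]tau, 1%R[) (arcsine_density k t y)%:E)%E.
  rewrite [LHS]integral_mkcond [RHS]integral_mkcond; apply: eq_integral => t _.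
  rewrite !patchE !mem_setE !in_itv/=; case: (ltP tau t) => tt /=.
    by rewrite (le_lt_trans tau0 tt).
  case: ifPn => //; rewrite arcsine_density_eq0//.
  by rewrite -tauE; nra.
rewrite -H; transitivity (\int[mu]_(v in `]0%R, V[) ((2 * pi * y)^-1)%:E)%E.
  apply: eq_integral => v; rewrite inE/= in_itv/= => /andP[v0 vV].
  rewrite -EFinM /arcsine_density (_ : _ - _ = v ^+ 2).
    rewrite sqrtr_sqr gtr0_norm//; congr EFin; move: pi0; move: (pi) => P P0; field.
    by rewrite !gt_eqF.
  by rewrite mulrAC mulrDr tauE; field; rewrite gt_eqF.
rewrite integral_constant// [X in (_ * X)%E](lebesgue_measure_itv `]0%R, V[)/= lte_fin V0.
by rewrite sube0 -EFinM mulrC.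
Qed.

(** With [h^2 = t (t + k)] one has [4 t y - (y - k)^2 = (2 h)^2 - (y - (2 t + k))^2]: an arcsine law
    with centre [2 t + k] and half-width [2 h], parametrized by a cosine. *)
Lemma integral_against_arcsine_density (k t delta : R) (f : R -> \bar R) :
  0 <= k -> 0 < t -> measurable_fun setT f -> (forall x, 0 <= f x)%E ->
  (\int[mu]_x (f x * (arcsine_density k t (x + delta))%:E) =
   (pi^-1)%:E * \int[mu]_(x in `]0%R, pi[)
     f (2 * t + k - delta - 2 * Num.sqrt (t * (t + k)) * cos x)%R)%E.
Proof.
move=> k0 t0 mf f0; have pi0 := @pi_gt0 R.
set h := Num.sqrt (t * (t + k)).
have tk0 : 0 < t * (t + k) by rewrite mulr_gt0// ltr_wpDr.
have h0 : 0 < h by rewrite sqrtr_gt0.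
have h2 : h ^+ 2 = t * (t + k) by rewrite sqr_sqrtr// ltW.
pose c := 2 * t + k - delta.
have mw : measurable_fun setT (fun x : R => (arcsine_density k t (x + delta))%:E).
  by apply/measurable_EFinP; apply: measurable_arcsine_density => //; exact: measurable_funD.
have mfw : measurable_fun setT (fun x => (f x * (arcsine_density k t (x + delta))%:E)%E).
  exact: emeasurable_funM.
have d1 (v : R) : is_derive v 1 (fun v : R => c - 2 * h * cos v) (2 * h * sin v).
  by apply: is_derive_eq; rewrite /GRing.scale/=; ring.
have c1 : continuous (fun v : R => 2 * h * sin v).
  by move=> x; apply: cvgM; [exact: cvg_cst|exact: continuous_sin].
have p1 (v : R) : 0 < v < pi -> 0 < 2 * h * sin v.
  by move=> vpi; rewrite !mulr_gt0// sin_gt0_pi.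
have := ge0_integral_subst_increasing pi0 d1 c1 p1 mfw.
move=> /(_ (fun x => ltac:(by rewrite mule_ge0// lee_fin arcsine_density_ge0))).
rewrite cos0 cospi mulr1 mulrN1 opprK => H.
transitivity (\int[mu]_(x in `](c - 2 * h)%R, (c + 2 * h)%R[)
    (f x * (arcsine_density k t (x + delta))%:E))%E.
  rewrite [RHS]integral_mkcond; apply: eq_integral => x _.
  rewrite patchE mem_setE in_itv/=; case: ifPn => // xc.
  rewrite arcsine_density_eq0 ?mule0//.
  rewrite -subr_ge0 (_ : _ - _ = (x - c) ^+ 2 - (2 * h) ^+ 2); last first.
    by rewrite exprMn h2 /c; ring.
  rewrite subr_sqr; case/nandP: xc; rewrite -leNgt => xc.
    by rewrite -mulrNN mulr_ge0//; lra.
  by rewrite mulr_ge0//; lra.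
rewrite -H -ge0_integralZl//; last 2 first.
- apply: measurableT_comp; first exact: mf.
  apply: measurable_funTS; apply: measurable_funB => //.
  by apply: measurable_funM => //; exact: measurable_cos.
- by rewrite lee_fin invr_ge0 ltW.
apply: eq_integral => v; rewrite inE/= in_itv/= => vpi.
have s0 : 0 < sin v by rewrite sin_gt0_pi.
rewrite -muleA -EFinM muleC; congr (_%:E * _)%E.
rewrite /arcsine_density (_ : _ - _ = (2 * h * sin v) ^+ 2); last first.
  by rewrite !exprMn sin2cos2 h2 /c; nra.
rewrite sqrtr_sqr gtr0_norm ?mulr_gt0//; move: pi0; move: (pi) => P P0; field.
by rewrite !gt_eqF.
Qed.

Lemma integral_mp_density (k delta : R) (f : R -> \bar R) : 0 <= k ->
  measurable_fun setT f -> (forall x, 0 <= f x)%E ->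
  (\int[mu]_x (f x * (mp_density k (x + delta))%:E) =
   \int[mu]_(t in `]0%R, 1%R[) ((pi^-1)%:E * \int[mu]_(x in `]0%R, pi[)
     f (2 * t + k - delta - 2 * Num.sqrt (t * (t + k)) * cos x)%R))%E.
Proof.
move=> k0 mf f0.
pose I01 : set R := `]0%R, 1%R[%classic.
have mI : measurable I01 by exact: measurable_itv.
pose F (z : R * R) := (f z.1 * (arcsine_density k z.2 (z.1 + delta) * \1_I01 z.2)%:E)%E.
have mF : measurable_fun setT F.
  apply: emeasurable_funM; first exact: measurableT_comp.
  apply/measurable_EFinP; apply: measurable_funM.
    by apply: measurable_arcsine_density => //; exact: measurable_funD.
  by apply: measurableT_comp => //; exact: measurable_indic.
have F0 z : (0 <= F z)%E.
  by rewrite mule_ge0// lee_fin mulr_ge0// arcsine_density_ge0.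
have := @fubini_tonelli _ _ _ _ R mu mu F mF F0.
have -> : (\int[mu]_x \int[mu]_y F (x, y) = \int[mu]_x (f x * (mp_density k (x + delta))%:E))%E.
  apply: eq_integral => x _; rewrite /F/= ge0_integralZl//; last 2 first.
  - apply/measurable_EFinP; apply: measurable_funM; last exact: measurable_indic.
    exact: measurable_arcsine_density.
  - by move=> y _; rewrite lee_fin mulr_ge0// arcsine_density_ge0.
  congr (_ * _)%E; rewrite -integral_arcsine_density [RHS]integral_mkcond.
  apply: eq_integral => t _; rewrite patchE indicE; case: ifPn => _; by rewrite ?mulr1 ?mulr0.
move=> ->; rewrite [RHS]integral_mkcond; apply: eq_integral => t _.
rewrite patchE /F/= indicE; case: ifPn => tI; last first.
  by under eq_integral do rewrite mulr0 mule0; rewrite integral0.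
under eq_integral do rewrite mulr1.
by move: tI; rewrite inE/= in_itv/= => /andP[t0 _]; rewrite integral_against_arcsine_density.
Qed.

End mixture.

Section derivatives.
Context (R : realType).
Implicit Types (f : R -> R) (x : R).

Lemma is_derive_ln_comp f x df : is_derive x 1 f df -> 0 < f x ->
  is_derive x 1 (fun t => ln (f t)) (df / f x).
Proof.
move=> dfx fx; rewrite mulrC.
exact: (@is_derive1_comp _ _ _ x _ _ (is_derive1_ln fx) dfx).
Qed.

Lemma is_derive_sqrt_comp f x df : is_derive x 1 f df -> 0 < f x ->
  is_derive x 1 (fun t => Num.sqrt (f t)) (df / (2 * Num.sqrt (f x))).
Proof.
move=> dfx fx; rewrite mulrC.
exact: (@is_derive1_comp _ _ _ x _ _ (is_derive1_sqrt fx) dfx).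
Qed.

Lemma continuous_ln_comp f x : {for x, continuous f} -> 0 < f x ->
  {for x, continuous (fun t => ln (f t))}.
Proof. by move=> cf fx; apply: continuous_comp => //; exact: continuous_ln. Qed.
End derivatives.

(** * Closed form of the potential of the mixture *)

Section edge.
Context (R : realType).
Variables (k y s : R).
Hypotheses (k0 : 0 <= k) (y0 : 0 < y) (s2 : s ^+ 2 = 1) (sr : 0 < s * (y - k)).
Definition pot_r := y - k.
(** The sign [s] of [y - k] is carried as a variable, so that both sides of [k] are treated at once.
    With this signed root, [s / 2 * pot_a t] is the argument of the logarithm in [itv_pot] when [y]
    lies outside the component. *)
Definition pot_e (t : R) := s * Num.sqrt (pot_r ^+ 2 - 4 * t * y).
Definition pot_a (t : R) := pot_r - 2 * t + pot_e t.
Definition pot_b (t : R) := pot_e t + y + k.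
Definition pot_tau := pot_r ^+ 2 / (4 * y).

(* [pot_tau] is the parameter at which [y] enters the support of the mixture component;
   below it [pot_H] is an antiderivative of the potential of that component, beyond it [pot_L]. *)
Definition pot_H (t : R) := t * ln (s / 2 * pot_a t) - pot_e t / 2 - t + k * ln (pot_b t).

Let tauE : 4 * y * pot_tau = pot_r ^+ 2. Proof. by rewrite /pot_tau; field; rewrite gt_eqF. Qed.

Let s_cases : s = 1 \/ s = - 1.
Proof.
have /eqP : (s - 1) * (s + 1) = 0 by rewrite -subr_sqr s2; ring.
by rewrite mulf_eq0 => /orP[]/eqP ?; [left|right]; lra.
Qed.

Let r2_gt0 : 0 < pot_r ^+ 2.
Proof. rewrite -[pot_r ^+ 2]mul1r -s2 -exprMn exprn_gt0//. Qed.

Let discE t : pot_r ^+ 2 - 4 * t * y = 4 * y * (pot_tau - t).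
Proof. by rewrite -tauE; ring. Qed.

Let disc t : t <= pot_tau -> 0 <= pot_r ^+ 2 - 4 * t * y.
Proof. by move=> tt; rewrite discE !mulr_ge0 ?subr_ge0// ltW. Qed.

Let disc_gt0 t : t < pot_tau -> 0 < pot_r ^+ 2 - 4 * t * y.
Proof. by move=> tt; rewrite discE !mulr_gt0 ?subr_gt0. Qed.

Let e2 t : t <= pot_tau -> pot_e t ^+ 2 = pot_r ^+ 2 - 4 * t * y.
Proof. by move=> tt; rewrite exprMn s2 mul1r sqr_sqrtr// disc. Qed.

(** The point stays on one side of the centre [2 t + k] until the component reaches it. Only [s = 1]
    needs an argument: [4 t y <= pot_r^2 <= pot_r * y]. *)
Let sra t : 0 <= t -> t <= pot_tau -> 0 < s * (pot_r - 2 * t).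
Proof.
move=> t0 tt; have k0' := k0; have y0' := y0; have := disc tt.
case: s_cases sr => ->; rewrite -/pot_r => h ?; last lra.
have ry : pot_r <= y by rewrite /pot_r gerBl.
have rr : pot_r * pot_r <= pot_r * y by rewrite ler_wpM2l//; lra.
have : y * (4 * t) <= y * pot_r by nra.
by rewrite ler_pM2l//; lra.
Qed.

Let se_ge0 t : 0 <= s * pot_e t.
Proof. by rewrite mulrA -expr2 s2 mul1r sqrtr_ge0. Qed.

Let sa t : 0 <= t -> t <= pot_tau -> 0 < s / 2 * pot_a t.
Proof.
move=> t0 tt; have := sra t0 tt; have := se_ge0 t; rewrite /pot_a => h1 h2.
rewrite (_ : s / 2 * _ = (s * (pot_r - 2 * t) + s * pot_e t) / 2); first lra.
by field.
Qed.

Let b_gt0 t : 0 <= t -> t <= pot_tau -> 0 < pot_b t.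
Proof.
move=> t0 tt; have k0' := k0; have y0' := y0; have := e2 tt; have := se_ge0 t; rewrite /pot_b.
case: s_cases sr => ->; rewrite -/pot_r => h ? ?; first lra.
have : pot_e t ^+ 2 <= pot_r ^+ 2 by nra.
move=> h2; have : 0 <= (- pot_r + pot_e t) by nra.
by rewrite /pot_r; lra.
Qed.

Let e_neq0 t : t < pot_tau -> pot_e t != 0.
Proof.
by move=> tt; rewrite -sqrf_eq0 e2 ?gt_eqF ?disc_gt0// ltW.
Qed.

Let de t : t < pot_tau -> is_derive t 1 pot_e (- 2 * y / pot_e t).
Proof.
move=> tt.
have d1 : is_derive t 1 (fun t => pot_r ^+ 2 - 4 * t * y) (- 4 * y).
  by apply: is_derive_eq; rewrite /GRing.scale/=; ring.
have d2 := is_derive_sqrt_comp d1 (disc_gt0 tt).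
apply: is_derive_eq; rewrite /GRing.scale/= /pot_e.
have q0 : Num.sqrt (pot_r ^+ 2 - 4 * t * y) != 0 by rewrite gt_eqF// sqrtr_gt0 disc_gt0.
by case: s_cases => ->; field.
Qed.

Let dH t : 0 <= t -> t < pot_tau -> is_derive t 1 pot_H (ln (s / 2 * pot_a t)).
Proof.
move=> t0 tt; have d1 := de tt; have tt' := ltW tt.
have da : is_derive t 1 (fun t => s / 2 * pot_a t) (s / 2 * (- 2 - 2 * y / pot_e t)).
  by rewrite /pot_a; apply: is_derive_eq; rewrite /GRing.scale/=; ring.
have db : is_derive t 1 pot_b (- 2 * y / pot_e t).
  by rewrite /pot_b; apply: is_derive_eq; rewrite /GRing.scale/=; ring.
have dla := is_derive_ln_comp da (sa t0 tt').
have dlb := is_derive_ln_comp db (b_gt0 t0 tt').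
apply: is_derive_eq; rewrite /GRing.scale/=.
have en := e_neq0 tt.
have an : pot_a t != 0.
  by have := sa t0 tt'; apply: contraTneq => ->; rewrite mulr0 ltxx.
have bn : pot_b t != 0 by rewrite gt_eqF// b_gt0.
have sn : s != 0 by case: s_cases => ->; rewrite ?oppr_eq0 oner_eq0.
have te : t = (pot_r ^+ 2 - pot_e t ^+ 2) / (4 * y) by rewrite e2//; field; rewrite gt_eqF.
move: an bn en te; rewrite /pot_a /pot_b /pot_r; move: (pot_e t) => u an bn en te.
have yn : y != 0 by rewrite gt_eqF.
(* Once [t] is expressed through the root [u], [pot_a] factors and [pot_b] is one of its factors;
   the derivative becomes a rational identity in [u]. *)
have aE : y - k - 2 * t + u = (u + y - k) * (u + y + k) / (2 * y).
  by rewrite te; field.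
rewrite aE in an *; move: (ln _) => l.
have cn : u + y - k != 0.
  by move: an; apply: contra_neq => ->; rewrite !mul0r.
by rewrite te; field; rewrite cn yn bn en sn.
Qed.

Let cH t : 0 <= t -> t <= pot_tau -> {for t, continuous pot_H}.
Proof.
move=> t0 tt.
have ce : {for t, continuous pot_e}.
  apply: cvgM; first exact: cvg_cst.
  apply: continuous_comp; last exact: sqrt_continuous.
  apply: cvgB; first exact: cvg_cst.
  by apply: cvgM; [apply: cvgM; [exact: cvg_cst|exact: cvg_id]|exact: cvg_cst].
have ca : {for t, continuous (fun t => s / 2 * pot_a t)}.
  apply: cvgM; first exact: cvg_cst.
  apply: cvgD => //; apply: cvgB; first exact: cvg_cst.
  by apply: cvgM; [exact: cvg_cst|exact: cvg_id].
have cb : {for t, continuous pot_b}.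
  by apply: cvgD; [apply: cvgD => //; exact: cvg_cst|exact: cvg_cst].
have cla := continuous_ln_comp ca (sa t0 tt).
have clb := continuous_ln_comp cb (b_gt0 t0 tt).
apply: cvgD; last by apply: cvgM => //; exact: cvg_cst.
apply: cvgB; last exact: cvg_id.
apply: cvgB; first by apply: cvgM => //; exact: cvg_id.
by apply: cvgM => //; exact: cvg_cst.
Qed.

Let cU t : 0 <= t -> t <= pot_tau -> {for t, continuous (fun t => ln (s / 2 * pot_a t))}.
Proof.
move=> t0 tt; apply: continuous_ln_comp; last exact: sa.
have ce : {for t, continuous pot_e}.
  apply: cvgM; first exact: cvg_cst.
  apply: continuous_comp; last exact: sqrt_continuous.
  apply: cvgB; first exact: cvg_cst.
  by apply: cvgM; [apply: cvgM; [exact: cvg_cst|exact: cvg_id]|exact: cvg_cst].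
apply: cvgM; first exact: cvg_cst.
apply: cvgD => //; apply: cvgB; first exact: cvg_cst.
by apply: cvgM; [exact: cvg_cst|exact: cvg_id].
Qed.

Definition pot_L (t : R) := t / 2 * (ln t + ln (t + k)) + k / 2 * ln (t + k) - t.

Let dL (t : R) : 0 < t -> is_derive t 1 pot_L ((ln t + ln (t + k)) / 2).
Proof.
move=> t0; have tk : 0 < t + k by rewrite ltr_wpDr.
have d1 := is_derive1_ln t0.
have d2 : is_derive t 1 (fun t => t + k) 1 by apply: is_derive_eq; rewrite ?addr0.
have d3 := is_derive_ln_comp d2 tk.
apply: is_derive_eq; rewrite /GRing.scale/=.
by field; rewrite !gt_eqF.
Qed.

Lemma itv_pot_ge (d h : R) : 0 < h -> ln h <= itv_pot d h.
Proof.
move=> h0; rewrite /itv_pot; case: ifPn => //; rewrite -ltNge => dh.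
have s0 := sqrtr_ge0 (d ^+ 2 - 4 * h ^+ 2); rewrite ler_ln ?posrE//; lra.
Qed.

Let U (t : R) := itv_pot (y - (2 * t + k)) (Num.sqrt (t * (t + k))).

Let U_lt t : 0 < t -> t < pot_tau -> U t = ln (s / 2 * pot_a t).
Proof.
move=> t0 tt; have tk : 0 < t * (t + k) by rewrite mulr_gt0// ltr_wpDr.
have h2 : Num.sqrt (t * (t + k)) ^+ 2 = t * (t + k) by rewrite sqr_sqrtr// ltW.
have D : (y - (2 * t + k)) ^+ 2 - 4 * Num.sqrt (t * (t + k)) ^+ 2 = pot_r ^+ 2 - 4 * t * y.
  by rewrite h2 /pot_r; ring.
rewrite /U /itv_pot D; case: ifPn => [|_].
  rewrite -ler_sqr ?nnegrE ?mulr_ge0 ?sqrtr_ge0// real_normK ?num_real// exprMn.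
  by have := disc_gt0 tt; lra.
have nd : `|y - (2 * t + k)| = s * (pot_r - 2 * t).
  have := sra (ltW t0) (ltW tt).
  rewrite (_ : y - (2 * t + k) = pot_r - 2 * t); last by rewrite /pot_r; ring.
  case: s_cases => ->; rewrite ?mul1r ?mulN1r ?oppr_gt0 => h; first by rewrite gtr0_norm.
  by rewrite ltr0_norm.
rewrite nd /pot_a /pot_e; congr ln; rewrite -[X in (_ + X) / 2]mul1r -s2; field.
by case: s_cases => ->; rewrite ?oppr_eq0 oner_eq0.
Qed.

Let U_ge t : 0 < t -> pot_tau <= t -> U t = (ln t + ln (t + k)) / 2.
Proof.
move=> t0 tt; have tk0 : 0 < t + k by rewrite ltr_wpDr.
have tk : 0 < t * (t + k) by rewrite mulr_gt0.
have h2 : Num.sqrt (t * (t + k)) ^+ 2 = t * (t + k) by rewrite sqr_sqrtr// ltW.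
rewrite /U /itv_pot ifT.
  by rewrite -lnM ?posrE// -[in RHS]h2 lnXn ?sqrtr_gt0// mulr2n; field.
rewrite -ler_sqr ?nnegrE ?mulr_ge0 ?sqrtr_ge0// real_normK ?num_real// exprMn h2.
rewrite -subr_le0 (_ : _ - _ = 4 * y * (pot_tau - t)); last first.
  by rewrite mulrBr tauE /pot_r; ring.
by rewrite mulr_ge0_le0 ?subr_le0// mulr_ge0// ltW.
Qed.

Let tau_gt0 : 0 < pot_tau.
Proof. by rewrite divr_gt0// mulr_gt0. Qed.

(** The matching constant comes from [pot_tau + k = (y + k)^2 / (4 y)] and
    [pot_b pot_tau = y + k]. *)
Let HL_tau : pot_H pot_tau - k / 2 * ln (4 * y) = pot_L pot_tau.
Proof.
have k0' := k0; have y0' := y0.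
have e0 : pot_e pot_tau = 0.
  by apply/eqP; rewrite -sqrf_eq0 e2// discE subrr mulr0.
rewrite /pot_H /pot_L /pot_a /pot_b e0 addr0 add0r mul0r subr0.
have yk : 0 < y + k by lra.
have tk : pot_tau + k = (y + k) ^+ 2 / (4 * y).
  by rewrite /pot_tau /pot_r; field; rewrite gt_eqF.
have tk0 : 0 < pot_tau + k by rewrite ltr_wpDr.
have lntk : ln (pot_tau + k) = 2 * ln (y + k) - ln (4 * y).
  by rewrite tk ln_div ?posrE ?exprn_gt0 ?mulr_gt0// lnXn// mulr2n; ring.
have -> : s / 2 * (pot_r - 2 * pot_tau) = Num.sqrt (pot_tau * (pot_tau + k)).
  rewrite -[LHS]gtr0_norm -?sqrtr_sqr; last first.
    by have := sra (ltW tau_gt0) (lexx _); lra.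
  congr Num.sqrt; rewrite !exprMn s2 tk /pot_tau /pot_r; field.
  by rewrite gt_eqF.
have h0 : 0 < pot_tau * (pot_tau + k) by rewrite mulr_gt0.
have -> : ln (Num.sqrt (pot_tau * (pot_tau + k))) = (ln pot_tau + ln (pot_tau + k)) / 2.
  by rewrite -lnM ?posrE// -[in RHS](sqr_sqrtr (ltW h0)) lnXn ?sqrtr_gt0// mulr2n; field.
by rewrite lntk; field.
Qed.

Let H0 : pot_H 0 = - (y - k) / 2 + k * ln (2 * y).
Proof.
have e0 : pot_e 0 = pot_r.
  rewrite /pot_e mulr0 mul0r subr0 sqrtr_sqr.
  by case: s_cases sr => ->; rewrite -/pot_r => h; [rewrite gtr0_norm|rewrite ltr0_norm]; lra.
by rewrite /pot_H /pot_b e0 mul0r sub0r subr0 /pot_r; congr (_ + k * ln _); field.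
Qed.

Notation mu := (@lebesgue_measure R).

Lemma measurable_mixture_pot M : measurable_fun setT (fun t : R =>
  (M - itv_pot (y - (2 * t + k)) (Num.sqrt (t * (t + k))))%:E).
Proof.
apply/measurable_EFinP; apply: measurable_funB => //.
have md : measurable_fun setT (fun t : R => y - (2 * t + k)).
  by apply: measurable_funB => //; apply: measurable_funD => //; exact: measurable_funM.
have mh : measurable_fun setT (fun t : R => Num.sqrt (t * (t + k))).
  apply: measurableT_comp; first exact: measurable_sqrtr.
  by apply: measurable_funM => //; exact: measurable_funD.
have mn : measurable_fun setT (fun t : R => `|y - (2 * t + k)|).
  exact: measurableT_comp.
apply: measurable_fun_ifT.
- by apply: measurable_fun_ler => //; exact: measurable_funM.
- by apply: measurableT_comp => //; exact: measurable_ln.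
- apply: measurableT_comp; first exact: measurable_ln.
  apply: measurable_funM => //; apply: measurable_funD => //.
  apply: measurableT_comp; first exact: measurable_sqrtr.
  by apply: measurable_funB; [exact: measurable_funX|apply: measurable_funM => //; exact: measurable_funX].
Qed.

Let int_H T M : 0 < T -> T <= pot_tau ->
  (\int[mu]_(t in `]0%R, T[) (M - U t)%:E = (M * T - (pot_H T - pot_H 0))%:E)%E.
Proof.
move=> T0 Tt; transitivity (\int[mu]_(t in `]0%R, T[) (M - ln (s / 2 * pot_a t))%:E)%E.
  apply: eq_integral => t; rewrite inE/= in_itv/= => /andP[t0 tT].
  by rewrite U_lt// (lt_le_trans tT).
have cf : {within `[0, T], continuous (fun t => M - ln (s / 2 * pot_a t))}.
  apply: continuous_within => t /=; rewrite in_itv/= => /andP[t0 tT].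
  by apply: cvgB; [exact: cvg_cst|apply: cU => //; exact: le_trans Tt].
rewrite -(@integral_itv_bndoo _ _ _ _ true false); last first.
  apply: measurable_funS (_ : measurable_fun `[0, T] _) => //.
    exact: subset_itv_oo_cc.
  by apply/measurable_EFinP; apply: subspace_continuous_measurable_fun.
have dF (t : R) : t \in `]0, T[ -> is_derive t 1 (fun t => M * t - pot_H t) (M - ln (s / 2 * pot_a t)).
  rewrite in_itv/= => /andP[t0 tT].
  have d1 := dH (ltW t0) (lt_le_trans tT Tt).
  by apply: is_derive_eq; rewrite /GRing.scale/=; ring.
have cF : {within `[0, T], continuous (fun t => M * t - pot_H t)}.
  apply: continuous_within => t /=; rewrite in_itv/= => /andP[t0 tT].
  apply: cvgB; first by apply: cvgM; [exact: cvg_cst|exact: cvg_id].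
  by apply: cH => //; exact: le_trans Tt.
by rewrite (FTC_is_derive (ltW T0) cf cF dF); congr EFin; ring.
Qed.

Let int_L M : pot_tau < 1 ->
  (\int[mu]_(t in `]pot_tau, 1%R[) (M - U t)%:E =
   (M * (1 - pot_tau) - (pot_L 1 - pot_L pot_tau))%:E)%E.
Proof.
move=> tau1; transitivity (\int[mu]_(t in `]pot_tau, 1%R[) (M - (ln t + ln (t + k)) / 2)%:E)%E.
  apply: eq_integral => t; rewrite inE/= in_itv/= => /andP[t0 tT].
  by rewrite U_ge ?(lt_trans tau_gt0)// ltW.
have cf : {within `[pot_tau, 1], continuous (fun t => M - (ln t + ln (t + k)) / 2)}.
  apply: continuous_within => t /=; rewrite in_itv/= => /andP[t0 tT].
  have tp := lt_le_trans tau_gt0 t0.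
  apply: cvgB; first exact: cvg_cst.
  apply: cvgM; last exact: cvg_cst.
  have cl : {for t, continuous (fun t => ln (t + k))}.
    apply: continuous_ln_comp; last by rewrite ltr_wpDr.
    by apply: cvgD; [exact: cvg_id|exact: cvg_cst].
  by apply: cvgD => //; exact: continuous_ln.
rewrite -(@integral_itv_bndoo _ _ _ _ true false); last first.
  apply: measurable_funS (_ : measurable_fun `[pot_tau, 1] _) => //.
    exact: subset_itv_oo_cc.
  by apply/measurable_EFinP; apply: subspace_continuous_measurable_fun.
have dM (t : R) : 0 < t -> is_derive t 1 (fun t => M * t - pot_L t) (M - (ln t + ln (t + k)) / 2).
  move=> t0; have d1 := dL t0.
  by apply: is_derive_eq; rewrite /GRing.scale/=; ring.
have cF : {within `[pot_tau, 1], continuous (fun t => M * t - pot_L t)}.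
  apply: continuous_within => t /=; rewrite in_itv/= => /andP[t0 tT].
  by apply: continuous_is_derive; exact: dM (lt_le_trans tau_gt0 t0).
have dF (t : R) : t \in `]pot_tau, 1[ ->
    is_derive t 1 (fun t => M * t - pot_L t) (M - (ln t + ln (t + k)) / 2).
  by rewrite in_itv/= => /andP[t0 tT]; exact: dM (lt_trans tau_gt0 t0).
by rewrite (FTC_is_derive (ltW tau1) cf cF dF); congr EFin; ring.
Qed.

(* The Euler-Lagrange constant of the Marchenko-Pastur density. *)
Definition mp_ell := 2 + k - (k + 1) * ln (k + 1).

Let value : 2 * (pot_L 1 + k / 2 * ln (4 * y) - pot_H 0) = y - k * ln y - mp_ell.
Proof.
have l4 : ln (4 * y) = 2 * ln 2 + ln y.
  by rewrite lnM ?posrE// (_ : 4 = 2 ^+ 2 :> R) ?lnXn// ?mulr_natl//; ring.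
have l2 : ln (2 * y) = ln 2 + ln y by rewrite lnM ?posrE.
by rewrite H0 /pot_L /mp_ell l4 l2 ln1 (addrC 1 k); field.
Qed.

(** The Euler-Lagrange relation in the variable [y]. The free constant [M] is kept because Tonelli
    will be applied to the nonnegative function [M - ln |x - z|]. If [pot_tau < 1] the two
    antiderivatives are glued at [pot_tau] and equality holds; otherwise only [pot_H] occurs. *)
Lemma mixture_potE : exists W,
  [/\ forall M, (\int[mu]_(t in `]0%R, 1%R[) (M - U t)%:E = (M - W)%:E)%E,
      2 * W <= y - k * ln y - mp_ell
    & (y - k) ^+ 2 <= 4 * y -> 2 * W = y - k * ln y - mp_ell].
Proof.
have HL := HL_tau; have v := value.
have [tau1|tau1] := ltP pot_tau 1.
  exists (pot_L 1 + k / 2 * ln (4 * y) - pot_H 0); split; rewrite ?v// => M.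
  rewrite (@itv_bndbnd_setU _ _ (BRight 0) (BRight pot_tau) (BLeft 1)); last 2 first.
  - by rewrite bnd_simp ltW.
  - by rewrite bnd_simp.
  rewrite integral_setU//; last 2 first.
  - by apply: measurable_funTS; exact: measurable_mixture_pot.
  - apply/disj_setPS => x [] /=; rewrite !in_itv/= => /andP[_ xp] /andP[px _].
    by have := lt_le_trans px xp; rewrite ltxx.
  rewrite (@integral_itv_bndoo _ 0 pot_tau _ false false); last by apply: measurable_funTS; exact: measurable_mixture_pot.
  by rewrite int_H// int_L// -EFinD; congr EFin; lra.
exists (pot_H 1 - pot_H 0); split.
- by move=> M; rewrite int_H// mulr1.
- rewrite -v ler_pM2l// lerD2r.
  move: tau1; rewrite le_eqVlt => /predU1P[tau1|tau1].
    by move: HL; rewrite -tau1; lra.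
  (* Outside its interval an arcsine potential is at least its inner value [ln h], so
     [pot_H - pot_L] does not decrease on [[1, pot_tau]]; its value at [pot_tau] is known. *)
  have d (t : R) : 0 < t -> t < pot_tau -> is_derive t 1 (fun t => pot_H t - pot_L t)
      (ln (s / 2 * pot_a t) - (ln t + ln (t + k)) / 2).
    move=> t0 tt; have d1 := dL t0; have d2 := dH (ltW t0) tt.
    exact: is_derive_eq.
  have [||c] := @MVT R (fun t => pot_H t - pot_L t)
    (fun t => ln (s / 2 * pot_a t) - (ln t + ln (t + k)) / 2) 1 pot_tau tau1.
  + by move=> t; rewrite in_itv/= => /andP[t1 tt]; apply: d => //; exact: lt_trans t1.
  + apply: continuous_within => t /=; rewrite in_itv/= => /andP[t1 tt].
    have t0 : 0 < t := lt_le_trans ltr01 t1.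
    apply: cvgB; first by apply: cH => //; exact: ltW.
    exact: continuous_is_derive (dL t0).
  rewrite in_itv/= => /andP[c1 ct]; have c0 : 0 < c := lt_trans ltr01 c1.
  have : 0 <= ln (s / 2 * pot_a c) - (ln c + ln (c + k)) / 2.
    have ck : 0 < c * (c + k) by rewrite mulr_gt0// ltr_wpDr.
    rewrite -U_lt// subr_ge0; apply: le_trans (itv_pot_ge _ _); last by rewrite sqrtr_gt0.
    rewrite -lnM ?posrE//; last by rewrite ltr_wpDr.
    rewrite -[in leLHS](sqr_sqrtr (ltW ck)) lnXn ?sqrtr_gt0// mulr2n; lra.
  move=> h h1; have t1 : 0 <= pot_tau - 1 by lra.
  by have := mulr_ge0 h t1; rewrite -h1; lra.
- move=> h; have tau1' : pot_tau = 1.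
    apply/eqP; rewrite eq_le tau1 andbT ler_pdivrMr ?mulr_gt0// mul1r.
    exact: h.
  by rewrite -v; move: HL; rewrite tau1'; lra.
Qed.

End edge.

(** At [y = 0], outside the range of the closed form above, the root simplifies to [k] and the
    potential of a component is [ln (t + k)]. This yields the logarithmic moment. *)
Lemma mixture_pot0 (R : realType) (k M : R) : 0 < k ->
  (\int[@lebesgue_measure R]_(t in `]0%R, 1%R[)
     (M - itv_pot (0 - (2 * t + k)) (Num.sqrt (t * (t + k))))%:E =
   (M - ((k + 1) * ln (k + 1) - k * ln k - 1))%:E)%E.
Proof.
move=> k0.
transitivity (\int[@lebesgue_measure R]_(t in `]0%R, 1%R[) (M - ln (t + k))%:E)%E.
  apply: eq_integral => t; rewrite inE/= in_itv/= => /andP[t0 _].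
  have tk : 0 < t * (t + k) by rewrite mulr_gt0// addr_gt0.
  have h2 : Num.sqrt (t * (t + k)) ^+ 2 = t * (t + k) by rewrite sqr_sqrtr// ltW.
  have D : (0 - (2 * t + k)) ^+ 2 - 4 * Num.sqrt (t * (t + k)) ^+ 2 = k ^+ 2.
    by rewrite h2; ring.
  have nd : `|0 - (2 * t + k)| = 2 * t + k by rewrite sub0r normrN gtr0_norm//; lra.
  rewrite /itv_pot D nd ifF.
    by rewrite sqrtr_sqr gtr0_norm//; congr (M - ln _)%:E; field.
  apply/negbTE; rewrite -ltNge -ltr_sqr ?nnegrE ?mulr_ge0 ?sqrtr_ge0//; last lra.
  by rewrite exprMn h2; nra.
have dM (t : R) : 0 <= t -> is_derive t 1 (fun t => M * t - ((t + k) * ln (t + k) - t)) (M - ln (t + k)).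
  move=> t0; have tk : 0 < t + k by rewrite ltr_wpDl.
  have d2 : is_derive t 1 (fun t => t + k) 1 by apply: is_derive_eq; rewrite ?addr0.
  have d3 := is_derive_ln_comp d2 tk.
  by apply: is_derive_eq; rewrite /GRing.scale/=; field; rewrite gt_eqF.
have cf : {within `[0, 1], continuous (fun t => M - ln (t + k))}.
  apply: continuous_within => t /=; rewrite in_itv/= => /andP[t0 tT].
  have cl : {for t, continuous (fun t => ln (t + k))}.
    apply: continuous_ln_comp; last by rewrite ltr_wpDl.
    by apply: cvgD; [exact: cvg_id|exact: cvg_cst].
  by apply: cvgB => //; exact: cvg_cst.
have mC : measurable_fun (`]0%R, 1%R[ : set R) (fun t : R => (M - ln (t + k))%:E).
  apply: measurable_funTS; apply/measurable_EFinP; apply: measurable_funB => //.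
  by apply: measurableT_comp; [exact: measurable_ln|exact: measurable_funD].
rewrite -(@integral_itv_bndoo _ _ _ _ true false)//.
have cF : {within `[0, 1], continuous (fun t => M * t - ((t + k) * ln (t + k) - t))}.
  apply: continuous_within => t /=; rewrite in_itv/= => /andP[t0 tT].
  by apply: continuous_is_derive; exact: dM.
have dF (t : R) : t \in `]0, 1[ ->
    is_derive t 1 (fun t => M * t - ((t + k) * ln (t + k) - t)) (M - ln (t + k)).
  by rewrite in_itv/= => /andP[t0 tT]; exact: dM (ltW t0).
by rewrite (FTC_is_derive ler01 cf cF dF) add0r (addrC 1 k); congr EFin; ring.
Qed.

(** * Moments and logarithmic potential of the Marchenko-Pastur density *)

Section mp_moments.
Context (R : realType).
Notation mu := (@lebesgue_measure R).
Variables (k delta : R).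
Hypothesis k0 : 0 <= k.
Let p (z : R) := mp_density k (z + delta).

Let mp_meas D : measurable_fun D p.
Proof. by apply: measurable_mp_density; exact: measurable_funD. Qed.

Let mupi : mu `]0, pi[ = (@pi R)%:E.
Proof. by rewrite [LHS](lebesgue_measure_itv `]0, pi[)/= lte_fin pi_gt0 sube0. Qed.

Let mu01 : mu `]0, 1[ = (1 : R)%:E.
Proof. by rewrite [LHS](lebesgue_measure_itv `]0, 1[)/= lte_fin ltr01 sube0. Qed.

Lemma mp_mass : (\int[mu]_z (p z)%:E = 1)%E.
Proof.
have pn : @pi R != 0 by rewrite gt_eqF// pi_gt0.
have := @integral_mp_density R k delta (fun=> 1%E) k0 (@measurable_cst _ _ _ _ _ _) (fun=> lee01).
under eq_integral do rewrite mul1e.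
move=> ->; under eq_integral.
  move=> t _; rewrite integral_constant// [X in (_ * (_ * X))%E]mupi mul1e -EFinM mulVf//.
  over.
by rewrite integral_constant// [X in (_ * X)%E]mu01 mule1.
Qed.

Let spread t : 0 < t -> 2 * Num.sqrt (t * (t + k)) <= 2 * t + k.
Proof.
move=> t0; have k0' := k0; have tk : 0 <= t * (t + k) by rewrite mulr_ge0; lra.
rewrite -ler_sqr ?nnegrE ?mulr_ge0 ?sqrtr_ge0//; last lra.
by rewrite exprMn sqr_sqrtr//; nra.
Qed.

Let cos_spread t x : 0 < t ->
  0 <= 2 * t + k - 2 * Num.sqrt (t * (t + k)) * cos x.
Proof.
move=> t0; have := spread t0; have := sqrtr_ge0 (t * (t + k)).
have := cos_le1 x; have := cos_geN1 x; nra.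
Qed.

Let cos_spread_le t x : 0 < t -> t < 1 ->
  2 * t + k - 2 * Num.sqrt (t * (t + k)) * cos x <= 4 + 2 * k.
Proof.
move=> t0 t1; have := spread t0; have := sqrtr_ge0 (t * (t + k)).
have := cos_le1 x; have := cos_geN1 x; have k0' := k0; nra.
Qed.

Let integral_cos0 : (\int[mu]_(x in `]0%R, (@pi R)[) (cos x)%:E = 0)%E.
Proof.
rewrite -(@integral_itv_bndoo _ _ _ _ true false); last first.
  by apply/measurable_EFinP; exact: measurable_cos.
have dF (t : R) : t \in `]0, pi[ -> is_derive t 1 (@sin R) (cos t) by move=> _; exact: is_derive_sin.
rewrite (FTC_is_derive (pi_ge0 R) _ _ dF) ?sinpi ?sin0 ?subrr//.
- by apply: continuous_subspaceT => ?; exact: continuous_cos.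
- by apply: continuous_subspaceT => ?; exact: continuous_sin.
Qed.

(** The absolute value provides the nonnegativity that the mixture formula asks for; on the support
    it changes nothing. Each component has mean [2 t + k]. *)
Lemma mp_first_moment : (\int[mu]_z (`|z + delta| * p z)%:E = (1 + k)%:E)%E.
Proof.
have pn : @pi R != 0 by rewrite gt_eqF// pi_gt0.
have mf : measurable_fun setT (fun z : R => `|z + delta|%:E).
  by apply/measurable_EFinP; apply: measurableT_comp => //; exact: measurable_funD.
have := @integral_mp_density R k delta _ k0 mf (fun z => ltac:(by rewrite lee_fin)).
under eq_integral do rewrite -EFinM.
move=> ->.
have dF (t : R) : t \in `]0, 1[ -> is_derive t 1 (fun t : R => t ^+ 2 + k * t) (2 * t + k).
  by move=> _; apply: is_derive_eq; rewrite /GRing.scale/=; ring.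
have cf : {within `[0, 1], continuous (fun t : R => 2 * t + k)}.
  apply: continuous_within => t _; apply: cvgD; last exact: cvg_cst.
  by apply: cvgM; [exact: cvg_cst|exact: cvg_id].
have cF : {within `[0, 1], continuous (fun t : R => t ^+ 2 + k * t)}.
  apply: continuous_within => t _; apply: cvgD; first by apply: cvgM; exact: cvg_id.
  by apply: cvgM; [exact: cvg_cst|exact: cvg_id].
transitivity (\int[mu]_(t in `]0%R, 1%R[) (2 * t + k)%:E)%E; last first.
  rewrite -(@integral_itv_bndoo _ _ _ _ true false); last first.
    apply/measurable_EFinP; apply: measurable_funD => //; exact: measurable_funM.
  by rewrite (FTC_is_derive ler01 cf cF dF); congr EFin; ring.
apply: eq_integral => t; rewrite inE/= in_itv/= => /andP[t0 t1].
transitivity ((pi^-1)%:E * \int[mu]_(x in `]0%R, pi[)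
    ((2 * t + k)%:E - (2 * Num.sqrt (t * (t + k)))%:E * (cos x)%:E))%E.
  congr (_ * _)%E; apply: eq_integral => x _; rewrite -EFinM -EFinB.
  rewrite (_ : _ + delta = 2 * t + k - 2 * Num.sqrt (t * (t + k)) * cos x); last by ring.
  by rewrite ger0_norm// cos_spread.
have Ic : mu.-integrable `]0%R, pi[ (fun x => (cos x)%:E).
  apply: measurable_bounded_integrable => //.
  - by rewrite [X in (X < _)%E]mupi ltry.
  - exact: measurable_cos.
  exists 1; split; first exact: num_real.
  by move=> M M1 x _ /=; apply: le_trans (cos_max x) (ltW M1).
have Ik : mu.-integrable `]0%R, pi[ (fun x => (2 * t + k)%:E).
  by apply: integrable_constant => //; rewrite [X in (X < _)%E]mupi ltry.
rewrite integralB//; last exact: integrableZl.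
rewrite integralZl// integral_cos0 mule0 sube0 integral_constant// [X in (_ * (_ * X))%E]mupi.
by rewrite -!EFinM; congr EFin; rewrite mulrCA mulVf// mulr1.
Qed.

(** A root-free bound for the upper edge [(sqrt (k + 1) + 1)^2]. *)
Let C := 4 + 2 * k.

Lemma mp_supp z : 0 < p z -> 0 < z + delta <= C.
Proof.
move=> pz; have k0' := k0; rewrite ltNge.
have : (z + delta - k) ^+ 2 < 4 * (z + delta).
  by rewrite ltNge; apply/negP => h; move: pz; rewrite /p mp_density_eq0// ltxx.
have := sqr_ge0 (z + delta - k) => h1 h2; rewrite -ltNge.
by rewrite /C; apply/andP; split; first lra; rewrite leNgt; apply/negP => h; nra.
Qed.

Section log_pot.
Variables (x W : R).
Hypothesis xd : 0 <= x + delta.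
Hypothesis HW : forall M, (\int[mu]_(t in `]0%R, 1%R[)
  (M - itv_pot (x + delta - (2 * t + k)) (Num.sqrt (t * (t + k))))%:E = (M - W)%:E)%E.

Let M := ln (x + delta + C).

Let M_ge0 : 0 <= M. Proof. have k0' := k0; have xd' := xd; apply: ln_ge0; rewrite /C; lra. Qed.

Let ln_le_M (y z : R) : z = x + delta -> 0 <= y <= C -> ln `|z - y| <= M.
Proof.
move=> -> /andP[y0 yC]; have xd' := xd; have k0' := k0.
have [->|n0] := eqVneq (x + delta - y) 0; first by rewrite normr0 ln0.
rewrite ler_ln ?posrE ?normr_gt0//; last by rewrite /C; lra.
by rewrite ler_norml; apply/andP; split; lra.
Qed.

(** The absolute value makes [f] nonnegative on the whole line; on the support [M] majorizes the
    logarithm, so there [f] is [M - ln |x - z|]. *)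
Let f (z : R) : \bar R := `|M - ln `|x - z| |%:E.

Let mln D : measurable_fun D (fun z : R => ln `|x - z|).
Proof. by apply: measurable_ln_norm; exact: measurable_funB. Qed.

Let mf : measurable_fun setT f.
Proof.
by apply/measurable_EFinP; apply: measurableT_comp => //; exact: measurable_funB.
Qed.

Let fp z : (f z * (p z)%:E = ((M - ln `|x - z|) * p z)%:E)%E.
Proof.
rewrite -EFinM; have := mp_density_ge0 k (z + delta); rewrite -/(p z) le_eqVlt.
move=> /predU1P[<-|pz]; first by rewrite !mulr0.
congr (_ * _)%:E; rewrite ger0_norm// subr_ge0.
have -> : x - z = (x + delta) - (z + delta) by ring.
by apply: ln_le_M => //; have /andP[/ltW-> ->] := mp_supp pz.
Qed.

Let inner t : 0 < t < 1 ->
  ((pi^-1)%:E * \int[mu]_(v in `]0%R, pi[)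
    f (2 * t + k - delta - 2 * Num.sqrt (t * (t + k)) * cos v)%R =
  (M - itv_pot (x + delta - (2 * t + k)) (Num.sqrt (t * (t + k))))%:E)%E.
Proof.
move=> /andP[t0 t1].
have k0' := k0; have pn : @pi R != 0 by rewrite gt_eqF// pi_gt0.
have h0 : 0 < Num.sqrt (t * (t + k)) by rewrite sqrtr_gt0 mulr_gt0//; lra.
transitivity ((pi^-1)%:E * \int[mu]_(v in `]0%R, pi[)
    (M%:E - (ln `|(x + delta - (2 * t + k)) + 2 * Num.sqrt (t * (t + k)) * cos v|)%:E))%E.
  congr (_ * _)%E; apply: eq_integral => v _; rewrite /f -EFinB; congr EFin.
  have -> : x - (2 * t + k - delta - 2 * Num.sqrt (t * (t + k)) * cos v) =
    x + delta - (2 * t + k) + 2 * Num.sqrt (t * (t + k)) * cos v by ring.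
  rewrite ger0_norm// subr_ge0.
  have -> : x + delta - (2 * t + k) + 2 * Num.sqrt (t * (t + k)) * cos v =
    x + delta - (2 * t + k - 2 * Num.sqrt (t * (t + k)) * cos v) by ring.
  by apply: ln_le_M => //; rewrite cos_spread// cos_spread_le.
have IM : mu.-integrable `]0%R, pi[ (fun x => M%:E).
  by apply: integrable_constant => //; rewrite [X in (X < _)%E]mupi ltry.
rewrite integralB//; last exact: integrable_itv_pot.
rewrite integral_itv_pot// integral_constant// [X in (_ * (_ * X - _))%E]mupi.
rewrite -[X in (_ * X)%E]/((M * pi - pi * itv_pot (x + delta - (2 * t + k))
  (Num.sqrt (t * (t + k))))%:E) -EFinM; congr EFin.
by rewrite [M * _]mulrC -mulrBr mulrA mulVf// mul1r.
Qed.

Let integral_f : (\int[mu]_z (f z * (p z)%:E) = (M - W)%:E)%E.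
Proof.
rewrite (@integral_mp_density R k delta _ k0 mf) => [|z]; last by rewrite lee_fin.
by rewrite -HW; apply: eq_integral => t; rewrite inE/= in_itv/=; exact: inner.
Qed.

(** Each component potential is at least [ln h >= ln t >= - 2 / sqrt t], and [2 / sqrt t] has
    integral [4] over []0, 1[]. *)
Let W_ge : - 4 <= W.
Proof.
have k0' := k0.
have : ((M - W)%:E <= (M + 4)%:E)%E; last by rewrite lee_fin; lra.
have mb : measurable_fun (`]0%R, 1%R[ : set R) (fun t : R => (M + 2 * (Num.sqrt t)^-1)%:E).
  apply/measurable_EFinP; apply: measurable_funD => //; apply: measurable_funM => //.
  by apply: measurableT_comp; [exact: measurable_invr|exact: measurable_sqrtr].
have ms : measurable_fun (`]0%R, 1%R[ : set R) (fun t : R => ((Num.sqrt t)^-1)%:E).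
  apply/measurable_EFinP.
  by apply: measurableT_comp; [exact: measurable_invr|exact: measurable_sqrtr].
rewrite -HW.
apply: (@le_trans _ _ (\int[mu]_(t in `]0%R, 1%R[) (M + 2 * (Num.sqrt t)^-1)%:E)%E).
  apply: ge0_le_integral => //.
  - move=> t; rewrite /= in_itv/= => t01; rewrite -inner//.
    by apply: mule_ge0; [rewrite lee_fin invr_ge0 pi_ge0|apply: integral_ge0 => v _; rewrite lee_fin].
  - by apply: measurable_funTS; exact: measurable_mixture_pot.
  - move=> t; rewrite /= in_itv/= => /andP[t0 t1].
    have t2 : t ^+ 2 <= t * (t + k) by nra.
    have h0 : 0 < Num.sqrt (t * (t + k)) by rewrite sqrtr_gt0 (lt_le_trans _ t2)// exprn_gt0.
    have th : t <= Num.sqrt (t * (t + k)).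
      by rewrite -[leLHS]gtr0_norm// -sqrtr_sqr ler_sqrt// (le_trans _ t2)// sqr_ge0.
    have l1 : ln t <= ln (Num.sqrt (t * (t + k))) by rewrite ler_ln.
    have l2 := itv_pot_ge (x + delta - (2 * t + k)) h0.
    have l3 := ln_ge_sqrtV t0.
    by rewrite lee_fin; lra.
under eq_integral do rewrite EFinD EFinM.
rewrite ge0_integralD//.
- rewrite integral_constant// [X in (_ * X + _)%E]mu01 ge0_integralZl//.
  by rewrite integral_sqrtV// sqrtr1 -!EFinM -EFinD lee_fin; lra.
- by apply: emeasurable_funM.
Qed.

Let pge0 z : 0 <= p z. Proof. exact: mp_density_ge0. Qed.

Lemma mp_integrable : mu.-integrable setT (EFin \o p).
Proof.
apply/integrableP; split; first by apply/measurable_EFinP; exact: mp_meas.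
by under eq_integral do rewrite /= ger0_norm//; rewrite mp_mass ltry.
Qed.

Let g z := ((M - ln `|x - z|) * p z).

Let g_ge0 z : 0 <= g z.
Proof. by rewrite -lee_fin -fp mule_ge0// lee_fin. Qed.

Let mg : measurable_fun setT g.
Proof.
by apply: measurable_funM; [exact: measurable_funB|exact: mp_meas].
Qed.

Let int_g : (\int[mu]_z (g z)%:E = (M - W)%:E)%E.
Proof. by rewrite -integral_f; apply: eq_integral => z _; rewrite fp. Qed.

Let Ig : mu.-integrable setT (EFin \o g).
Proof.
apply/integrableP; split; first exact/measurable_EFinP.
by under eq_integral do rewrite /= ger0_norm//; rewrite int_g ltry.
Qed.

Let IMp : mu.-integrable setT (fun z => (M%:E * (p z)%:E)%E).
Proof. by apply: integrableZl => //; exact: mp_integrable. Qed.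

Let plnE z : ((p z * ln `|x - z|)%:E = M%:E * (p z)%:E - (g z)%:E)%E.
Proof. by rewrite -EFinM -EFinB; congr EFin; rewrite /g; ring. Qed.

(** The last bound follows from [|ln| <= M + (M - ln)] on the support, whose integral is [2 M - W].
    Its linear growth in [x] is what a competitor with finite first moment can absorb. *)
Lemma mp_log_pot :
  [/\ mu.-integrable setT (fun z => (p z * ln `|x - z|)%:E),
      (\int[mu]_z (p z * ln `|x - z|)%:E = W%:E)%E
    & (\int[mu]_z (p z * `|ln `|x - z| |)%:E <= (2 * (x + delta + C) + 4)%:E)%E].
Proof.
have xd' := xd; have k0' := k0; split.
- apply: eq_integrable (integrableB measurableT IMp Ig) => // z _.
- under eq_integral do rewrite plnE.
  rewrite integralB// int_g integralZl//; last exact: mp_integrable.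
  by rewrite mp_mass mule1 -EFinB; congr EFin; ring.
apply: (@le_trans _ _ (\int[mu]_z (M%:E * (p z)%:E + (g z)%:E))%E).
  apply: ge0_le_integral => //.
  - by move=> z _; rewrite lee_fin mulr_ge0 ?pge0.
  - apply/measurable_EFinP; apply: measurable_funM; first exact: mp_meas.
    by apply: measurableT_comp; [exact: normr_measurable|exact: mln].
  - apply/emeasurable_funD; last exact/measurable_EFinP.
    by apply/measurable_EFinP; apply: measurable_funM => //; exact: mp_meas.
  - move=> z _; rewrite -EFinM -EFinD lee_fin.
    have := pge0 z; rewrite le_eqVlt => /predU1P[<-|pz].
      by rewrite mul0r mulr0 add0r g_ge0.
    have : 0 <= M - ln `|x - z| by rewrite -(pmulr_lge0 _ pz); exact: g_ge0.
    have := M_ge0; rewrite /g => h1 h2.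
    rewrite -mulrDl mulrC ler_pM2r// ler_norml; apply/andP; split; lra.
rewrite ge0_integralD//.
- rewrite int_g ge0_integralZl//.
  + rewrite mp_mass mule1 -EFinD lee_fin.
    have : M <= x + delta + C by apply/ltW/ln_sublinear; rewrite /C; lra.
    by have := W_ge; lra.
  + by apply/measurable_EFinP; exact: mp_meas.
  + by move=> z _; rewrite lee_fin pge0.
- by move=> z _; rewrite mule_ge0 ?lee_fin ?pge0 ?M_ge0.
- by apply/measurable_EFinP; apply: measurable_funM => //; exact: mp_meas.
- by move=> z _; rewrite lee_fin g_ge0.
- exact/measurable_EFinP.
Qed.

End log_pot.
End mp_moments.

(** * Negativity of the logarithmic energy *)

Section frullani.
Context (R : realType).
Notation mu := (@lebesgue_measure R).

Definition tent (s d : R) : R := Num.max 0 (1 - s * d).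

(** Subtracting the value at distance [1] keeps the quotient bounded near [s = 0]; against a
    function of mean zero the subtracted term contributes nothing. *)
Definition log_kernel (s d : R) : R := if 0 < s then (tent s d - tent s 1) / s else 0.

Lemma measurable_tent d (T : measurableType d) (D : set T) (s x : T -> R) :
  measurable_fun D s -> measurable_fun D x -> measurable_fun D (fun z => tent (s z) (x z)).
Proof.
move=> ms mx; apply: measurable_maxr => //; apply: measurable_funB => //.
exact: measurable_funM.
Qed.

Lemma measurable_log_kernel d (T : measurableType d) (s x : T -> R) :
  measurable_fun setT s -> measurable_fun setT x ->
  measurable_fun setT (fun z => log_kernel (s z) (x z)).
Proof.
move=> ms mx; apply: measurable_fun_ifT => //; first exact: measurable_fun_ltr.
apply: measurable_funM; first by apply: measurable_funB; exact: measurable_tent.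
by apply: measurableT_comp; [exact: measurable_invr|].
Qed.

Lemma le_tent (s a b : R) : 0 <= s -> a <= b -> tent s b <= tent s a.
Proof.
move=> s0 ab; rewrite /tent ge_max le_max lexx/= le_max; apply/orP; right.
by rewrite lerD2l lerN2 ler_wpM2l.
Qed.

(** The integrand is [b - a] below [1 / b], then [1 / s - a] up to [1 / a], and [0] beyond. *)
Let tent_diff_integral (a b : R) : 0 < a -> a < b ->
  (\int[mu]_(s in `]0%R, +oo[) ((tent s a - tent s b) / s)%:E = (ln b - ln a)%:E)%E.
Proof.
move=> a0 ab; have b0 := lt_trans a0 ab.
have ba : b^-1 < a^-1 by rewrite ltf_pV2.
have bV : 0 < b^-1 by rewrite invr_gt0.
have aaV : a * a^-1 = 1 by rewrite mulfV ?gt_eqF.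
have bbV : b * b^-1 = 1 by rewrite mulfV ?gt_eqF.
have mg D : measurable_fun D (fun s : R => ((tent s a - tent s b) / s)%:E).
  apply/measurable_EFinP; apply: measurable_funM; last exact: measurable_invr.
  by apply: measurable_funB; exact: measurable_tent.
have tE (s c : R) : 0 < s -> 0 < c -> tent s c = if s < c^-1 then 1 - s * c else 0.
  move=> s0 c0; rewrite /tent; have ccV : c * c^-1 = 1 by rewrite mulfV ?gt_eqF.
  case: ltP => h.
    by rewrite max_r// subr_ge0 -ler_pdivlMr// div1r ltW.
  by rewrite max_l// subr_le0 -ler_pdivrMr// div1r.
rewrite (@itv_bndbnd_setU _ _ (BRight 0) (BRight b^-1) +oo%O); last 2 first.
- by rewrite bnd_simp ltW.
- by rewrite bnd_simp.
rewrite integral_setU//; last 2 first.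
- exact: mg.
- apply/disj_setPS => x [] /=; rewrite !in_itv/= => /andP[_ xp]; rewrite andbT => px.
  by have := lt_le_trans px xp; rewrite ltxx.
have -> : (\int[mu]_(s in `]0%R, b^-1%R]) ((tent s a - tent s b) / s)%:E =
    ((b - a) / b)%:E)%E.
  rewrite (@integral_itv_bndoo _ 0 b^-1 _ false false); last exact: mg.
  transitivity (\int[mu]_(s in `]0%R, b^-1%R[) (b - a)%:E)%E.
    apply: eq_integral => s; rewrite inE/= in_itv/= => /andP[s0 sb].
    by rewrite !tE// sb (lt_trans sb ba); congr EFin; field; rewrite gt_eqF.
  by rewrite integral_constant// [X in (_ * X)%E](lebesgue_measure_itv `]0, b^-1[)/= lte_fin bV sube0.
have -> : (\int[mu]_(s in `]b^-1%R, +oo[) ((tent s a - tent s b) / s)%:E =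
    \int[mu]_(s in `[b^-1%R, a^-1%R]) (s^-1 - a)%:E)%E.
  transitivity (\int[mu]_(s in `[b^-1%R, a^-1%R]) ((tent s a - tent s b) / s)%:E)%E.
    rewrite (@integral_itv_bndoo _ _ _ _ true false); last exact: mg.
    rewrite [LHS]integral_mkcond [RHS]integral_mkcond; apply: eq_integral => s _.
    rewrite !patchE !mem_setE !in_itv/= andbT; case: (ltP b^-1 s) => //= bs.
    case: ltP => // sa; have s0 := lt_trans bV bs.
    by rewrite !tE// !ltNge sa (ltW bs)/= subrr mul0r.
  apply: eq_integral => s; rewrite inE/= in_itv/= => /andP[bs sa].
  have s0 : 0 < s := lt_le_trans bV bs.
  rewrite !tE// [s < b^-1]ltNge bs/= subr0; move: sa; rewrite le_eqVlt.
  move=> /predU1P[->|->]; last by congr EFin; field; rewrite gt_eqF.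
  by rewrite ltxx mul0r invrK subrr.
have sp (s : R) : b^-1 <= s -> 0 < s := lt_le_trans bV.
have cf : {within `[b^-1, a^-1], continuous (fun s : R => s^-1 - a)}.
  apply: continuous_within => s /=; rewrite in_itv/= => /andP[/sp s0 _].
  by apply: cvgB; [apply: inv_continuous; rewrite gt_eqF|exact: cvg_cst].
have d (s : R) : 0 < s -> is_derive s 1 (fun s => ln s - a * s) (s^-1 - a).
  move=> s0; have d1 := is_derive1_ln s0.
  by apply: is_derive_eq; rewrite /GRing.scale/=; ring.
have cF : {within `[b^-1, a^-1], continuous (fun s : R => ln s - a * s)}.
  apply: continuous_within => s /=; rewrite in_itv/= => /andP[/sp s0 _].
  exact: continuous_is_derive (d _ s0).
have dF (s : R) : s \in `]b^-1, a^-1[ -> is_derive s 1 (fun s => ln s - a * s) (s^-1 - a).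
  by rewrite in_itv/= => /andP[/ltW/sp s0 _]; exact: d.
rewrite (FTC_is_derive (ltW ba) cf cF dF) -EFinD !lnV ?posrE//; congr EFin.
by rewrite aaV; field; rewrite gt_eqF.
Qed.

(** For fixed [d] the kernel has constant sign in [s], so its absolute integral is exactly [|ln d|].
    This turns integrability of the interaction into the Fubini condition. *)
Lemma integral_log_kernel (d : R) : 0 < d ->
  (\int[mu]_s (log_kernel s d)%:E = (- ln d)%:E)%E /\
  (\int[mu]_s `|log_kernel s d|%:E = `|ln d|%:E)%E.
Proof.
move=> d0.
have E (g : R -> R) : (\int[mu]_(s in `]0%R, +oo[) (g s)%:E =
    \int[mu]_s (if (0 < s)%R then g s else 0)%:E)%E.
  rewrite integral_mkcond; apply: eq_integral => s _.
  by rewrite patchE mem_setE in_itv/= andbT; case: ifPn.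
have [d1|d1|->] := ltgtP d 1.
- have h : (\int[mu]_s (log_kernel s d)%:E = (- ln d)%:E)%E.
    by rewrite -[- ln d]add0r -ln1 -(tent_diff_integral d0 d1) E.
  split => //; rewrite ler0_norm ?ln_le0 1?ltW// -h.
  apply: eq_integral => s _; rewrite ger0_norm// /log_kernel; case: ifPn => // s0.
  by rewrite divr_ge0 ?subr_ge0 ?le_tent// ltW.
- have h : (\int[mu]_s `|log_kernel s d|%:E = (ln d)%:E)%E.
    rewrite -[ln d]subr0 -[in (_ - _)%R]ln1 -(tent_diff_integral ltr01 d1) E.
    apply: eq_integral => s _; congr EFin; rewrite /log_kernel; case: ifPn => s0; last by rewrite normr0.
    by rewrite ler0_norm -?mulNr ?opprB// ler_pdivrMr// mul0r subr_le0 le_tent// ltW.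
  split; last by rewrite h ger0_norm// ln_ge0// ltW.
  rewrite EFinN -h -integral_ge0N => [|s _]; last by rewrite lee_fin.
  apply: eq_integral => s _; rewrite -EFinN; congr EFin.
  rewrite ler0_norm ?opprK// /log_kernel; case: ifPn => // s0.
  by rewrite ler_pdivrMr// mul0r subr_le0 le_tent// ltW.
- rewrite ln1 oppr0 normr0.
  by split; apply: integral0_eq => s _; rewrite /log_kernel subrr mul0r if_same ?normr0.
Qed.

End frullani.

(** * Product integrals, the diagonal and sliding windows *)

Section product.
Context (R : realType).
Notation mu := (@lebesgue_measure R).

Lemma integrable_prod (g h : R -> R) :
  mu.-integrable setT (EFin \o g) -> mu.-integrable setT (EFin \o h) ->
  (mu \x mu)%E.-integrable setT (fun z => (g z.1 * h z.2)%:E).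
Proof.
move=> Ig Ih.
have mg : measurable_fun setT g by apply/measurable_EFinP; exact: measurable_int Ig.
have mh : measurable_fun setT h by apply/measurable_EFinP; exact: measurable_int Ih.
apply/integrable12ltyP.
  apply/measurable_EFinP; apply: measurable_funM; exact: measurableT_comp.
have h0 : (0 <= \int[mu]_y `|h y|%:E)%E by apply: integral_ge0 => y _; rewrite lee_fin.
have -> : (\int[mu]_x \int[mu]_y `|(g (x, y).1 * h (x, y).2)%:E| =
    (\int[mu]_x `|g x|%:E) * (\int[mu]_y `|h y|%:E))%E.
  rewrite -ge0_integralZr//; try by [move=> x _; rewrite lee_fin
    |apply/measurable_EFinP; exact: measurableT_comp].
  apply: eq_integral => x _ /=; under eq_integral do rewrite normrM EFinM.
  rewrite ge0_integralZl//; try by [move=> y _; rewrite lee_fin|rewrite lee_fin].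
  by apply/measurable_EFinP; exact: measurableT_comp.
move: Ig Ih => /integrableP[_ Ig] /integrableP[_ Ih].
by rewrite lte_mul_pinfty// ?ge0_fin_numE//; apply: integral_ge0 => y _; rewrite lee_fin.
Qed.

Lemma integral_prod (g h : R -> R) :
  mu.-integrable setT (EFin \o g) -> mu.-integrable setT (EFin \o h) ->
  (\int[mu \x mu]_z (g z.1 * h z.2)%:E =
   (\int[mu]_x g x * \int[mu]_y h y)%:E)%E.
Proof.
move=> Ig Ih; rewrite -integral12_prod_meas1; last exact: integrable_prod.
rewrite /fubini_F/=.
have Eg : (\int[mu]_x (g x)%:E = (\int[mu]_x g x)%:E)%E.
  by rewrite /Rintegral fineK//; exact: integrable_fin_num.
have Eh : (\int[mu]_x (h x)%:E = (\int[mu]_x h x)%:E)%E.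
  by rewrite /Rintegral fineK//; exact: integrable_fin_num.
under eq_integral.
  move=> x _; under eq_integral do rewrite EFinM.
  rewrite integralZl// Eh; over.
by rewrite integralZr// Eg -EFinM.
Qed.

Lemma diagonal_negligible : (mu \x mu)%E.-negligible [set z : R * R | z.1 = z.2].
Proof.
have mD : measurable [set z : R * R | z.1 = z.2].
  rewrite [X in measurable X](_ : _ = (fun z : R * R => z.1 - z.2) @^-1` [set 0]).
    rewrite -[X in measurable X]setTI.
    by apply: (measurable_funB measurable_fst measurable_snd) => //.
  by apply/seteqP; split => z /=; [move=> ->; rewrite subrr|move/eqP; rewrite subr_eq0 => /eqP].
apply/negligibleP => //.
rewrite [LHS]integral0_eq// => x _ /=.
rewrite (_ : xsection _ _ = [set x]) ?lebesgue_measure_set1//.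
by apply/seteqP; split => y; rewrite /xsection/= inE/=.
Qed.

Definition window (w x u : R) : R := if (u <= x) && (x <= u + w) then 1 else 0.

Lemma measurable_window d (T : measurableType d) (w : R) (x u : T -> R) :
  measurable_fun setT x -> measurable_fun setT u ->
  measurable_fun setT (fun z => window w (x z) (u z)).
Proof.
move=> mx mu'; apply: measurable_fun_ifT => //.
apply: measurable_and; apply: measurable_fun_ler => //.
exact: measurable_funD.
Qed.

Lemma window_ge0 (w x u : R) : 0 <= window w x u.
Proof. by rewrite /window; case: ifPn. Qed.

Lemma window_le1 (w x u : R) : window w x u <= 1.
Proof. by rewrite /window; case: ifPn. Qed.

(** With [w = 1 / s], the product of windows is the indicator of [[max x y - w, min x y]], of length
    [w - |x - y|] when nonempty. *)
Lemma integral_window (s x y : R) : 0 < s ->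
  (\int[mu]_u (window s^-1 x u * window s^-1 y u)%:E = (s^-1 * tent s `|x - y|)%:E)%E.
Proof.
move=> s0; set w := s^-1; have w0 : 0 < w by rewrite invr_gt0.
pose a := Num.max x y - w; pose b := Num.min x y.
transitivity (\int[mu]_(u in `[a, b]) 1%E)%E.
  rewrite [RHS]integral_mkcond; apply: eq_integral => u _.
  rewrite patchE mem_setE in_itv/= /a /b /window lerBlDr ge_max le_min.
  by case: (u <= x); case: (u <= y); case: (x <= u + w); case: (y <= u + w); rewrite /= ?mulr1 ?mulr0.
rewrite integral_constant// mul1e [LHS](lebesgue_measure_itv `[a, b])/= lte_fin.
have sw : s * w = 1 by rewrite mulfV// gt_eqF.
have ab : b - a = w - `|x - y|.
  by rewrite /a /b; case: (leP x y) => xy; [rewrite ler0_norm ?subr_le0//|rewrite gtr0_norm ?subr_gt0//]; ring.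
have -> : w * tent s `|x - y| = Num.max 0 (b - a).
  rewrite /tent ab maxr_pMr ?ltW// mulr0; congr Num.max.
  by rewrite mulrBr mulr1 mulrA (mulrC w) sw mul1r.
rewrite -EFinB; case: ltP => h; congr EFin; first by rewrite max_r// subr_ge0 ltW.
by rewrite max_l// subr_le0.
Qed.

End product.

Section product_sigma_finite.
Context d1 d2 (T1 : measurableType d1) (T2 : measurableType d2) (R : realType)
  (m1 : {sigma_finite_measure set T1 -> \bar R}) (m2 : {sigma_finite_measure set T2 -> \bar R}).
Local Open Scope ereal_scope.

Let product_measure_sigma_finite : sigma_finite setT (m1 \x m2).
Proof.
have /sigma_finiteP[F [TF ndF Foo]] := sigma_finiteT m1.
have /sigma_finiteP[G [TG ndG Goo]] := sigma_finiteT m2.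
exists (fun n => F n `*` G n); last first.
  move=> n; have [mFn Fn] := Foo n; have [mGn Gn] := Goo n.
  split; first exact: measurableX.
  by rewrite product_measure1E// lte_mul_pinfty// ge0_fin_numE.
apply/esym; rewrite -subTset => -[x y] _.
have [n _ Fnx] : (\bigcup_n F n) x by rewrite -TF.
have [k _ Gky] : (\bigcup_n G n) y by rewrite -TG.
exists (maxn n k) => //; split => /=.
- by move/subsetPset: (ndF _ _ (leq_maxl n k)); exact.
- by move/subsetPset: (ndG _ _ (leq_maxr n k)); exact.
Qed.

(** Fubini is applied to the pair [(x, y)] against a third variable, the scale or the window
    position, so the plane must itself be a sigma-finite factor. *)
Definition product_sigma_finite : {sigma_finite_measure set (T1 * T2)%type -> \bar R} :=
  HB.pack_for {sigma_finite_measure set (T1 * T2)%type -> \bar R} (m1 \x m2)%E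
    (Measure_isSigmaFinite.Build _ _ _ (m1 \x m2) product_measure_sigma_finite).

End product_sigma_finite.

(** * The logarithmic energy as an integral of squared window masses *)

Section log_energy.
Context (R : realType).
Notation mu := (@lebesgue_measure R).
Let mu2 := product_sigma_finite mu mu.
Variable f : R -> R.
Hypothesis If : mu.-integrable setT (EFin \o f).
Hypothesis f_mean0 : \int[mu]_x f x = 0.
Hypothesis IL : (mu \x mu)%E.-integrable setT
  (fun z => (f z.1 * f z.2 * ln `|z.1 - z.2|)%:E).

Let mf : measurable_fun setT f.
Proof. by apply/measurable_EFinP; exact: measurable_int If. Qed.

Let mf1 : measurable_fun setT (fun z : R * R => f z.1).
Proof. exact: measurableT_comp. Qed.

Let mf2 : measurable_fun setT (fun z : R * R => f z.2).
Proof. exact: measurableT_comp. Qed.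

Let mdist : measurable_fun setT (fun z : R * R => `|z.1 - z.2|).
Proof.
apply: measurableT_comp; first exact: normr_measurable.
exact: (measurable_funB measurable_fst measurable_snd).
Qed.

Definition window_mass (s u : R) : R := \int[mu]_x (f x * window s^-1 x u).

Let Ifw s u : mu.-integrable setT (fun x => (f x * window s^-1 x u)%:E).
Proof.
apply: le_integrable If => //.
  by apply/measurable_EFinP; apply: measurable_funM => //; exact: measurable_window.
move=> x _; rewrite /= lee_fin normrM ler_piMr//.
by rewrite ger0_norm ?window_ge0// window_le1.
Qed.

Let Psi s (z : (R * R) * R) : \bar R :=
  (f z.1.1 * f z.1.2 * (window s^-1 z.1.1 z.2 * window s^-1 z.1.2 z.2))%:E.

Let m11 : measurable_fun setT (fun z : (R * R) * R => z.1.1).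
Proof. exact: measurableT_comp. Qed.
Let m12 : measurable_fun setT (fun z : (R * R) * R => z.1.2).
Proof. exact: measurableT_comp. Qed.

Let mPsi s : measurable_fun setT (Psi s).
Proof.
apply/measurable_EFinP; apply: measurable_funM.
  apply: measurable_funM; first exact: (measurableT_comp mf m11).
  exact: (measurableT_comp mf m12).
by apply: measurable_funM; exact: measurable_window.
Qed.

Let tent_ge0 (s d : R) : 0 <= tent s d. Proof. by rewrite /tent le_max lexx. Qed.

Let tent_le1 (s d : R) : 0 < s -> 0 <= d -> tent s d <= 1.
Proof. by move=> s0 d0; rewrite /tent ge_max ler01 gerBl mulr_ge0// ltW. Qed.

Let IL2 : mu2.-integrable setT (fun z => (f z.1 * f z.2 * ln `|z.1 - z.2|)%:E) := IL.
Let Ip2 : mu2.-integrable setT (fun z => (f z.1 * f z.2)%:E) := integrable_prod If If.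
Let Ep2 : (\int[mu2]_z (f z.1 * f z.2)%:E = (\int[mu]_x f x * \int[mu]_y f y)%:E)%E := integral_prod If If.

Let IPsi s : 0 < s -> (mu2 \x mu)%E.-integrable setT (Psi s).
Proof.
move=> s0; apply: (@integrable12ltyP _ _ _ _ R mu2 mu (Psi s) (mPsi s)).2.
have /integrableP := Ip2; move=> [_].
have sV : 0 <= s^-1 by rewrite invr_ge0 ltW.
have -> : (\int[mu2]_x \int[mu]_y `|Psi s (x, y)| =
    \int[mu2]_x (`|f x.1 * f x.2| * (s^-1 * tent s `|x.1 - x.2|))%:E)%E.
  apply: eq_integral => z _; rewrite /Psi/=.
  have ww u : 0 <= window s^-1 z.1 u * window s^-1 z.2 u by rewrite mulr_ge0// window_ge0.
  under eq_integral do rewrite normrM (ger0_norm (ww _)) EFinM.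
  rewrite ge0_integralZl//.
  - by rewrite integral_window.
  - by apply/measurable_EFinP; apply: measurable_funM; exact: measurable_window.
  - by move=> u _; rewrite lee_fin mulr_ge0// window_ge0.
move=> h; apply: (@le_lt_trans _ _ (\int[mu2]_x ((s^-1)%:E * `|(f x.1 * f x.2)%:E|))%E).
  apply: ge0_le_integral => //.
  - by move=> z _; rewrite lee_fin !mulr_ge0.
  - apply/measurable_EFinP; apply: measurable_funM.
      by apply: measurableT_comp => //; exact: measurable_funM.
    by apply: measurable_funM => //; exact: measurable_tent.
  - apply: emeasurable_funM => //; apply/measurable_EFinP.
    by apply: measurableT_comp => //; exact: measurable_funM.
  - move=> z _; rewrite -EFinM lee_fin mulrC ler_wpM2r//.
    by rewrite ler_piMr// tent_le1.
rewrite ge0_integralZl//.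
- by rewrite lte_mul_pinfty// ?lee_fin.
- apply/measurable_EFinP.
  by apply: measurableT_comp => //; exact: measurable_funM.
Qed.

(** The squared mass is a partial integral of [Psi s], so measurability comes with Fubini's
    theorem. *)
Let mass_measurable s : 0 < s -> measurable_fun setT (fun u => ((window_mass s u) ^+ 2)%:E).
Proof.
move=> s0; have := @measurable_fubini_G _ _ _ _ R mu2 mu _ (IPsi s0).
apply: eq_measurable_fun => u _; rewrite /fubini_G /Psi/=.
under eq_integral do rewrite mulrACA.
by rewrite (integral_prod (Ifw s u) (Ifw s u)) expr2.
Qed.

(** Integrating the product of windows over [u] gives the tent; integrating it over the pair of
    points gives the squared mass. *)
Let tent_energy s : 0 < s ->
  (\int[mu2]_z (f z.1 * f z.2 * tent s `|z.1 - z.2|)%:E =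
   s%:E * \int[mu]_u ((window_mass s u) ^+ 2)%:E)%E.
Proof.
move=> s0; have := @Fubini _ _ _ _ R mu2 mu _ (IPsi s0); rewrite /Psi/=.
have sn : s != 0 by rewrite gt_eqF.
have -> : (\int[mu2]_x \int[mu]_y
    (f x.1 * f x.2 * (window s^-1 x.1 y * window s^-1 x.2 y))%:E =
    \int[mu2]_x ((s^-1)%:E * (f x.1 * f x.2 * tent s `|x.1 - x.2|)%:E))%E.
  apply: eq_integral => z _.
  have Iw : mu.-integrable setT (fun u => (window s^-1 z.1 u * window s^-1 z.2 u)%:E).
    apply/integrableP; split.
      by apply/measurable_EFinP; apply: measurable_funM; exact: measurable_window.
    under eq_integral do rewrite /= ger0_norm ?mulr_ge0 ?window_ge0//.
    by rewrite integral_window// ltry.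
  under eq_integral do rewrite EFinM.
  by rewrite integralZl// integral_window// -!EFinM; congr EFin; ring.
have It : mu2.-integrable setT (fun z => (f z.1 * f z.2 * tent s `|z.1 - z.2|)%:E).
  apply: le_integrable Ip2 => //.
    apply/measurable_EFinP; apply: measurable_funM; first exact: measurable_funM.
    exact: measurable_tent.
  move=> z _; rewrite lee_fin normrM ler_piMr// ger0_norm//.
  by rewrite tent_le1.
rewrite integralZl// => h.
rewrite -[LHS]mul1e -(mulfV sn) EFinM -muleA; congr (_ * _)%E; rewrite h.
apply: eq_integral => u _.
under eq_integral do rewrite mulrACA.
by rewrite (integral_prod (Ifw s u) (Ifw s u)) expr2.
Qed.

(** On the diagonal the kernel behaves like [1 / s] at infinity and is not integrable. The value [0]
    there agrees with [ln 0 = 0] and alters only a null set. *)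
Let Phi (z : (R * R) * R) : \bar R :=
  (f z.1.1 * f z.1.2 * (if z.1.1 == z.1.2 then 0 else log_kernel z.2 `|z.1.1 - z.1.2|))%:E.

Let mPhi : measurable_fun setT Phi.
Proof.
apply/measurable_EFinP; apply: measurable_funM.
  apply: measurable_funM; first exact: (measurableT_comp mf m11).
  exact: (measurableT_comp mf m12).
apply: measurable_fun_ifT => //; first exact: measurable_fun_eqr.
apply: measurable_log_kernel => //; apply: measurableT_comp => //.
exact: measurable_funB.
Qed.

Let int_Phi z :
  (\int[mu]_s Phi (z, s) = (- (f z.1 * f z.2 * ln `|z.1 - z.2|))%:E)%E /\
  (\int[mu]_s `|Phi (z, s)| = `|f z.1 * f z.2 * ln `|z.1 - z.2| |%:E)%E.
Proof.
rewrite /Phi/=; have [z12|z12] := eqVneq z.1 z.2.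
  rewrite z12 subrr normr0 ln0// mulr0 oppr0 normr0.
  by split; apply: integral0_eq => s _; rewrite /= ?z12 ?eqxx; rewrite ?mulr0 ?normr0.
have d0 : 0 < `|z.1 - z.2| by rewrite normr_gt0 subr_eq0.
have [h1 h2] := integral_log_kernel d0.
have Ik : mu.-integrable setT (fun s => (log_kernel s `|z.1 - z.2|)%:E).
  apply/integrableP; split; first by apply/measurable_EFinP; exact: measurable_log_kernel.
  by rewrite h2 ltry.
split; first by under eq_integral do rewrite EFinM; rewrite integralZl// h1 -EFinM mulrN.
under eq_integral do rewrite normrM EFinM.
rewrite ge0_integralZl//; first by rewrite h2 -EFinM -normrM.
by apply/measurable_EFinP; apply: measurableT_comp => //; exact: measurable_log_kernel.
Qed.

Let IPhi : (mu2 \x mu)%E.-integrable setT Phi.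
Proof.
apply: (@integrable12ltyP _ _ _ _ R mu2 mu Phi mPhi).2; move/integrableP: IL2 => [_].
by under [X in (_ -> X < _)%E]eq_integral do rewrite (int_Phi _).2.
Qed.

Let G (s : R) : \bar R := (if (0 < s)%R then \int[mu]_u ((window_mass s u) ^+ 2)%:E else 0)%E.

Let G_ge0 s : (0 <= G s)%E.
Proof.
by rewrite /G; case: ifPn => // _; apply: integral_ge0 => u _; rewrite lee_fin sqr_ge0.
Qed.

Let int_Phi_G s : (\int[mu2]_z Phi (z, s) = G s)%E.
Proof.
rewrite /Phi /G /=; case: ifPn => s0; last first.
  by apply: integral0_eq => z _; rewrite /log_kernel (negbTE s0) if_same mulr0.
have It (d : R * R -> R) : (forall z, 0 <= d z) -> measurable_fun setT d ->
    mu2.-integrable setT (fun z => (f z.1 * f z.2 * tent s (d z))%:E).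
  move=> d0 md; apply: le_integrable Ip2 => //.
    apply/measurable_EFinP; apply: measurable_funM; first exact: measurable_funM.
    exact: measurable_tent.
  by move=> z _; rewrite lee_fin normrM ler_piMr// ger0_norm// tent_le1.
transitivity (\int[mu2]_z ((s^-1)%:E * ((f z.1 * f z.2 * tent s `|z.1 - z.2|)%:E -
    (f z.1 * f z.2 * tent s 1)%:E)))%E.
  apply: ae_eq_integral => //.
  - exact: (@measurable_fun_pair1 _ _ _ _ _ _ _ s mPhi).
  - apply: emeasurable_funM => //; apply: emeasurable_funB.
      by apply: measurable_int (It (fun z : R * R => `|z.1 - z.2|) _ _).
    by apply: measurable_int (It (fun _ : R * R => 1) _ _).
  have := @diagonal_negligible R; apply: negligibleS => z /= h.
  apply: contrapT => /eqP z12; apply: h => _.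
  rewrite (negbTE z12) /log_kernel s0 -EFinB -EFinM; congr EFin; field.
  by rewrite gt_eqF.
have I1 := It (fun z : R * R => `|z.1 - z.2|) (fun=> normr_ge0 _) mdist.
have I2 := It (fun _ : R * R => 1) (fun=> ler01) (@measurable_cst _ _ _ _ _ _).
rewrite integralZl//; last exact: integrableB.
rewrite integralB// tent_energy//.
(* The reference term disappears because [f] has mean zero. *)
have -> : (\int[mu2]_z (f z.1 * f z.2 * tent s 1)%:E = 0)%E.
  under eq_integral do rewrite EFinM.
  by rewrite integralZr// Ep2 f_mean0 mul0r mul0e.
by rewrite sube0 muleA -EFinM mulVf ?mul1e// gt_eqF.
Qed.

Let log_energyE :
  (\int[mu2]_z (f z.1 * f z.2 * ln `|z.1 - z.2|)%:E = - \int[mu]_s G s)%E.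
Proof.
have := @Fubini _ _ _ _ R mu2 mu _ IPhi.
under eq_integral do rewrite (int_Phi _).1.
under [X in _ = X]eq_integral do rewrite int_Phi_G.
move=> <-.
transitivity (- - \int[mu2]_z (f z.1 * f z.2 * ln `|z.1 - z.2|)%:E)%E; first by rewrite oppeK.
rewrite -(integralN (integrable_add_def measurableT IL2)); congr (- _)%E.
Qed.

Lemma log_energy_le0 :
  (\int[mu \x mu]_z (f z.1 * f z.2 * ln `|z.1 - z.2|)%:E <= 0)%E.
Proof. by rewrite log_energyE oppe_le0 integral_ge0. Qed.

Lemma log_energy_eq0 :
  (\int[mu \x mu]_z (f z.1 * f z.2 * ln `|z.1 - z.2|)%:E = 0)%E ->
  {ae mu, forall x, f x = 0}.
Proof.
rewrite log_energyE => /eqP; rewrite oppe_eq0 => /eqP G0.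
have mG : measurable_fun setT G.
  apply: eq_measurable_fun (@measurable_fubini_G _ _ _ _ R mu2 mu _ IPhi) => s _.
  by rewrite /fubini_G int_Phi_G.
have aeG : ae_eq mu setT G (cst 0)%E.
  apply/ae_eq_integral_abs => //; rewrite -[RHS]G0; apply: eq_integral => s _.
  by rewrite gee0_abs.
(* [G] vanishes only almost everywhere, but every interval of length one contains a good scale.
   Countably many scales suffice, so the exceptional sets of positions [u] have a null union. *)
have /choice[sn hsn] : forall n : nat, exists s : R, n.+1%:R < s < n.+2%:R /\ G s = 0%E.
  move=> n; apply: contrapT => hn.
  have : mu.-negligible `]n.+1%:R, n.+2%:R[%classic.
    apply: negligibleS aeG => s /=; rewrite in_itv/= => sI h.
    by apply: hn; exists s; split => //; exact: h.
  move=> /(negligibleP mu (measurable_itv `]n.+1%:R, n.+2%:R[)).1.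
  rewrite [LHS](lebesgue_measure_itv `]n.+1%:R, n.+2%:R[)/= lte_fin ltr_nat ltnSn.
  rewrite -EFinB => -[]/eqP; rewrite subr_eq0 eqr_nat => /eqP/eq_add_S/esym.
  by apply: n_Sn.
have sn0 n : 0 < sn n by have [/andP[h _] _] := hsn n; apply: le_lt_trans h.
have snV n : 0 < (sn n)^-1 by rewrite invr_gt0.
have aew n : {ae mu, forall u, window_mass (sn n) u = 0}.
  have [_] := hsn n; rewrite /G sn0 => h.
  have : ae_eq mu setT (fun u => ((window_mass (sn n) u) ^+ 2)%:E) (cst 0)%E.
    apply/ae_eq_integral_abs => //; first exact: mass_measurable.
    by rewrite -[RHS]h; apply: eq_integral => u _; rewrite gee0_abs// lee_fin sqr_ge0.
  apply: negligibleS => u /= hu h0; apply: hu.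
  by case: (h0 I) => /eqP; rewrite sqrf_eq0 => /eqP.
have := ae_foralln aew => aew'.
have locf : locally_integrable setT f by apply: open_integrable_locally => //; exact: openT.
have aeL := lebesgue_differentiation locf.
pose E (x : R) (n : nat) : set R := `[x, x + (sn n)^-1]%classic.
have muE x n : (lebesgue_measure (E x n) = ((sn n)^-1)%:E)%E.
  by rewrite lebesgue_measure_itv/= lte_fin ltrDl snV -EFinB addrAC subrr add0r.
have hE x : nicely_shrinking x (E x).
  split; first by move=> n; exact: measurable_itv.
  have r0 n : 0 < 2 * (sn n)^-1 by rewrite mulr_gt0.
  (* The radius is twice the length [1 / sn n] because balls are open and the intervals closed; the
     ball then has four times the measure of the interval. *)
  exists (4, fun n => PosNum (r0 n)); split => //=.
  - apply: (squeeze_cvgr (f := cst 0) (h := fun n => 2 * harmonic n)).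
    + apply: nearW => n; rewrite /= (ltW (r0 n))/= ler_pM2l// /harmonic lef_pV2 ?posrE//.
      by have [/andP[/ltW]] := hsn n.
    + exact: cvg_cst.
    + by rewrite -[X in _ --> X](mulr0 2); apply: cvgM; [exact: cvg_cst|exact: cvg_harmonic].
  - move=> n y; rewrite /E/= in_itv/= => /andP[xy yx]; rewrite /ball/=.
    by rewrite ler0_norm ?subr_le0// opprB; have := snV n; lra.
  - move=> n; rewrite muE lebesgue_measure_ball; last exact: ltW.
    by rewrite -EFinM lee_fin; lra.
have := negligibleU aew' aeL; apply: negligibleS => x /= nx.
apply/not_andP => -[hx Lx]; apply: nx; have := nice_lebesgue_differentiation hE locf Lx.
rewrite (_ : (fun n => _) = cst 0%E).
  move=> /(cvg_lim (@ereal_hausdorff R)); rewrite lim_cst; last exact: ereal_hausdorff.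
  by move=> -[].
apply/funext => n.
have -> : (\int[mu]_(y in E x n) (f y)%:E = (window_mass (sn n) x)%:E)%E; last by rewrite hx mule0.
rewrite /window_mass /Rintegral fineK; last exact: integrable_fin_num.
rewrite [LHS]integral_mkcond; apply: eq_integral => y _.
by rewrite patchE /E mem_setE in_itv/= /window; case: ifPn => _; rewrite ?mulr1 ?mulr0.
Qed.

End log_energy.

(** * The variational inequality *)

Section log_potential.
Context (R : realType).
Notation mu := (@lebesgue_measure R).

(** Sign and support are imposed pointwise and integrals run over the whole line, so neither null
    sets nor a domain have to be carried along; densities are first replaced by such
    representatives. *)
Definition halfline_density (q : R -> R) : Prop :=
  [/\ forall x, 0 <= q x, forall x, x < 0 -> q x = 0,
      mu.-integrable setT (EFin \o q), mu.-integrable setT (fun x => (x * q x)%:E)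
    & \int[mu]_x q x = 1].

Definition log_potential (p : R -> R) (x : R) : R := \int[mu]_z (p z * ln `|x - z|).

Lemma measurable_ln_dist : measurable_fun setT (fun z : R * R => ln `|z.1 - z.2|).
Proof.
by apply: measurable_ln_norm; exact: (measurable_funB measurable_fst measurable_snd).
Qed.

Lemma measurable_log_interaction (q p : R -> R) :
  measurable_fun setT q -> measurable_fun setT p ->
  measurable_fun setT (fun z : R * R => q z.1 * p z.2 * ln `|z.1 - z.2|).
Proof.
move=> mq mp; apply: measurable_funM; last exact: measurable_ln_dist.
by apply: measurable_funM; exact: measurableT_comp.
Qed.

Lemma measurable_log_potential p : measurable_fun setT p ->
  measurable_fun setT (log_potential p).
Proof.
move=> mp; apply: measurableT_comp; first exact: fine_measurable.
have mg : measurable_fun setT (fun z : R * R => (p z.2 * ln `|z.1 - z.2|)%:E).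
  apply/measurable_EFinP; apply: measurable_funM; last exact: measurable_ln_dist.
  exact: measurableT_comp.
pose g := fun z : R * R => (p z.2 * ln `|z.1 - z.2|)%:E.
have h1 := @measurable_fun_fubini_tonelli_F _ _ _ _ R mu _ (measurable_funepos mg) (fun=> funepos_ge0 _ _).
have h2 := @measurable_fun_fubini_tonelli_F _ _ _ _ R mu _ (measurable_funeneg mg) (fun=> funeneg_ge0 _ _).
apply: eq_measurable_fun (emeasurable_funB h1 h2) => x _ /=.
rewrite /fubini_F [RHS]integralE.
by congr (_ - _)%E; apply: eq_integral => y _; rewrite ?(funeposE, funenegE).
Qed.

Lemma Rintegral_ae_ge0 (g : R -> R) : mu.-integrable setT (EFin \o g) ->
  {ae mu, forall x, 0 <= g x} -> 0 <= \int[mu]_x g x.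
Proof.
move=> Ig g0; have mg : measurable_fun setT g by apply/measurable_EFinP; exact: measurable_int Ig.
have -> : \int[mu]_x g x = \int[mu]_x `|g x|; last exact: Rintegral_ge0.
congr fine; apply: ae_eq_integral => //.
- exact/measurable_EFinP.
- by apply/measurable_EFinP; exact: measurableT_comp.
by apply: negligibleS g0 => x /= h n; apply: h => _; rewrite ger0_norm.
Qed.

Lemma Rintegral_ae_eq0 (g : R -> R) : measurable_fun setT g ->
  {ae mu, forall x, g x = 0} -> \int[mu]_x g x = 0.
Proof.
move=> mg g0; have -> : \int[mu]_x g x = \int[mu]_(x in setT) (0 : R); last by rewrite /Rintegral integral0.
congr fine; apply: ae_eq_integral => //; first exact/measurable_EFinP.
by apply: negligibleS g0 => x /= h n; apply: h => _; rewrite n.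
Qed.

End log_potential.

(** * Finite and infinite energies *)

Section coulomb_energy.
Context (R : realType).
Notation mu := (@lebesgue_measure R).

Definition coulomb_energy (q : R -> R) : \bar R :=
  (\int[mu]_x (x * q x)%:E - \int[mu \x mu]_z (q z.1 * q z.2 * ln `|z.1 - z.2|)%:E)%E.

Lemma coulomb_energy_fin (q : R -> R) : mu.-integrable setT (fun x => (x * q x)%:E) ->
  (mu \x mu)%E.-integrable setT (fun z => (q z.1 * q z.2 * ln `|z.1 - z.2|)%:E) ->
  coulomb_energy q = (\int[mu]_x (x * q x) -
    \int[(mu \x mu)%E]_z (q z.1 * q z.2 * ln `|z.1 - z.2|))%:E.
Proof.
move=> I1 I2; rewrite /coulomb_energy EFinB /Rintegral fineK; last exact: integrable_fin_num.
by rewrite fineK//; exact: integrable_fin_num.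
Qed.

Let ln_dist_le (x y : R) : 0 <= x -> 0 <= y -> ln `|x - y| <= x + y.
Proof.
move=> x0 y0; apply: (@le_trans _ _ `|x - y|); last first.
  by rewrite (le_trans (ler_normB _ _))// !ger0_norm.
have := normr_ge0 (x - y); rewrite le_eqVlt => /predU1P[<-|/ln_sublinear/ltW//].
by rewrite ln0.
Qed.

(** On the half line [ln |x - y| <= x + y], so the positive part of the interaction has finite
    integral and only the negative part can diverge. *)
Lemma coulomb_energy_pinfty (q : R -> R) : halfline_density q ->
  ~ (mu \x mu)%E.-integrable setT (fun z => (q z.1 * q z.2 * ln `|z.1 - z.2|)%:E) ->
  coulomb_energy q = +oo%E.
Proof.
move=> [q0 qH Iq Ixq _] nI.
have mq : measurable_fun setT q by apply/measurable_EFinP; exact: measurable_int Iq.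
pose g (z : R * R) : \bar R := (q z.1 * q z.2 * ln `|z.1 - z.2|)%:E.
have mg : measurable_fun setT g by apply/measurable_EFinP; exact: measurable_log_interaction.
have Ib := integrableD measurableT (integrable_prod Ixq Iq) (integrable_prod Iq Ixq).
have pos : (\int[mu \x mu]_z g^\+ z < +oo)%E.
  move/integrableP : Ib => [mb]; apply: le_lt_trans; apply: ge0_le_integral => //.
  - exact: measurable_funepos.
  - exact: measurableT_comp.
  move=> z _ /=; apply: (@le_trans _ _ (z.1 * q z.1 * q z.2 + q z.1 * (z.2 * q z.2))%:E);
    last by rewrite lee_fin ler_norm.
  rewrite /g funeposE ge_max !lee_fin.
  have [z1|z1] := ltP z.1 0; first by rewrite (qH _ z1) !(mulr0, mul0r) addr0 lexx.
  have [z2|z2] := ltP z.2 0; first by rewrite (qH _ z2) !(mulr0, mul0r) addr0 lexx.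
  rewrite (_ : z.1 * q z.1 * q z.2 + _ = q z.1 * q z.2 * (z.1 + z.2)); last by ring.
  by rewrite ler_wpM2l ?mulr_ge0 ?addr_ge0//= ln_dist_le.
have neg : (\int[mu \x mu]_z g^\- z = +oo)%E.
  apply: contrapT => /eqP; rewrite -ltey => neg; apply: nI; apply/integrableP; split => //.
  rewrite [X in (X < _)%E](_ : _ = \int[mu \x mu]_z (g^\+ z + g^\- z))%E; last first.
    by apply: eq_integral => z _; exact: (congr1 (fun f => f z) (fune_abse g)).
  rewrite ge0_integralD//; [|exact: measurable_funepos|exact: measurable_funeneg].
  by rewrite lte_add_pinfty.
rewrite /coulomb_energy [X in (_ - X)%E]integralE neg.
have /fineK <- : (\int[mu \x mu]_z g^\+ z)%E \is a fin_num.
  by rewrite ge0_fin_numE//; exact: integral_ge0.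
have /fineK <- : (\int[mu]_x (x * q x)%:E)%E \is a fin_num by exact: integrable_fin_num.
by [].
Qed.

End coulomb_energy.

(** The quadratic expansion about the candidate: [l], [w], [w'] are the interactions of [q] with
    [q], of [q] with [p] and of [p] with [p], [m] and [m'] are first moments, and [j] is the
    interaction of [q - p] with itself. *)
Lemma energy_gap (R : realType) (j m w m' w' l b : R) : j = l - w - (w - w') -> j <= 0 ->
  b <= m - 2 * w -> m' - 2 * w' = b ->
  (m' + b) / 2 <= m - l /\ (m - l = (m' + b) / 2 -> j = 0).
Proof. by move=> *; split => *; lra. Qed.

(** * Minimality from the Euler-Lagrange condition, for a general constraint function [h] with
    multiplier [lam] *)

Section variational.
Context (R : realType).
Notation mu := (@lebesgue_measure R).
Local Notation W := log_potential.

Variables (p h : R -> R) (A c lam r : R).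
Hypothesis dp : halfline_density p.
Hypothesis pot_bound : {ae mu, forall x : R, 0 <= x ->
  mu.-integrable setT (fun z => (p z * ln `|x - z|)%:E) /\
  (\int[mu]_z (p z * `|ln `|x - z| |)%:E <= (A * (x + 1))%:E)%E}.
Hypothesis euler_lagrange : {ae mu, forall x : R, 0 <= x ->
  c + lam * h x <= x - 2 * W p x /\ (0 < p x -> x - 2 * W p x = c + lam * h x)}.
Hypothesis Ihp : mu.-integrable setT (fun x => (h x * p x)%:E).
Hypothesis hp : \int[mu]_x (h x * p x) = r.

Let p_ge0 x : 0 <= p x. Proof. by have [] := dp. Qed.

Let Ip : mu.-integrable setT (EFin \o p). Proof. by have [] := dp. Qed.

Let mp : measurable_fun setT p.
Proof. by apply/measurable_EFinP; exact: measurable_int Ip. Qed.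

Let mW : measurable_fun setT (W p). Proof. exact: measurable_log_potential. Qed.

Section competitor.
Variable q : R -> R.
Hypothesis dq : halfline_density q.
Hypothesis Ihq : mu.-integrable setT (fun x => (h x * q x)%:E).
Hypothesis hq : \int[mu]_x (h x * q x) = r.

Let q_ge0 x : 0 <= q x. Proof. by have [] := dq. Qed.

Let Iq : mu.-integrable setT (EFin \o q). Proof. by have [] := dq. Qed.

Let Ixq : mu.-integrable setT (fun x => (x * q x)%:E). Proof. by have [] := dq. Qed.

Let mq : measurable_fun setT q.
Proof. by apply/measurable_EFinP; exact: measurable_int Iq. Qed.

Let inner_bound :
  (\int[mu]_x \int[mu]_z `|(q x * p z * ln `|x - z|)%:E| < +oo)%E.
Proof.
have mi : measurable_fun setT (fun z : R * R => `|(q z.1 * p z.2 * ln `|z.1 - z.2|)%:E|%E).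
  apply: measurableT_comp => //; apply/measurable_EFinP.
  exact: measurable_log_interaction.
have Ib : mu.-integrable setT (fun x => (A * (x * q x + q x))%:E).
  under eq_fun do rewrite EFinM EFinD.
  by apply: integrableZl => //; apply: integrableD.
move/integrableP : (Ib) => [mb].
apply: le_lt_trans; apply: ae_ge0_le_integral => //.
- by move=> x _; exact: integral_ge0.
- exact: (@measurable_fun_fubini_tonelli_F _ _ _ _ R mu _ mi).
- by apply: measurableT_comp.
have := pot_bound; apply: negligibleS => x /= nx n; apply: nx => _.
have [x0|x0] := ltP x 0.
  have [_ -> // _ _ _] := dq.
  by rewrite integral0_eq// => z _; rewrite !mul0r normr0.
have [I b] := n x0.
under eq_integral.
  move=> z _; rewrite /= -mulrA normrM normrM (ger0_norm (p_ge0 _)) (ger0_norm (q_ge0 _)) EFinM.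
  over.
rewrite ge0_integralZl//; last 3 first.
- apply/measurable_EFinP; apply: measurable_funM => //; apply: measurableT_comp => //.
  by apply: measurable_ln_norm; exact: measurable_funB.
- by move=> z _; rewrite lee_fin mulr_ge0.
- by rewrite lee_fin.
apply: (@le_trans _ _ (A * (x * q x + q x))%:E); last by rewrite lee_fin ler_norm.
rewrite (_ : (A * (x * q x + q x))%R = (q x * (A * (x + 1)))%R); last by ring.
by rewrite EFinM lee_wpmul2l// lee_fin.
Qed.

(** The linear growth of the absolute potential of [p] is paid for by the first moment of [q]; no
    interaction of [q] with itself is involved. *)
Lemma integrable_cross :
  (mu \x mu)%E.-integrable setT (fun z => (q z.1 * p z.2 * ln `|z.1 - z.2|)%:E).
Proof.
apply/integrable12ltyP => //; apply/measurable_EFinP.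
exact: measurable_log_interaction.
Qed.

Lemma integrable_cross_sym :
  (mu \x mu)%E.-integrable setT (fun z => (p z.1 * q z.2 * ln `|z.1 - z.2|)%:E).
Proof.
apply/integrable21ltyP; first by apply/measurable_EFinP; exact: measurable_log_interaction.
apply: le_lt_trans inner_bound; rewrite le_eqVlt; apply/orP; left; apply/eqP.
apply: eq_integral => x _; apply: eq_integral => z _ /=.
by rewrite distrC (mulrC (p z)).
Qed.

Let crossE : ae_eq mu setT
  (fun x => \int[mu]_z (q x * p z * ln `|x - z|)%:E)%E (fun x => (q x * W p x)%:E).
Proof.
have := pot_bound; apply: negligibleS => x /= nx n; apply: nx => _.
have [x0|x0] := ltP x 0.
  have [_ -> // _ _ _] := dq.
  by rewrite mul0r integral0_eq// => z _; rewrite !mul0r.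
have [I _] := n x0.
under eq_integral do rewrite -mulrA EFinM.
by rewrite integralZl// EFinM /log_potential /Rintegral fineK//; exact: integrable_fin_num.
Qed.

Let mqW : measurable_fun setT (fun x => (q x * W p x)%:E).
Proof. by apply/measurable_EFinP; exact: measurable_funM. Qed.

Lemma integrable_mul_potential : mu.-integrable setT (fun x => (q x * W p x)%:E).
Proof.
apply/integrableP; split => //.
have /integrableP[mF] := integrable_fubini_F integrable_cross.
apply: le_lt_trans; rewrite le_eqVlt; apply/orP; left; apply/eqP.
apply: ae_eq_integral => //; [exact: measurableT_comp|exact: measurableT_comp|].
exact: ae_eq_abse (ae_eq_sym crossE).
Qed.

Lemma Rintegral_cross :
  \int[(mu \x mu)%E]_z (q z.1 * p z.2 * ln `|z.1 - z.2|) = \int[mu]_x (q x * W p x).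
Proof.
congr fine; rewrite -integral12_prod_meas1; last exact: integrable_cross.
apply: ae_eq_integral => //; exact: measurable_fubini_F integrable_cross.
Qed.

Lemma Rintegral_cross_sym :
  \int[(mu \x mu)%E]_z (p z.1 * q z.2 * ln `|z.1 - z.2|) = \int[mu]_x (q x * W p x).
Proof.
rewrite -Rintegral_cross; congr fine.
rewrite -(integral21_prod_meas1 integrable_cross_sym).
rewrite -(integral12_prod_meas1 integrable_cross).
apply: eq_integral => x _; apply: eq_integral => z _ /=.
by rewrite distrC (mulrC (p z)).
Qed.

(** The defect in the Euler-Lagrange inequality weighted by [q]. Its integral sees [q] only through
    the mass, the constraint value, the first moment and the interaction with [p]. *)
Let slack x := q x * (x - 2 * W p x - c - lam * h x).

Let Islack : mu.-integrable setT (EFin \o slack) /\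
  \int[mu]_x slack x = \int[mu]_x (x * q x) - 2 * \int[mu]_x (q x * W p x) - c - lam * r.
Proof.
have IW := integrable_mul_potential.
have q1 : \int[mu]_x q x = 1 by have [] := dq.
have I2 : mu.-integrable setT (EFin \o (fun x => 2 * (q x * W p x))).
  by rewrite /comp; under eq_fun do rewrite EFinM; exact: integrableZl.
have I3 : mu.-integrable setT (EFin \o (fun x => c * q x)).
  by rewrite /comp; under eq_fun do rewrite EFinM; exact: integrableZl.
have I4 : mu.-integrable setT (EFin \o (fun x => lam * (h x * q x))).
  by rewrite /comp; under eq_fun do rewrite EFinM; exact: integrableZl.
have I12 : mu.-integrable setT (EFin \o (fun x => x * q x - 2 * (q x * W p x))).
  by rewrite /comp; under eq_fun do rewrite EFinB; exact: integrableB.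
have I123 : mu.-integrable setT (EFin \o (fun x => x * q x - 2 * (q x * W p x) - c * q x)).
  by rewrite /comp; under eq_fun do rewrite EFinB; exact: integrableB.
have I : mu.-integrable setT
    (EFin \o (fun x => x * q x - 2 * (q x * W p x) - c * q x - lam * (h x * q x))).
  by rewrite /comp; under eq_fun do rewrite EFinB; exact: integrableB.
have E : slack = (fun x => x * q x - 2 * (q x * W p x) - c * q x - lam * (h x * q x)).
  by apply/funext => x; rewrite /slack; ring.
rewrite E; split=> //.
rewrite RintegralB// RintegralB// RintegralB// RintegralZl// RintegralZl// RintegralZl//.
by rewrite q1 hq mulr1.
Qed.

Lemma slack_ge0 :
  c + lam * r <= \int[mu]_x (x * q x) - 2 * \int[mu]_x (q x * W p x).
Proof.
rewrite -subr_ge0 opprD addrA -Islack.2; apply: Rintegral_ae_ge0; first exact: Islack.1.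
have := euler_lagrange; apply: negligibleS => x /= nx n; apply: nx.
have [x0|x0] := ltP x 0; first by have [_ h0 _ _ _] := dq; rewrite /slack h0// mul0r.
by rewrite mulr_ge0// -addrA -opprD subr_ge0; have [] := n x0.
Qed.

Lemma slack_eq0 : {ae mu, forall x, 0 < q x -> 0 < p x} ->
  \int[mu]_x (x * q x) - 2 * \int[mu]_x (q x * W p x) = c + lam * r.
Proof.
move=> qp; apply/eqP; rewrite -subr_eq0 opprD addrA -Islack.2; apply/eqP.
apply: Rintegral_ae_eq0; first by apply/measurable_EFinP; exact: measurable_int Islack.1.
have := negligibleU euler_lagrange qp; apply: negligibleS => x /= nx.
apply/not_andP => -[n m]; apply: nx.
have [x0|x0] := ltP x 0; first by have [_ h0 _ _ _] := dq; rewrite /slack h0// mul0r.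
have := q_ge0 x; rewrite le_eqVlt => /predU1P[q0|q0]; first by rewrite /slack -q0 mul0r.
have [_ /(_ (m q0)) e] := n x0.
by apply/eqP; rewrite mulf_eq0 e; apply/orP; right; apply/eqP; ring.
Qed.

End competitor.

Local Notation inter q1 q2 := (\int[(mu \x mu)%E]_z (q1 z.1 * q2 z.2 * ln `|z.1 - z.2|)).

(** The Euler-Lagrange equality integrated against [p] gives the self-interaction as half of first
    moment minus [c + lam * r]. *)
Lemma coulomb_energy_minimizer :
  coulomb_energy p = ((\int[mu]_x (x * p x) + c + lam * r) / 2)%:E.
Proof.
have Ixp : mu.-integrable setT (fun x => (x * p x)%:E) by have [] := dp.
rewrite (coulomb_energy_fin Ixp (integrable_cross dp)) (Rintegral_cross dp); congr EFin.
have := slack_eq0 dp Ihp hp (aeW _ (fun x => id)).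
have real_eq (m w b : R) : m - 2 * w = b -> m - w = (m + b) / 2 by move=> ?; lra.
by move=> /real_eq; rewrite addrA.
Qed.

Lemma coulomb_energy_min (q : R -> R) : halfline_density q ->
  mu.-integrable setT (fun x => (h x * q x)%:E) -> \int[mu]_x (h x * q x) = r ->
  (coulomb_energy p <= coulomb_energy q)%E /\
  (coulomb_energy q = coulomb_energy p -> {ae mu, forall x, q x = p x}).
Proof.
move=> dq Ihq hq.
have [Iqq|/(coulomb_energy_pinfty dq) ->] :=
    pselect ((mu \x mu)%E.-integrable setT (fun z => (q z.1 * q z.2 * ln `|z.1 - z.2|)%:E)); last first.
  by rewrite leey coulomb_energy_minimizer.
pose f x := q x - p x.
have Iq : mu.-integrable setT (EFin \o q) by have [] := dq.
have If : mu.-integrable setT (EFin \o f).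
  by rewrite /comp /f; under eq_fun do rewrite EFinB; exact: integrableB.
have f0 : \int[mu]_x f x = 0.
  by rewrite RintegralB//; have [_ _ _ _ ->] := dq; have [_ _ _ _ ->] := dp; rewrite subrr.
have Iqp := integrable_cross dq; have Ipq := integrable_cross_sym dq.
have Ipp := integrable_cross dp.
have I1 : (mu \x mu)%E.-integrable setT (EFin \o (fun z : R * R =>
    q z.1 * q z.2 * ln `|z.1 - z.2| - q z.1 * p z.2 * ln `|z.1 - z.2|)).
  by rewrite /comp; under eq_fun do rewrite EFinB; exact: integrableB.
have I2 : (mu \x mu)%E.-integrable setT (EFin \o (fun z : R * R =>
    p z.1 * q z.2 * ln `|z.1 - z.2| - p z.1 * p z.2 * ln `|z.1 - z.2|)).
  by rewrite /comp; under eq_fun do rewrite EFinB; exact: integrableB.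
have E : (fun z : R * R => f z.1 * f z.2 * ln `|z.1 - z.2|) = (fun z : R * R =>
    (q z.1 * q z.2 * ln `|z.1 - z.2| - q z.1 * p z.2 * ln `|z.1 - z.2|) -
    (p z.1 * q z.2 * ln `|z.1 - z.2| - p z.1 * p z.2 * ln `|z.1 - z.2|)).
  by apply/funext => z; rewrite /f; ring.
have IL : (mu \x mu)%E.-integrable setT (EFin \o (fun z : R * R => f z.1 * f z.2 * ln `|z.1 - z.2|)).
  by rewrite E /comp; under eq_fun do rewrite EFinB; exact: integrableB.
have J : inter f f = inter q q - \int[mu]_x (q x * W p x)
    - (\int[mu]_x (q x * W p x) - \int[mu]_x (p x * W p x)).
  rewrite E RintegralB// RintegralB// RintegralB//.
  by rewrite Rintegral_cross// Rintegral_cross_sym// Rintegral_cross.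
have J' : (inter f f)%:E = (\int[mu \x mu]_z (f z.1 * f z.2 * ln `|z.1 - z.2|)%:E)%E.
  by rewrite /Rintegral fineK//; exact: integrable_fin_num.
have J0 : inter f f <= 0 by rewrite -lee_fin J'; exact: log_energy_le0.
have Ixq : mu.-integrable setT (fun x => (x * q x)%:E) by have [] := dq.
rewrite (coulomb_energy_fin Ixq Iqq) coulomb_energy_minimizer lee_fin.
have sq := slack_ge0 dq Ihq hq.
have sp := slack_eq0 dp Ihp hp (aeW _ (fun x => id)).
rewrite -addrA; have [le_e eq_e] := energy_gap J J0 sq sp.
split => // -[]/eq_e Jz.
have := log_energy_eq0 If f0 IL; rewrite -J' Jz => /(_ erefl).
by apply: negligibleS => x /= nx n; apply: nx; move/eqP: n; rewrite subr_eq0 => /eqP.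
Qed.

End variational.

(** * The Marchenko-Pastur density solves the Euler-Lagrange condition *)

Section mp_variational.
Context (R : realType).
Notation mu := (@lebesgue_measure R).
Variables (k delta : R).
Hypothesis k0 : 0 <= k.
Hypothesis d0 : 0 <= delta.
Hypothesis dk : delta + 2 * Num.sqrt delta <= k.
Let p (z : R) := mp_density k (z + delta).

Let mp_meas D : measurable_fun D p.
Proof. by apply: measurable_mp_density; exact: measurable_funD. Qed.

(** The hypothesis [dk] says that the lower edge [(sqrt (k + 1) - 1)^2] is at least [delta]. For
    [0 < y < delta] it gives [k - y >= 2 sqrt y]. *)
Lemma mp_density_edge y : y < delta -> mp_density k y = 0.
Proof.
move=> yd; have dk' := dk; apply: mp_density_eq0.
have [y0|y0] := leP y 0; first by have := sqr_ge0 (y - k); lra.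
have sy := sqr_sqrtr (ltW y0); have s0 := sqrtr_ge0 y.
have sd : Num.sqrt y <= Num.sqrt delta by rewrite ler_wsqrtr// ltW.
have -> : 4 * y = (2 * Num.sqrt y) ^+ 2 by rewrite exprMn sy; ring.
rewrite -(sqrrN (y - k)) opprB ler_pXn2r// ?nnegrE; lra.
Qed.

Lemma mp_halfline_density : halfline_density p /\ \int[mu]_x (x * p x) = 1 + k - delta.
Proof.
have Ip : mu.-integrable setT (EFin \o p) := mp_integrable delta k0.
have I1 : mu.-integrable setT (EFin \o (fun x => `|x + delta| * p x)).
  apply/integrableP; split.
    apply/measurable_EFinP; apply: measurable_funM; last exact: mp_meas.
    by apply: measurableT_comp => //; exact: measurable_funD.
  have xp0 x : 0 <= `|x + delta| * p x by rewrite mulr_ge0 ?mp_density_ge0.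
  under eq_integral do rewrite /= (ger0_norm (xp0 _)).
  by rewrite mp_first_moment// ltry.
have I2 : mu.-integrable setT (EFin \o (fun x => delta * p x)).
  by rewrite /comp; under eq_fun do rewrite EFinM; exact: integrableZl.
have E : (fun x => x * p x) = (fun x => `|x + delta| * p x - delta * p x).
  apply/funext => x; have := mp_density_ge0 k (x + delta); rewrite le_eqVlt.
  move=> /predU1P[|/(mp_supp k0)/andP[h _]]; first by rewrite /p => <-; rewrite !mulr0 subrr.
  by rewrite gtr0_norm//; ring.
have p1 : \int[mu]_x p x = 1 by rewrite /Rintegral mp_mass.
split.
  split => //.
  - by move=> x; exact: mp_density_ge0.
  - by move=> x x0; rewrite /p mp_density_edge// gtrDr.
  - rewrite (_ : (fun x => _) = EFin \o (fun x => x * p x))// E /comp.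
    by under eq_fun do rewrite EFinB; exact: integrableB.
rewrite E RintegralB// RintegralZl// p1 mulr1.
by rewrite [X in X - _](_ : _ = 1 + k)// /Rintegral mp_first_moment.
Qed.

(** Two points are discarded: [x + delta = k], where the sign [s] would be zero, and
    [x + delta = 0], where the closed form does not apply. *)
Lemma mp_potential : {ae mu, forall x : R, 0 <= x ->
  [/\ mu.-integrable setT (fun z => (p z * ln `|x - z|)%:E),
   (\int[mu]_z (p z * `|ln `|x - z| |)%:E <= ((12 + 4 * k + 2 * delta) * (x + 1))%:E)%E,
   mp_ell k - delta + k * ln (x + delta) <= x - 2 * log_potential p x &
   0 < p x -> x - 2 * log_potential p x = mp_ell k - delta + k * ln (x + delta)]}.
Proof.
have neg1 (a : R) : mu.-negligible [set a].
  by apply/negligibleP => //; exact: lebesgue_measure_set1.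
have := negligibleU (neg1 (k - delta)) (neg1 (- delta)); apply: negligibleS => x /= nx.
apply: contrapT => /not_orP[/eqP xk /eqP xd]; apply: nx => x0.
have y0 : 0 < x + delta.
  rewrite lt_neqAle addr_ge0// andbT eq_sym; apply: contra_neq xd => /eqP.
  by rewrite addr_eq0 => /eqP.
have yk : x + delta - k != 0.
  by apply: contra_neq xk => /eqP; rewrite subr_eq0 => /eqP <-; rewrite addrK.
have sg : 0 < Num.sg (x + delta - k) * (x + delta - k).
  by rewrite -normrEsg normr_gt0.
have sg2 : Num.sg (x + delta - k) ^+ 2 = 1 by rewrite sqr_sg yk.
have [w [wM wle weq]] := mixture_potE k0 y0 sg2 sg.
have [I Iw Ib] := mp_log_pot k0 (ltW y0) wM.
have -> : log_potential p x = w by rewrite /log_potential /Rintegral Iw.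
have k0' := k0; have d0' := d0; split => //.
- apply: (le_trans Ib); rewrite lee_fin.
  suff : 0 <= (10 + 4 * k + 2 * delta) * x by move: x0; lra.
  by rewrite mulr_ge0//; lra.
- by move: wle; lra.
- move=> px; have h : (x + delta - k) ^+ 2 <= 4 * (x + delta).
    by rewrite leNgt; apply/negP => /ltW h; move: px; rewrite /p mp_density_eq0// ltxx.
  by move: (weq h); lra.
Qed.

(** On the support [ln (x + delta)] is [ln |(- delta) - x|], so the moment is the potential at the
    point [- delta], that is at [y = 0]. *)
Lemma mp_log_moment : 0 < k ->
  mu.-integrable setT (fun x => (ln (x + delta) * p x)%:E) /\
  \int[mu]_x (ln (x + delta) * p x) = (k + 1) * ln (k + 1) - k * ln k - 1.
Proof.
move=> kp; have y0 : 0 <= - delta + delta by rewrite addNr.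
have [|I Iw _] := mp_log_pot (W := (k + 1) * ln (k + 1) - k * ln k - 1) k0 y0.
  by move=> M; rewrite addNr mixture_pot0.
have E : (fun x => (ln (x + delta) * p x)%:E) = (fun z => (p z * ln `|- delta - z|)%:E).
  apply/funext => x; have := mp_density_ge0 k (x + delta); rewrite le_eqVlt.
  move=> /predU1P[|/(mp_supp k0)/andP[hp _]]; first by rewrite /p => <-; rewrite mulr0 mul0r.
  by rewrite -opprD normrN addrC gtr0_norm 1?mulrC//; rewrite addrC.
by rewrite E; split => //; rewrite /Rintegral E Iw.
Qed.

End mp_variational.

(** * Tameness of the Marchenko-Pastur density *)

Section mp_tame.
Context (R : realType).
Notation mu := (@lebesgue_measure R).

Lemma mp_density_le (k y : R) : 0 < y -> mp_density k y <= (Num.sqrt y)^-1.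
Proof.
move=> y0; have [s s0 ->] : exists2 s, 0 < s & y = s ^+ 2.
  by exists (Num.sqrt y); rewrite ?sqrtr_gt0// sqr_sqrtr// ltW.
rewrite sqrtr_sqr (gtr0_norm s0).
have pi1 : 1 <= pi :> R by apply: le_trans (pi_ge2 R); rewrite ler1n.
have pn : pi != 0 :> R by rewrite gt_eqF// pi_gt0.
rewrite /mp_density ler_pdivrMr ?mulr_gt0 ?pi_gt0 ?exprn_gt0//.
rewrite (_ : s^-1 * _ = pi * (2 * s)); last first.
  by move: pi1 pn; move: (pi) => P P1 Pn; field; rewrite gt_eqF.
apply: (@le_trans _ _ (2 * s)); last by rewrite ler_peMl// mulr_ge0// ltW.
have -> : 2 * s = Num.sqrt ((2 * s) ^+ 2) by rewrite sqrtr_sqr ger0_norm// mulr_ge0// ltW.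
apply: ler_wsqrtr; rewrite exprMn.
by have := sqr_ge0 (s ^+ 2 - k); lra.
Qed.

(** This is [y^(-3/4)], the majorant of the density to the power [3/2]. For [k = 0] the density is
    unbounded, of order [y^(-1/2)] at the origin. *)
Let g (y : R) : \bar R := ((Num.sqrt y)^-1 * (Num.sqrt (Num.sqrt y))^-1)%:E.

Let mg : measurable_fun setT g.
Proof.
apply/measurable_EFinP; apply: measurable_funM; apply: measurableT_comp => //;
  try exact: measurable_invr; try exact: measurable_sqrtr.
by apply: measurableT_comp; exact: measurable_sqrtr.
Qed.

Let g0 y : (0 <= g y)%E.
Proof. by rewrite lee_fin mulr_ge0// invr_ge0 sqrtr_ge0. Qed.

Lemma integral_pow_quarter (c : R) : 0 < c ->
  (\int[mu]_(y in `]0%R, (c ^+ 4)%R[) g y = (4 * c)%:E)%E.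
Proof.
move=> c0.
have d (x : R) : is_derive x 1 (fun x : R => x ^+ 4) (4 * x ^+ 3).
  by apply: is_derive_eq; rewrite /GRing.scale/=; ring.
have cpsi : continuous (fun x : R => 4 * x ^+ 3).
  by move=> x; apply: cvgM; [exact: cvg_cst|exact: exprn_continuous].
have psi_gt0 (x : R) : 0 < x < c -> 0 < 4 * x ^+ 3.
  by move=> /andP[x0 _]; rewrite mulr_gt0// exprn_gt0.
have := ge0_integral_subst_increasing c0 d cpsi psi_gt0 mg g0.
rewrite expr0n/= => <-.
transitivity (\int[mu]_(x in `]0%R, c[) 4%:E)%E.
  apply: eq_integral => x; rewrite inE/= in_itv/= => /andP[x0 _].
  rewrite /g (_ : x ^+ 4 = (x ^+ 2) ^+ 2); last by rewrite -exprM.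
  rewrite sqrtr_sqr ger0_norm ?sqr_ge0// sqrtr_sqr ger0_norm ?ltW// -EFinM; congr EFin.
  by field; rewrite gt_eqF.
by rewrite integral_constant// [X in (_ * X)%E](lebesgue_measure_itv `]0, c[)/= lte_fin c0 sube0.
Qed.

Lemma mp_tame (k delta : R) : 0 <= k -> 0 <= delta -> delta + 2 * Num.sqrt delta <= k ->
  tame (fun x => mp_density k (x + delta)).
Proof.
move=> k0 d0 dk; set p := fun x => _.
have [[p0 pH Ip Ixp _] _] := mp_halfline_density k0 dk; rewrite -/p in p0 pH Ip Ixp.
have mp : measurable_fun setT p by apply/measurable_EFinP; exact: measurable_int Ip.
have mH : measurable (halfline R : set (measurableTypeR R)) by exact: measurable_itv.
split.
- exact: integrableS Ip.
- have /integrableP[_] := integrableS measurableT mH (@subsetT _ _) Ixp.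
  apply: le_lt_trans; rewrite le_eqVlt; apply/orP; left; apply/eqP.
  apply: eq_integral => x; rewrite inE /halfline/= in_itv/= andbT => x0.
  by rewrite /= (normrM x) (ger0_norm x0).
exists (1 / 2); first by lra.
pose C : R := 4 + 2 * k.
have C1 : 1 < C by rewrite /C; lra.
have CC : C < C ^+ 4 by rewrite exprS ltr_pMr ?exprn_egt1//; lra.
have pE x : `|p x| `^ (1 + 1 / 2) = p x * Num.sqrt (p x).
  rewrite ger0_norm; last exact: p0.
  rewrite powRD; last by apply/implyP => /eqP; lra.
  by rewrite powRr1 ?div1r ?powR12_sqrt; try exact: p0.
(* A fourth power is chosen as end point to suit the substitution [y = v^4]; since [C > 1] it lies
   beyond the support bound [C]. *)
apply: (@le_lt_trans _ _ (\int[mu]_(x in `](- delta)%R, (C ^+ 4 - delta)%R[) g (delta + x))%E).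
  rewrite integral_mkcond [leRHS]integral_mkcond; apply: ge0_le_integral => //.
  - by move=> x _; rewrite patchE; case: ifPn => // _; rewrite lee_fin powR_ge0.
  - apply/(measurable_restrictT _ mH) => //.
    under eq_fun do rewrite pE.
    apply: measurable_funTS; apply/measurable_EFinP; apply: measurable_funM => //.
    by apply: measurableT_comp => //; exact: measurable_sqrtr.
  - apply/(measurable_restrictT _ (measurable_itv _)).
    apply: measurable_funTS; apply: (measurableT_comp mg).
    exact: measurable_funD.
  move=> x _; rewrite !patchE !mem_setE; case: ifPn => _; last by case: ifPn.
  rewrite pE; have : 0 <= p x := p0 x; rewrite le_eqVlt => /predU1P[<-|px].
    by rewrite mul0r; case: ifPn.
  have /andP[y0 yC] := mp_supp k0 px.
  rewrite in_itv/= ltrBrDr (le_lt_trans yC CC) -subr_gt0 opprK y0/=.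
  have sl := mp_density_le k y0.
  rewrite /g [(delta + x)%R]addrC lee_fin.
  apply: ler_pM; [exact: p0|exact: sqrtr_ge0|exact: sl|].
  by rewrite -sqrtrV ?sqrtr_ge0//; exact: ler_wsqrtr sl.
rewrite integral_translate ?ltrD2r//; last by rewrite -subr_gt0; lra.
rewrite addrN addrCA subrr addr0 integral_pow_quarter ?ltry//; lra.
Qed.

End mp_tame.

(** * Passage from almost-everywhere densities to pointwise representatives *)

Section halfline_part.
Context (R : realType).
Notation mu := (@lebesgue_measure R).

(* A representative of [q] which is nonnegative everywhere and vanishes off the half line. *)
Definition halfline_part (q : R -> R) (x : R) : R := if 0 <= x then Num.max 0 (q x) else 0.

Let mH : measurable (halfline R : set (measurableTypeR R)).
Proof. exact: measurable_itv. Qed.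

Let restrictE (f : R -> R) (x : R) :
  ((EFin \o f) \_ (halfline R)) x = (if 0 <= x then f x else 0)%:E.
Proof. by rewrite patchE mem_setE in_itv/= andbT; case: ifPn. Qed.

Variable q : R -> R.
Hypothesis dq : density q.

Let Q (x : R) : R := if 0 <= x then q x else 0.

Let tq : tame q. Proof. by have [] := dq. Qed.

Let IQ : mu.-integrable setT (EFin \o Q).
Proof.
have [Iq _ _] := tq; have /(integrable_mkcond _ mH) := Iq.
by apply: eq_integrable => // x _; rewrite restrictE.
Qed.

Let mQ : measurable_fun setT Q.
Proof. by apply/measurable_EFinP; exact: measurable_int IQ. Qed.

Let partE x : halfline_part q x = Num.max 0 (Q x).
Proof. by rewrite /halfline_part /Q; case: ifPn => // _; rewrite maxxx. Qed.

Let mpart : measurable_fun setT (halfline_part q).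
Proof. by rewrite (funext partE); exact: measurable_maxr. Qed.

Lemma ae_halfline_part : {ae mu, forall x : R, Q x = halfline_part q x}.
Proof.
have [_ q0 _] := dq; apply: negligibleS q0 => x /= nx n; apply: nx.
rewrite /Q /halfline_part; case: ifPn => // x0.
by rewrite max_r// n// /halfline/= in_itv/= x0.
Qed.

Lemma integral_halfline_part (w : R -> R) : measurable_fun setT w ->
  (\int[mu]_(x in halfline R) (w x * q x)%:E = \int[mu]_x (w x * halfline_part q x)%:E)%E.
Proof.
move=> mw; rewrite integral_mkcond.
transitivity (\int[mu]_x (w x * Q x)%:E)%E.
  apply: eq_integral => x _; rewrite (restrictE (fun x => w x * q x)) /Q.
  by case: ifPn => // _; rewrite mulr0.
apply: ae_eq_integral => //.
- by apply/measurable_EFinP; exact: measurable_funM.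
- by apply/measurable_EFinP; exact: measurable_funM.
by apply: negligibleS ae_halfline_part => x /= nx n; apply: nx => _; rewrite n.
Qed.

Lemma halfline_density_part : halfline_density (halfline_part q).
Proof.
have part0 x : 0 <= halfline_part q x by rewrite partE le_max lexx.
have [_ xq _] := tq; have [_ _ q1] := dq; split => //.
- by move=> x x0; rewrite /halfline_part leNgt x0.
- apply: le_integrable IQ => //; first exact/measurable_EFinP.
  by move=> x _; rewrite /= lee_fin ger0_norm// partE ge_max normr_ge0 ler_norm.
- apply/integrableP; split; first by apply/measurable_EFinP; exact: measurable_funM.
  apply: le_lt_trans xq; rewrite [leRHS]integral_mkcond; apply: ge0_le_integral => //.
  + by apply/measurable_EFinP; apply: measurableT_comp => //; exact: measurable_funM.
  + suff : measurable_fun setT (fun x : R => (x * `|Q x|)%:E).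
      apply: eq_measurable_fun => x _; rewrite (restrictE (fun x => x * `|q x|)) /Q.
      by case: ifPn => // _; rewrite normr0 mulr0.
    apply/measurable_EFinP; apply: measurable_funM => //; exact: measurableT_comp.
  + move=> x _; rewrite (restrictE (fun x => x * `|q x|)) lee_fin /halfline_part.
    case: ifPn => x0; last by rewrite mulr0 normr0.
    rewrite normrM (ger0_norm x0) ler_wpM2l// ger0_norm ?le_max ?lexx//.
    by rewrite ge_max normr_ge0 ler_norm.
have := @integral_halfline_part (fun=> 1) (@measurable_cst _ _ _ _ _ _).
under eq_integral do rewrite mul1r.
under [X in _ = X]eq_integral do rewrite mul1r.
by rewrite q1 /Rintegral => <-.
Qed.

Let interactionE : (\int[mu \x mu]_(z in halfline R `*` halfline R)
      (q z.1 * q z.2 * ln `|z.1 - z.2|)%:E =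
   \int[mu \x mu]_z (halfline_part q z.1 * halfline_part q z.2 * ln `|z.1 - z.2|)%:E)%E.
Proof.
rewrite integral_mkcond.
transitivity (\int[mu \x mu]_z (Q z.1 * Q z.2 * ln `|z.1 - z.2|)%:E)%E.
  apply: eq_integral => z _; rewrite patchE /Q.
  case: ifPn; first by rewrite inE => -[]; rewrite /halfline/= !in_itv/= !andbT => -> ->.
  move=> nz; congr EFin; case: ifPn => z1; last by rewrite !mul0r.
  case: ifPn => z2; last by rewrite mulr0 mul0r.
  by case/negP: nz; rewrite inE; split; rewrite /halfline/= in_itv/= andbT.
apply: ae_eq_integral => //.
- by apply/measurable_EFinP; exact: measurable_log_interaction.
- by apply/measurable_EFinP; exact: measurable_log_interaction.
(* A null set [N] on the line spoils the product only on [N * R] and [R * N], both null in the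
   plane. *)
have [N [mN N0 NP]] := ae_halfline_part.
have NT : (mu \x mu)%E.-negligible (N `*` setT).
  apply/negligibleP; first exact: measurableX.
  by rewrite [LHS]product_measure1E// [X in (X * _)%E]N0 mul0e.
have TN : (mu \x mu)%E.-negligible (setT `*` N).
  apply/negligibleP; first exact: measurableX.
  by rewrite [LHS]product_measure1E// [X in (_ * X)%E]N0 mule0.
have := negligibleU NT TN; apply: negligibleS => z /= nz.
apply: contrapT => /not_orP[z1 z2]; apply: nz => _.
have E x : ~ N x -> Q x = halfline_part q x by move=> Nx; apply: contrapT => /NP.
by rewrite !E//; [move=> ?; apply: z2|move=> ?; apply: z1].
Qed.

Lemma energy_halfline_part : energy 1 q = coulomb_energy (halfline_part q).
Proof.
rewrite /energy subrr mul0e sube0 interactionE /coulomb_energy.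
by rewrite (integral_halfline_part (@measurable_id _ _ _)).
Qed.

Lemma ae_eq_halfline_part (p : R -> R) : {ae mu, forall x, halfline_part q x = p x} ->
  q = p %[ae mu in halfline R].
Proof.
move=> h; have := negligibleU h ae_halfline_part; apply: negligibleS => x /= nx.
apply/not_andP => -[h1 h2]; apply: nx; rewrite /halfline/= in_itv/= andbT => x0.
by rewrite -h1 -h2 /Q x0.
Qed.

End halfline_part.

(** * The parameter of the constrained problem *)

Section critical_parameter.
Context (R : realType).

Definition mp_log_mean (k : R) : R := (k + 1) * ln (k + 1) - k * ln k - 1.

Let is_derive_log_mean (k : R) : 0 < k ->
  is_derive k 1 mp_log_mean (ln (k + 1) - ln k).
Proof.
move=> k0; have k1 : 0 < k + 1 by rewrite addr_gt0.
have d0 := is_derive1_ln k0.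
have d1 : is_derive k 1 (fun k : R => ln (k + 1)) (k + 1)^-1.
  have d : is_derive k 1 (fun k : R => k + 1) 1 by apply: is_derive_eq; rewrite addr0.
  by have := is_derive_ln_comp d k1; rewrite div1r.
by apply: is_derive_eq; rewrite /GRing.scale/=; field; rewrite !gt_eqF.
Qed.

(** The derivative is [ln ((k + 1) / k)], positive for [k > 0]. *)
Lemma lt_mp_log_mean (k l : R) : 0 < k -> k < l -> mp_log_mean k < mp_log_mean l.
Proof.
move=> k0 kl; rewrite -subr_gt0.
have d (x : R) : x \in `]k, l[ -> is_derive x 1 mp_log_mean (ln (x + 1) - ln x).
  by rewrite in_itv/= => /andP[kx _]; apply: is_derive_log_mean; exact: lt_trans kx.
have cf : {within `[k, l], continuous mp_log_mean}.
  apply: continuous_within => x; rewrite /= in_itv/= => /andP[kx _].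
  exact: continuous_is_derive (is_derive_log_mean (lt_le_trans k0 kx)).
have [x] := MVT kl d cf; rewrite in_itv/= => /andP[kx _] ->.
have x0 := lt_trans k0 kx.
by rewrite mulr_gt0 ?subr_gt0// ltr_ln ?posrE ?addr_gt0// ltrDl.
Qed.

Let log_mean_ge (k : R) : 0 < k -> ln (k + 1) - 1 <= mp_log_mean k.
Proof.
move=> k0; have h : ln k <= ln (k + 1) by rewrite ler_ln ?posrE ?addr_gt0// lerDl.
have : 0 <= k * (ln (k + 1) - ln k) by rewrite mulr_ge0 ?subr_ge0// ltW.
by rewrite /mp_log_mean; lra.
Qed.

Lemma mp_log_mean_surj (k w : R) : 0 < k -> mp_log_mean k < w ->
  exists2 l, k < l & mp_log_mean l = w.
Proof.
(* The function is at least [ln (k + 1) - 1], so it exceeds [w] at this [K]. *)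
move=> k0 kw; pose K := k + expR (w + 1).
have e0 := expR_gt0 (w + 1).
have kK : k < K by rewrite ltrDl.
have wK : w <= mp_log_mean K.
  apply: le_trans (log_mean_ge (lt_trans k0 kK)); rewrite lerBrDr -[leLHS]expRK.
  by rewrite ler_ln ?posrE// /K; lra.
have cf : {within `[k, K], continuous mp_log_mean}.
  apply: continuous_within => x; rewrite /= in_itv/= => /andP[kx _].
  exact: continuous_is_derive (is_derive_log_mean (lt_le_trans k0 kx)).
have [|l] := IVT (v := w) (ltW kK) cf.
  by rewrite ge_min le_max (ltW kw) wK orbT.
rewrite in_itv/= => /andP[kl _] lw; exists l => //.
rewrite lt_neqAle kl andbT; apply/eqP => e; move: kw.
by rewrite e lw ltxx.
Qed.

(** The critical value is the one at which the lower edge of the support touches the origin. With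
    [rho = s^2] the parameter plus one is the square [(1 + s)^2 / s^2]. *)
Lemma r_critE (rho : R) : 0 < rho ->
  r_crit rho - ln rho = mp_log_mean (rho^-1 + 2 * Num.sqrt rho^-1).
Proof.
move=> rho0; have [s s0 ->] : exists2 s, 0 < s & rho = s ^+ 2.
  by exists (Num.sqrt rho); rewrite ?sqrtr_gt0// sqr_sqrtr// ltW.
have s20 : 0 < s ^+ 2 by rewrite exprn_gt0.
have s1 : 0 < 1 + s by rewrite addr_gt0.
have s2 : 0 < 1 + 2 * s by rewrite addr_gt0// mulr_gt0.
have [sn s1n s2n] : [/\ s != 0, 1 + s != 0 & 1 + 2 * s != 0] by rewrite !gt_eqF.
have lnsq (x : R) : 0 < x -> ln (x ^+ 2) = 2 * ln x.
  by move=> x0; rewrite lnXn// mulr_natl.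
rewrite sqrtrV ?ltW// /r_crit /mp_log_mean sqrtr_sqr (gtr0_norm s0).
rewrite (_ : 1 + s ^+ 2 / (1 + 2 * s) = (1 + s) ^+ 2 / (1 + 2 * s)); last by field.
rewrite (_ : (s ^+ 2)^-1 + 2 * s^-1 + 1 = (1 + s) ^+ 2 / s ^+ 2); last by field.
rewrite (_ : (s ^+ 2)^-1 + 2 * s^-1 = (1 + 2 * s) / s ^+ 2); last by field.
rewrite !ln_div ?posrE ?exprn_gt0// !lnsq//.
by field.
Qed.

Lemma mp_log_mean_critical (rho r : R) : 0 < rho -> r_crit rho < r ->
  exists! k, 0 < k /\ r - ln rho = mp_log_mean k.
Proof.
move=> rho0 rc; have kc0 : 0 < rho^-1 + 2 * Num.sqrt rho^-1.
  by rewrite addr_gt0 ?invr_gt0// mulr_gt0// sqrtr_gt0 invr_gt0.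
have [|k kk ke] := mp_log_mean_surj (w := r - ln rho) kc0.
  by rewrite -r_critE// ltrD2r.
have k0 := lt_trans kc0 kk.
exists k; split => // l [l0]; rewrite -ke => kl.
by have [/(lt_mp_log_mean k0)|/(lt_mp_log_mean l0)|//] := ltgtP k l; rewrite kl ltxx.
Qed.

Lemma gt_critical (rho r k : R) : 0 < rho -> r_crit rho < r -> 0 < k ->
  r - ln rho = mp_log_mean k -> rho^-1 + 2 * Num.sqrt rho^-1 <= k.
Proof.
move=> rho0 rc k0 ke; rewrite leNgt; apply/negP => /(lt_mp_log_mean k0).
by rewrite -ke -r_critE// ltrD2r => /(lt_trans rc); rewrite ltxx.
Qed.

(** With [y = x + 1 / rho], the product [(b - x) (x - a)] is [4 y - (y - k)^2], and it is
    nonpositive off [[a, b]], where the square root is [0]. *)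
Lemma opt_densityE (rho k : R) : 0 < rho -> 0 <= k ->
  opt_density rho k = (fun x => mp_density k (x + rho^-1)).
Proof.
move=> rho0 k0; apply/funext => x; rewrite /opt_density.
set S := Num.sqrt (k + 1); set y := x + rho^-1.
have S0 : 0 <= S by rewrite sqrtr_ge0.
have S2 : S ^+ 2 = k + 1 by rewrite sqr_sqrtr// addr_ge0.
have kS : k = S ^+ 2 - 1 by rewrite S2 addrK.
have xE : x = y - rho^-1 by rewrite /y addrK.
have E : (edge_b rho k - x) * (x - edge_a rho k) = 4 * y - (y - k) ^+ 2.
  by rewrite /edge_a /edge_b -/S kS xE; ring.
have ab : edge_a rho k <= edge_b rho k by rewrite /edge_a /edge_b -/S; move: S0; nra.
case: ifPn => [_|].
  have rn : rho != 0 by rewrite gt_eqF.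
  rewrite E /mp_density (_ : 1 + rho * x = rho * y); last by rewrite xE; field.
  by rewrite !invfM; move: (pi^-1) (y^-1) (Num.sqrt _) => P Y T; field; rewrite rn.
rewrite negb_and -!ltNge => h; rewrite mp_density_eq0// -subr_le0 -E.
case/orP: h => h.
- by apply: mulr_ge0_le0; rewrite ?subr_ge0 ?subr_le0 ?(ltW h)//; exact: le_trans (ltW h) ab.
- by apply: mulr_le0_ge0; rewrite ?subr_ge0 ?subr_le0 ?(ltW h)//; exact: le_trans ab (ltW h).
Qed.

End critical_parameter.

(** * The unconstrained and the constrained minimum *)

Section minimizers.
Context (R : realType).
Notation mu := (@lebesgue_measure R).

Let mH : measurable (halfline R : set (measurableTypeR R)).
Proof. exact: measurable_itv. Qed.

Lemma halfline_part_id (p : R -> R) : halfline_density p -> halfline_part p = p.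
Proof.
move=> [p0 pH _ _ _]; apply/funext => x; rewrite /halfline_part.
by case: leP => [_|/pH ->//]; rewrite max_r.
Qed.

Lemma halfline_densityW (p : R -> R) : halfline_density p -> tame p -> density p.
Proof.
move=> dp tp; have [p0 pH Ip _ p1] := dp; split => //; first exact: aeW.
rewrite -[RHS](congr1 EFin p1) /Rintegral fineK; last exact: integrable_fin_num.
rewrite [LHS]integral_mkcond; apply: eq_integral => x _.
by rewrite patchE mem_setE in_itv/= andbT; case: leP => // /pH ->.
Qed.

Section zero_parameter.

Let p (x : R) : R := mp_density 0 (x + 0).

Let edge0 : 0 + 2 * Num.sqrt 0 <= 0 :> R. Proof. by rewrite sqrtr0 mulr0 addr0. Qed.

Let dp : halfline_density p. Proof. by have [] := mp_halfline_density (lexx 0) edge0. Qed.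

(** The variational inequality with zero constraint function and zero multiplier: the first moment
    is [1] and the Euler-Lagrange constant is [2], so the value is half their sum. *)
Lemma energy0E : energy0 1 = ((3 / 2 : R)%:E : \bar R).
Proof.
have pot : {ae mu, forall x : R, 0 <= x ->
    mu.-integrable setT (fun z => (p z * ln `|x - z|)%:E) /\
    (\int[mu]_z (p z * `|ln `|x - z| |)%:E <= ((12 + 4 * 0 + 2 * 0) * (x + 1))%:E)%E}.
  apply: negligibleS (mp_potential (lexx 0) (lexx 0)) => x /= nx n; apply: nx => x0.
  by have [] := n x0.
have EL : {ae mu, forall x : R, 0 <= x ->
    2 + 0 * 0 <= x - 2 * log_potential p x /\
    (0 < p x -> x - 2 * log_potential p x = 2 + 0 * 0)}.
  apply: negligibleS (mp_potential (lexx 0) (lexx 0)) => x /= nx n; apply: nx => x0.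
  have e : mp_ell 0 - 0 + 0 * ln (x + 0) = 2 + 0 * 0 by rewrite /mp_ell add0r ln1; ring.
  by have [_ _] := n x0; rewrite e.
have I0 (q : R -> R) : mu.-integrable setT (fun x => (0 * q x)%:E).
  by under eq_fun do rewrite mul0r; exact: integrable0.
have i0 (q : R -> R) : \int[mu]_x (0 * q x) = 0.
  by rewrite /Rintegral integral0_eq// => x _; rewrite mul0r.
have pE : coulomb_energy p = (3 / 2)%:E.
  rewrite (coulomb_energy_minimizer dp pot EL (I0 p) (i0 p)).
  have [_ ->] := mp_halfline_density (lexx 0) edge0.
  by congr EFin; lra.
have dens : density p.
  by apply: halfline_densityW dp _; exact: (mp_tame (lexx 0) (lexx 0) edge0).
apply/eqP; rewrite eq_le; apply/andP; split.
  apply: ereal_inf_lbound; exists p => //.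
  by rewrite (energy_halfline_part dens) halfline_part_id.
apply: le_ereal_inf_tmp => _ [q dq <-]; rewrite (energy_halfline_part dq) -pE.
by have [] := coulomb_energy_min dp pot EL (I0 p) (i0 p) (halfline_density_part dq) (I0 _) (i0 _).
Qed.

End zero_parameter.

(** The constraint is shifted by [ln rho] since [1 + rho * x = rho * (x + rho^-1)]; integrability
    comes from [ln (1 + rho * x) <= rho * x] and the first moment. *)
Lemma log_moment_halfline_part (rho r : R) (q : R -> R) : 0 < rho -> density_at rho r q ->
  mu.-integrable setT (fun x => (ln (x + rho^-1) * halfline_part q x)%:E) /\
  \int[mu]_x (ln (x + rho^-1) * halfline_part q x) = r - ln rho.
Proof.
move=> rho0 [dq qr]; have [q0 qH Iq Ixq q1] := halfline_density_part dq.
have mq : measurable_fun setT (halfline_part q) by apply/measurable_EFinP; exact: measurable_int Iq.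
have mw : measurable_fun setT (fun x : R => ln (1 + rho * x)).
  apply: measurableT_comp; first exact: measurable_ln.
  by apply: measurable_funD => //; exact: measurable_funM.
have Iw : mu.-integrable setT (EFin \o (fun x => ln (1 + rho * x) * halfline_part q x)).
  have : mu.-integrable setT (fun x => (rho%:E * (x * halfline_part q x)%:E)%E).
    exact: integrableZl.
  apply: le_integrable => //; first by apply/measurable_EFinP; exact: measurable_funM.
  move=> x _; rewrite /= lee_fin.
  have [x0|x0] := ltP x 0; first by rewrite qH// !mulr0.
  rewrite mulrA !normrM ler_wpM2r// -normrM.
  have rx : 0 <= rho * x by rewrite mulr_ge0// ltW.
  rewrite !ger0_norm//; first by apply: le_ln1Dx; apply: lt_le_trans rx; rewrite ltrN10.
  by rewrite ln_ge0// lerDl.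
have Il : mu.-integrable setT (EFin \o (fun x => ln rho * halfline_part q x)).
  by rewrite /comp; under eq_fun do rewrite EFinM; exact: integrableZl.
have wr : \int[mu]_x (ln (1 + rho * x) * halfline_part q x) = r.
  rewrite /Rintegral -(integral_halfline_part dq mw).
  by under eq_integral do rewrite mulrC; rewrite qr.
have E : (fun x => ln (x + rho^-1) * halfline_part q x) =
    (fun x => ln (1 + rho * x) * halfline_part q x - ln rho * halfline_part q x).
  apply/funext => x; have [x0|x0] := ltP x 0; first by rewrite qH// !mulr0 subrr.
  have y0 : 0 < x + rho^-1 by rewrite ltr_wpDl// invr_gt0.
  rewrite (_ : 1 + rho * x = rho * (x + rho^-1)); last by field; rewrite gt_eqF.
  by rewrite lnM ?posrE//; ring.
split; last by rewrite E RintegralB// RintegralZl// wr q1 mulr1.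
rewrite (_ : (fun x => _) = EFin \o (fun x => ln (x + rho^-1) * halfline_part q x))//.
by rewrite E /comp; under eq_fun do rewrite EFinB; exact: integrableB.
Qed.

Section positive_parameter.
Variables (rho r k : R).
Hypothesis rho0 : 0 < rho.
Hypothesis rc : r_crit rho < r.
Hypothesis k0 : 0 < k.
Hypothesis rk : r - ln rho = mp_log_mean k.

Let p (x : R) : R := mp_density k (x + rho^-1).

Let d0 : 0 <= rho^-1. Proof. by rewrite invr_ge0 ltW. Qed.

Let edge : rho^-1 + 2 * Num.sqrt rho^-1 <= k. Proof. exact: gt_critical rc k0 rk. Qed.

Let dp : halfline_density p. Proof. by have [] := mp_halfline_density (ltW k0) edge. Qed.

Let dens : density p.
Proof. by apply: halfline_densityW dp _; exact: (mp_tame (ltW k0) d0 edge). Qed.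

Let pot : {ae mu, forall x : R, 0 <= x ->
  mu.-integrable setT (fun z => (p z * ln `|x - z|)%:E) /\
  (\int[mu]_z (p z * `|ln `|x - z| |)%:E <= ((12 + 4 * k + 2 * rho^-1) * (x + 1))%:E)%E}.
Proof.
apply: negligibleS (mp_potential (ltW k0) d0) => x /= nx n; apply: nx => x0.
by have [] := n x0.
Qed.

Let EL : {ae mu, forall x : R, 0 <= x ->
  mp_ell k - rho^-1 + k * ln (x + rho^-1) <= x - 2 * log_potential p x /\
  (0 < p x -> x - 2 * log_potential p x = mp_ell k - rho^-1 + k * ln (x + rho^-1))}.
Proof.
apply: negligibleS (mp_potential (ltW k0) d0) => x /= nx n; apply: nx => x0.
by have [] := n x0.
Qed.

Let Ih : mu.-integrable setT (fun x => (ln (x + rho^-1) * p x)%:E).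
Proof. by have [] := mp_log_moment rho^-1 (ltW k0) k0. Qed.

Let ih : \int[mu]_x (ln (x + rho^-1) * p x) = r - ln rho.
Proof. by rewrite rk; have [] := mp_log_moment rho^-1 (ltW k0) k0. Qed.

Let dens_at : density_at rho r p.
Proof.
split => //; have mw : measurable_fun setT (fun x : R => ln (1 + rho * x)).
  apply: measurableT_comp; first exact: measurable_ln.
  by apply: measurable_funD => //; exact: measurable_funM.
under eq_integral do rewrite mulrC.
rewrite (integral_halfline_part dens mw) halfline_part_id//.
have [_ _ Ip _ p1] := dp.
have Il : mu.-integrable setT (EFin \o (fun x => ln rho * p x)).
  by rewrite /comp; under eq_fun do rewrite EFinM; exact: integrableZl.
have E : (fun x => ln (1 + rho * x) * p x) = (fun x => ln (x + rho^-1) * p x + ln rho * p x).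
  apply/funext => x; have := mp_density_ge0 k (x + rho^-1); rewrite le_eqVlt.
  move=> /predU1P[|/(mp_supp (ltW k0))/andP[y0 _]].
    by rewrite /p => <-; rewrite !mulr0 addr0.
  rewrite (_ : 1 + rho * x = rho * (x + rho^-1)); last by field; rewrite gt_eqF.
  by rewrite lnM ?posrE//; ring.
have Iw : mu.-integrable setT (EFin \o (fun x => ln (1 + rho * x) * p x)).
  by rewrite E /comp; under eq_fun do rewrite EFinD; exact: integrableD.
transitivity ((\int[mu]_x (ln (1 + rho * x) * p x))%:E).
  by rewrite /Rintegral fineK//; exact: integrable_fin_num.
by congr EFin; rewrite E RintegralD// RintegralZl// ih p1 mulr1 subrK.
Qed.

Let energyE (q : R -> R) : density q -> energy 1 q = coulomb_energy (halfline_part q).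
Proof. exact: energy_halfline_part. Qed.

Let energy_p : energy 1 p = coulomb_energy p.
Proof. by rewrite energyE// halfline_part_id. Qed.

Let energy_min (q : R -> R) : density_at rho r q -> (energy 1 p <= energy 1 q)%E /\
  (energy 1 q = energy 1 p -> {ae mu, forall x, halfline_part q x = p x}).
Proof.
move=> dq; have [Iq iq] := log_moment_halfline_part rho0 dq; case: dq => dq _.
rewrite energy_p energyE//.
exact: (coulomb_energy_min dp pot EL Ih ih (halfline_density_part dq) Iq iq).
Qed.

Lemma opt_density_unique_minimizer :
  unique_minimizer (energy 1) (density_at rho r) (opt_density rho k).
Proof.
rewrite opt_densityE ?ltW//; split; first by split => // q /energy_min[].
move=> q [dq minq]; apply: ae_eq_halfline_part; first by case: dq.
by have [le_pq] := energy_min dq; apply; apply/eqP; rewrite eq_le le_pq minq.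
Qed.

Lemma energy1E : energy1 1 rho r =
  ((k + 3 / 2 - rho^-1 + (k * (r - ln rho) - (k + 1) * ln (k + 1)) / 2)%:E).
Proof.
transitivity (energy 1 p).
  apply/eqP; rewrite eq_le; apply/andP; split.
    by apply: ereal_inf_lbound; exists p.
  by apply: le_ereal_inf_tmp => _ [q dq <-]; have [] := energy_min dq.
rewrite energy_p (coulomb_energy_minimizer dp pot EL Ih ih).
have [_ ->] := mp_halfline_density (ltW k0) edge.
by rewrite /mp_ell; congr EFin; field; rewrite gt_eqF.
Qed.

End positive_parameter.

End minimizers.

Theorem mainTheorem2 (R : realType) (rho r : R)
    (rho_gt0 : 0 < rho) (r_gt : r_crit rho < r) :
  (exists! k : R,
     0 < k /\ r - ln rho = (k + 1) * ln (k + 1) - k * ln k - 1) /\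
  (forall k : R,
     0 < k -> r - ln rho = (k + 1) * ln (k + 1) - k * ln k - 1 ->
     unique_minimizer (energy 1) (density_at rho r) (opt_density rho k) /\
     (energy1 1 rho r - energy0 1 =
       ((k - 1) / 2 * (r - ln rho) + k - 1 / 2 - rho^-1
        - k * ln k / 2)%:E)%E).
Proof.
split; first exact: mp_log_mean_critical.
move=> k k0 rk; split; first exact: opt_density_unique_minimizer rk.
rewrite (energy1E rho_gt0 r_gt k0 rk) energy0E -EFinB rk; congr EFin.
by field; rewrite gt_eqF.
Qed.
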